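(* For $(w,\sigma),(w',\sigma')\in\mathbb R^n\times\mathbb R^k$ and $t>0$ let $$\mathscr B((w,\sigma),(w',\sigma'),t)=\frac{2^k}{(4\pi t)^{\frac n2+k}}\int_{\mathbb R^k}e^{-\frac it\langle\lambda,\sigma'-\sigma\rangle}\left(\frac{|\lambda|}{\sinh|\lambda|}\right)^{\frac n2}e^{-\frac{|\lambda|}{4t\tanh|\lambda|}\left((|w|^2+|w'|^2)-2\langle w,w'\rangle\operatorname{sech}|\lambda|\right)}\,d\lambda .$$ Then for every $f\in\mathscr S(\mathbb R^{n+k})$ the function $$u((w,\sigma),t)=\int_{\mathbb R^n}\int_{\mathbb R^k}\mathscr B((w,\sigma),(w',\sigma'),t)\,f(w',\sigma')\,dw'\,d\sigma'$$ is a solution of the Cauchy problem $$\begin{cases}\Delta_wu+\frac{|w|^2}{4}\Delta_\sigma u-\partial_tu=0&\text{in }\mathbb R^{n+k}\times(0,\infty),\\ u((w,\sigma),0)=f(w,\sigma).\end{cases}$$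
   Context: $w\in\mathbb R^n$, $\sigma\in\mathbb R^k$, and $\mathscr S$ is the Schwartz class. The functions $|\lambda|/\sinh|\lambda|$ and $|\lambda|/\tanh|\lambda|$ are taken equal to $1$ at $\lambda=0$. The initial condition is understood as $u((w,\sigma),t)\to f(w,\sigma)$ pointwise as $t\to0^+$. *)

(* Defs.v *)
From HB Require Import structures.
From mathcomp Require Import all_boot all_order all_algebra.
From mathcomp Require Import complex.
From mathcomp Require Import all_classical all_reals all_analysis.

Set Implicit Arguments.
Unset Strict Implicit.
Unset Printing Implicit Defensive.

Import Order.TTheory GRing.Theory Num.Theory.
Import numFieldNormedType.Exports.
Local Open Scope classical_set_scope.
Local Open Scope ring_scope.
Local Open Scope complex_scope.

(* Lebesgue measure on R^d is built as the d-fold product of the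
   one-dimensional one; it is carried by d-tuples, which the library equips
   with the product sigma-algebra. *)

Section lebesgue_cons.
Context (R : realType) (d : nat).
Local Notation mR := (measurableTypeR R).
Variable mu : {sigma_finite_measure set (d.-tuple mR) -> \bar R}.

Definition tuple_push (p : mR * d.-tuple mR) : d.+1.-tuple mR :=
  [the d.+1.-tuple mR of p.1 :: p.2].

Let tuple_pop (t : d.+1.-tuple mR) : mR * d.-tuple mR :=
  (tnth t ord0, [tuple of behead t]).

Let measurable_tuple_push : measurable_fun setT tuple_push.
Proof. exact: measurable_cons. Qed.

Let measurable_tuple_pop : measurable_fun setT tuple_pop.
Proof.
by apply/measurable_fun_pairP; split;
  [exact: measurable_tnth|exact: measurable_behead].
Qed.

Let tuple_pushK : cancel tuple_push tuple_pop.
Proof. by move=> [x t]; congr pair; exact/val_inj. Qed.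

Definition lebesgue_cons : set (d.+1.-tuple mR) -> \bar R :=
  pushforward (@lebesgue_measure R \x mu)%E tuple_push.

Let lebesgue_cons0 : lebesgue_cons set0 = 0%E.
Proof. by rewrite /lebesgue_cons /pushforward preimage_set0 measure0. Qed.

Let lebesgue_cons_ge0 A : (0 <= lebesgue_cons A)%E.
Proof. exact: measure_ge0. Qed.

Let measurable_preimage_push A : measurable A -> measurable (tuple_push @^-1` A).
Proof. by move=> mA; rewrite -[X in measurable X]setTI; exact: measurable_tuple_push. Qed.

Let lebesgue_cons_sigma_additive : semi_sigma_additive lebesgue_cons.
Proof.
move=> F mF tF mUF; rewrite /lebesgue_cons /pushforward preimage_bigcup.
apply: measure_semi_sigma_additive.
- by move=> n; exact: measurable_preimage_push.
- apply/trivIsetP => /= i j _ _ ij; rewrite -preimage_setI.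
  by move/trivIsetP : tF => /(_ _ _ _ _ ij) ->//; rewrite preimage_set0.
- by rewrite -preimage_bigcup; exact: measurable_preimage_push.
Qed.

HB.instance Definition _ := isMeasure.Build _ _ _ lebesgue_cons
  lebesgue_cons0 lebesgue_cons_ge0 lebesgue_cons_sigma_additive.

Let lebesgue_cons_sigma_finite : sigma_finite setT lebesgue_cons.
Proof.
have /sigma_finiteP[F [TF ndF Foo]] := sigma_finiteT (@lebesgue_measure R).
have /sigma_finiteP[G [TG ndG Goo]] := sigma_finiteT mu.
exists (fun i => tuple_pop @^-1` (F i `*` G i)).
  rewrite -preimage_bigcup; apply/seteqP; split => // x _ /=.
  have [i _ Fi] : (\bigcup_i F i) (tuple_pop x).1 by rewrite -TF.
  have [j _ Gj] : (\bigcup_i G i) (tuple_pop x).2 by rewrite -TG.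
  exists (maxn i j) => //; split.
  - by move: Fi; exact/subsetPset/ndF/leq_maxl.
  - by move: Gj; exact/subsetPset/ndG/leq_maxr.
move=> i; have [mF Fi] := Foo i; have [mG Gi] := Goo i.
have mFG : measurable (F i `*` G i) by exact: measurableX.
split; first by rewrite -[X in measurable X]setTI; exact: measurable_tuple_pop.
rewrite /lebesgue_cons /pushforward -comp_preimage.
rewrite (_ : _ \o _ = id); last by apply/funext => x; exact: tuple_pushK.
by rewrite preimage_id product_measure1E// lte_mul_pinfty// ge0_fin_numE.
Qed.

HB.instance Definition _ := Measure_isSigmaFinite.Build _ _ _ lebesgue_cons
  lebesgue_cons_sigma_finite.

End lebesgue_cons.

Fixpoint lebesgue_tuple (R : realType) (d : nat) :
    {sigma_finite_measure set (d.-tuple (measurableTypeR R)) -> \bar R} :=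
  match d with
  | 0 => dirac [tuple]
  | d'.+1 => lebesgue_cons (lebesgue_tuple R d')
  end.

Definition vec (R : realType) (d : nat) (x : d.-tuple (measurableTypeR R)) :
  'rV[R]_d := \row_i (tnth x i : R).

(* Integration, differentiation and limits of R[i]-valued functions are taken
   on real and imaginary parts. *)

Section complex_valued.
Context (R : realType).

Definition cintegrable d (T : measurableType d)
    (mu : {measure set T -> \bar R}) (g : T -> R[i]) : Prop :=
  mu.-integrable setT (fun x => (complex.Re (g x))%:E) /\
  mu.-integrable setT (fun x => (complex.Im (g x))%:E).

Definition cintegral d (T : measurableType d)
    (mu : {measure set T -> \bar R}) (g : T -> R[i]) : R[i] :=
  (\int[mu]_x complex.Re (g x)) +i* (\int[mu]_x complex.Im (g x)).

Definition ccvg (T : Type) (F : set_system T) (g : T -> R[i]) (l : R[i]) : Prop :=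
  (complex.Re (g x) @[x --> F] --> complex.Re l) /\
  (complex.Im (g x) @[x --> F] --> complex.Im l).

Definition ccontinuous_at (T : topologicalType) (g : T -> R[i]) (x : T) : Prop :=
  ccvg (nbhs x) g (g x).

Definition cderivable (V : normedModType R) (g : V -> R[i]) (x v : V) : Prop :=
  derivable (fun y => complex.Re (g y)) x v /\
  derivable (fun y => complex.Im (g y)) x v.

Definition cderive (V : normedModType R) (g : V -> R[i]) (x v : V) : R[i] :=
  ('D_v (fun y => complex.Re (g y)) x) +i* ('D_v (fun y => complex.Im (g y)) x).

End complex_valued.

Definition dirv (R : realType) (N : nat) (i : 'I_N) : 'rV[R]_N := delta_mx 0 i.

Definition partial (R : realType) (N : nat) (i : 'I_N)
    (g : 'rV[R]_N -> R[i]) : 'rV[R]_N -> R[i] :=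
  fun x => cderive g x (dirv R i).

Definition partials (R : realType) (N : nat) (s : seq 'I_N)
    (g : 'rV[R]_N -> R[i]) : 'rV[R]_N -> R[i] :=
  foldr (@partial R N) g s.

Definition smooth (R : realType) (N : nat) (g : 'rV[R]_N -> R[i]) : Prop :=
  forall (s : seq 'I_N) (x : 'rV[R]_N),
    ccontinuous_at (partials s g) x /\
    forall i : 'I_N, cderivable (partials s g) x (dirv R i).

Definition schwartz (R : realType) (N : nat) (g : 'rV[R]_N -> R[i]) : Prop :=
  smooth g /\
  forall (a : 'I_N -> nat) (s : seq 'I_N), exists M : R, forall x : 'rV[R]_N,
    `|((\prod_(i < N) x 0 i ^+ a i)%:C * partials s g x)| <= M%:C.

(* The library norm on 'rV[R]_d is the sup norm, hence a separate Euclidean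
   norm. *)
Definition dotv (R : realType) (d : nat) (x y : 'rV[R]_d) : R :=
  \sum_(i < d) x 0 i * y 0 i.

Definition enorm (R : realType) (d : nat) (x : 'rV[R]_d) : R :=
  Num.sqrt (dotv x x).

Section kernel.
Context (R : realType).

Definition sinh (x : R) : R := (expR x - expR (- x)) / 2.
Definition cosh (x : R) : R := (expR x + expR (- x)) / 2.
Definition tanh (x : R) : R := sinh x / cosh x.
Definition sech (x : R) : R := (cosh x)^-1.

Definition div_sinh (x : R) : R := if x == 0 then 1 else x / sinh x.
Definition div_tanh (x : R) : R := if x == 0 then 1 else x / tanh x.

Definition expi (x : R) : R[i] := cos x +i* sin x.

Context (n k : nat).

Definition kernel_integrand (w : 'rV[R]_n) (s : 'rV[R]_k)
    (w' : 'rV[R]_n) (s' : 'rV[R]_k) (t : R) (l : 'rV[R]_k) : R[i] :=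
  expi (- (dotv l (s' - s) / t)) *
  (div_sinh (enorm l) `^ (n%:R / 2) *
   expR (- (div_tanh (enorm l) / (4 * t) *
     ((enorm w ^+ 2 + enorm w' ^+ 2) - 2 * dotv w w' * sech (enorm l)))))%:C.

Definition kernelB (w : 'rV[R]_n) (s : 'rV[R]_k)
    (w' : 'rV[R]_n) (s' : 'rV[R]_k) (t : R) : R[i] :=
  (2 ^+ k / (4 * pi * t) `^ (n%:R / 2 + k%:R))%:C *
  cintegral (lebesgue_tuple R k)
    (fun l => kernel_integrand w s w' s' t (vec l)).

(* Points of R^(n+k) are row vectors (w, s), with w = lsubmx x, s = rsubmx x. *)
Definition kernel_solution (f : 'rV[R]_(n + k) -> R[i])
    (x : 'rV[R]_(n + k)) (t : R) : R[i] :=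
  cintegral (lebesgue_tuple R n) (fun w' =>
    cintegral (lebesgue_tuple R k) (fun s' =>
      kernelB (lsubmx x) (rsubmx x) (vec w') (vec s') t *
      f (row_mx (vec w') (vec s')))).

End kernel.

Section cauchy_problem.
Context (R : realType) (n k : nat).
Implicit Types (u : 'rV[R]_(n + k) -> R -> R[i]) (f : 'rV[R]_(n + k) -> R[i]).

Definition space_partial (i : 'I_(n + k)) u : 'rV[R]_(n + k) -> R -> R[i] :=
  fun x t => partial i (u^~ t) x.

Definition time_partial u : 'rV[R]_(n + k) -> R -> R[i] :=
  fun x t => cderive (u x) t 1.

Definition laplacian_w u : 'rV[R]_(n + k) -> R -> R[i] := fun x t =>
  \sum_(i < n) space_partial (lshift k i) (space_partial (lshift k i) u) x t.

Definition laplacian_s u : 'rV[R]_(n + k) -> R -> R[i] := fun x t =>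
  \sum_(j < k) space_partial (rshift n j) (space_partial (rshift n j) u) x t.

Definition continuous_pos u : Prop :=
  forall x t, 0 < t -> ccontinuous_at (fun p => u p.1 p.2) (x, t).

(* C^1 in t and C^2 in x on R^(n+k) x (0, oo) *)
Definition regular21 u : Prop :=
  [/\ continuous_pos u,
      (forall x t, 0 < t -> cderivable (u x) t 1) /\
      continuous_pos (time_partial u),
      (forall i x t, 0 < t -> cderivable (u^~ t) x (dirv R i)) /\
      (forall i, continuous_pos (space_partial i u)) &
      (forall i j x t, 0 < t ->
         cderivable ((space_partial j u)^~ t) x (dirv R i)) /\
      (forall i j, continuous_pos (space_partial i (space_partial j u)))].

Definition solves_cauchy_problem u f : Prop :=
  [/\ regular21 u,
      forall x t, 0 < t ->
        laplacian_w u x t + (enorm (lsubmx x) ^+ 2 / 4)%:C * laplacian_s u x t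
        - time_partial u x t = 0 &
      forall x, ccvg 0^'+ (u x) (f x)].

End cauchy_problem.

(* Main.v *)
(* The substitution [lambda = t xi] turns the kernel into [(2 pi)^-k] times
   the integral over [xi] of [expi (xi . (s - s'))] times a product of Mehler
   kernels in [w]; applied to [f] this gives one integral over [(w', s', xi)].
   For each [xi], with [r = |xi|], [A = r / sinh (r t)] and
   [T = r / tanh (r t)], the integrand solves the equation because
   [A' = - A T], [T' = - A^2] and [T^2 = A^2 + r^2].  Derivatives pass under
   the integral because [A^(n/2)] decays exponentially in [xi], locally
   uniformly in [t > 0].  For the initial value this domination is lost and is
   replaced by integration by parts in [s']; rescaling
   [w' = w + (2 / sqrt A) u] turns the Mehler kernel into a Gaussian in [u] as
   [t -> 0], and what remains is Fourier inversion in [xi], proved by Gaussian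
   regularization. *)
Require Import Defs.
From HB Require Import structures.
From mathcomp Require Import all_boot all_order all_algebra.
From mathcomp Require Import complex.
From mathcomp Require Import all_classical all_reals all_analysis.
From mathcomp Require Import measurable_realfun ring lra.
Import Order.TTheory GRing.Theory Num.Theory.
Import numFieldNormedType.Exports.
Local Open Scope classical_set_scope.
Local Open Scope ring_scope.

Set Implicit Arguments.
Unset Strict Implicit.
Unset Printing Implicit Defensive.

(** * Lebesgue measure on tuples *)

Section tuple_integral.
Context {R : realType}.
Local Notation mR := (measurableTypeR R).
Local Notation leb := (@lebesgue_measure R).

(** The decay of [A^(n/2)] in [xi], which rests on [0 < n], makes the triple integral converge
    absolutely, but only locally uniformly in [t > 0]: as [t -> 0], [A] behaves like [1 / t] and the
    kernel concentrates at [y = w]. No joint domination is kept there, so the integral is reordered: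
    [s'] innermost, where smoothness of [f] gives decay in [xi] independent of [t], then [w'], then
    [xi]. The rescaling of [w'] comes from [T (|w|^2 + |y|^2) - 2 A w.y = A |w - y|^2 + (T - A)
    (|w|^2 + |y|^2)], where [T - A = r^2 / (T + A)] vanishes with [t]. All computations are real.
    The data are a pair [(f1, f2)] and a phase angle [phi] is carried along, so that a derivative in
    [s], which exchanges cosine and sine, is a quarter-turn of [phi]. The integrals then form a
    family indexed by a polynomially growing coefficient and a phase. The derivatives needed stay
    inside this family, and domination is proved once for all its members. *)

Lemma lebesgue_affine (a c : R) (c0 : 0 < c) (A : set R) : measurable A ->
  leb A = (c%:E * leb ((fun x : R => a + c * x)%R @^-1` A))%E.
Proof.
move=> mA.
have mf : measurable_fun setT (fun x : mR => a + c * x : mR).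
  by apply: measurable_funD => //; exact: measurable_funM.
pose fm : {mfun mR >-> mR} := HB.pack (fun x : mR => a + c * x : mR)
  (isMeasurableFun.Build _ _ _ _ _ mf).
pose cp : {nonneg R} := NngNum (ltW c0).
have -> : (c%:E * leb ((fun x => a + c * x)%R @^-1` A))%E =
          mscale cp (pushforward leb fm) A by [].
(* Lebesgue measure is determined by its values on the half-open intervals []x, y]], so only these
   are compared. *)
apply: lebesgue_measure_unique => //= _ [[x y]] _ <- /=.
rewrite /mscale /pushforward /=.
pose I : set R := `](x - a) / c, (y - a) / c]%classic.
transitivity (c%:E * leb I)%E; last first.
  congr (_ * leb _)%E; apply/seteqP; split => z /=.
    by rewrite /I/= !in_itv/= ltr_pdivrMr // ler_pdivlMr // ltrBlDl lerBrDl mulrC.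
  by rewrite /I/= !in_itv/= ltr_pdivrMr // ler_pdivlMr // ltrBlDl lerBrDl mulrC.
rewrite /I !lebesgue_measure_itv/= !lte_fin ltr_pM2r ?invr_gt0 // ltrD2r.
case: ifP => _; last by rewrite mule0.
rewrite -!EFinB -EFinM; congr (_%:E).
by rewrite -mulrBl opprB addrA subrK mulrC divfK // gt_eqF.
Qed.

Lemma ge0_integral_affine (a c : R) (F : R -> \bar R) : 0 < c ->
  measurable_fun setT F -> (forall x, 0 <= F x)%E ->
  (\int[leb]_x F x = c%:E * \int[leb]_x F (a + c * x)%R)%E.
Proof.
move=> c0 mF F0.
have mf : measurable_fun setT (fun x : mR => a + c * x : mR).
  by apply: measurable_funD => //; exact: measurable_funM.
pose fm : {mfun mR >-> mR} := HB.pack (fun x : mR => a + c * x : mR)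
  (isMeasurableFun.Build _ _ _ _ _ mf).
pose cp : {nonneg R} := NngNum (ltW c0).
rewrite (@eq_measure_integral _ _ _ _ (mscale cp (pushforward leb fm))).
  rewrite ge0_integral_mscale //.
  by congr (_ * _)%E; rewrite ge0_integral_pushforward.
by move=> A mA _; rewrite /mscale/=; exact: lebesgue_affine.
Qed.

Lemma ge0_integral_cons d (F : d.+1.-tuple mR -> \bar R) :
  measurable_fun setT F -> (forall x, 0 <= F x)%E ->
  (\int[lebesgue_tuple R d.+1]_x F x =
   \int[leb]_x \int[lebesgue_tuple R d]_y F [the d.+1.-tuple mR of x :: y])%E.
Proof.
move=> mF F0.
have mp : measurable_fun setT (@tuple_push R d) by exact: measurable_cons.
transitivity (\int[leb \x lebesgue_tuple R d]_p F (tuple_push p))%E.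
  rewrite -(@ge0_integral_pushforward _ _ _ _ _ _ mp (leb \x lebesgue_tuple R d)%E setT) //.
rewrite fubini_tonelli1 //; exact: measurableT_comp.
Qed.

Lemma integral_tuple0 (F : 0.-tuple mR -> \bar R) :
  (\int[lebesgue_tuple R 0]_x F x = F [tuple])%E.
Proof.
rewrite (_ : F = cst (F [tuple])); last by apply/funext => x; rewrite (tuple0 x).
rewrite /= integral_cst //= diracT mule1 //.
Qed.

Definition affine_tuple d (a : 'I_d -> R) (c : R) (x : d.-tuple mR) : d.-tuple mR :=
  [tuple (a i + c * tnth x i : mR) | i < d].

Lemma measurable_affine_tuple d a c : measurable_fun setT (@affine_tuple d a c).
Proof.
apply/measurable_fun_tnthP => i.
rewrite (_ : _ \o _ = fun x => a i + c * tnth x i); last first.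
  by apply/funext => x /=; rewrite tnth_mktuple.
apply: measurable_funD => //; apply: measurable_funM => //; exact: measurable_tnth.
Qed.

Lemma affine_tuple_cons d (a : 'I_d.+1 -> R) c (x : mR) (y : d.-tuple mR) :
  affine_tuple a c [the d.+1.-tuple mR of x :: y] =
  [the d.+1.-tuple mR of (a ord0 + c * x) :: affine_tuple (a \o lift ord0) c y].
Proof.
apply: eq_from_tnth => i; rewrite tnth_mktuple.
case: (unliftP ord0 i) => [j|] ->.
  by rewrite !tnthS tnth_mktuple.
by rewrite !tnth0.
Qed.

(** Tonelli splits off the head coordinate; the induction hypothesis rescales the tail and
    [ge0_integral_affine] the head. Nonnegative integrands avoid integrability conditions; the
    signed version is [Rintegral_affine]. *)
Lemma ge0_integral_affine_tuple d (a : 'I_d -> R) c (F : d.-tuple mR -> \bar R) :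
  0 < c -> measurable_fun setT F -> (forall x, 0 <= F x)%E ->
  (\int[lebesgue_tuple R d]_x F x =
   (c ^+ d)%:E * \int[lebesgue_tuple R d]_x F (affine_tuple a c x))%E.
Proof.
move=> c0; elim: d => [|d IH] in a F * => mF F0.
  by rewrite !integral_tuple0 mul1e (tuple0 (affine_tuple _ _ _)).
rewrite ge0_integral_cons // ge0_integral_cons //; last first.
  by apply: measurableT_comp => //; exact: measurable_affine_tuple.
have mF2 : measurable_fun setT (fun p : mR * d.-tuple mR => F [the d.+1.-tuple mR of p.1 :: p.2]).
  by apply: measurableT_comp => //; exact: measurable_cons.
transitivity (\int[leb]_x ((c ^+ d)%:E * \int[lebesgue_tuple R d]_y
    F [the d.+1.-tuple mR of x :: affine_tuple (a \o lift ord0) c y]))%E.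
  apply: eq_integral => x _.
  rewrite (IH (a \o lift ord0)) //.
  exact: (measurableT_comp mF2 (measurable_pair1 x)).
have mF3 : measurable_fun setT (fun x : mR => \int[lebesgue_tuple R d]_y
    F [the d.+1.-tuple mR of x :: affine_tuple (a \o lift ord0) c y])%E.
  apply: (measurable_fun_fubini_tonelli_F (fun p : mR * d.-tuple mR =>
    F [the d.+1.-tuple mR of p.1 :: affine_tuple (a \o lift ord0) c p.2])) => //.
  apply: measurableT_comp => //; apply: measurable_cons => //.
  by apply: measurableT_comp => //; exact: measurable_affine_tuple.
rewrite ge0_integralZl //; last 2 first.
  by move=> x _; exact: integral_ge0.
  by rewrite lee_fin exprn_ge0 // ltW.
rewrite [in LHS](ge0_integral_affine (a ord0) c0) //; last by move=> x; exact: integral_ge0.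
rewrite muleA -EFinM exprSr; congr (_ * _)%E.
by apply: eq_integral => x _; apply: eq_integral => y _; rewrite affine_tuple_cons.
Qed.

Lemma ge0_integral_prod_tuple d (h : 'I_d -> R -> R) :
  (forall i x, 0 <= h i x) -> (forall i, measurable_fun setT (h i)) ->
  (\int[lebesgue_tuple R d]_x (\prod_(i < d) h i (tnth x i))%:E =
   \prod_(i < d) \int[leb]_x (h i x)%:E)%E.
Proof.
elim: d => [|d IH] in h * => h0 mh.
  by rewrite integral_tuple0 !big_ord0.
have mp m (g : 'I_m -> R -> R) : (forall i, measurable_fun setT (g i)) ->
    measurable_fun setT (fun x : m.-tuple mR => \prod_(i < m) g i (tnth x i)).
  move=> mg; apply: measurable_prod => i _.
  by apply: (measurableT_comp (mg i)); exact: measurable_tnth.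
rewrite ge0_integral_cons; last 2 first.
  by apply/measurable_EFinP; exact: mp.
  by move=> x; rewrite lee_fin; apply: prodr_ge0 => i _.
transitivity (\int[leb]_x ((h ord0 x)%:E * \prod_(i < d) \int[leb]_y (h (lift ord0 i) y)%:E))%E.
  apply: eq_integral => x _.
  rewrite -(IH (fun i => h (lift ord0 i))) // -ge0_integralZl ?lee_fin //; last first.
  - by move=> y _; rewrite lee_fin; apply: prodr_ge0.
  - by apply/measurable_EFinP; apply: (mp _ (fun i => h (lift ord0 i))).
  apply: eq_integral => y _; rewrite big_ord_recl tnth0 EFinM.
  by congr (_ * (_)%:E)%E; apply: eq_bigr => i _; rewrite tnthS.
rewrite ge0_integralZr //; last 3 first.
- by apply/measurable_EFinP; exact: mh.
- by move=> x _; rewrite lee_fin.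
- by apply: prode_ge0 => i _; apply: integral_ge0 => x _; rewrite lee_fin.
by rewrite big_ord_recl.
Qed.

End tuple_integral.

(** * Parametric integrals and Fubini *)

Section real_integrals.
Context {R : realType}.

Lemma Rintegral_dominated_cvg d (T : measurableType d)
    (mu : {measure set T -> \bar R}) (f_ : nat -> T -> R) (f g : T -> R) :
  (forall n, measurable_fun setT (f_ n)) ->
  (forall x, f_ ^~ x @ \oo --> f x) ->
  mu.-integrable setT (EFin \o g) ->
  (forall n x, `|f_ n x| <= g x) ->
  \int[mu]_x f_ n x @[n --> \oo] --> \int[mu]_x f x.
Proof.
move=> mf cf ig fg.
have mlim : measurable_fun setT f.
  by apply: (measurable_fun_cvg mf) => x _; exact: cf.
have [|||||intf _ cvgf] := @dominated_convergence _ T R mu setT measurableT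
  (fun n x => (f_ n x)%:E) (EFin \o f) (EFin \o g).
- by move=> n; exact/measurable_EFinP.
- exact/measurable_EFinP.
- apply: aeW => x _ /=; apply: cvg_EFin; first exact: nearW.
  exact: cf.
- exact: ig.
- by apply: aeW => x n _ /=; rewrite lee_fin.
apply: fine_cvg; rewrite fineK //.
exact: integrable_fin_num.
Qed.

Lemma integrable_dominated d (T : measurableType d)
    (mu : {measure set T -> \bar R}) (f g : T -> R) :
  measurable_fun setT f -> mu.-integrable setT (EFin \o g) ->
  (forall x, `|f x| <= g x) -> mu.-integrable setT (EFin \o f).
Proof.
move=> mf ig fg; apply: (le_integrable measurableT _ _ ig).
  exact/measurable_EFinP.
by move=> x _ /=; rewrite lee_fin (le_trans (fg x)) // ler_norm.
Qed.

(** Dominated convergence is sequential, so continuity is proved by contradiction: failure yields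
    points within [1 / (n + 1)] of [p] whose integrals stay at distance [e]. *)
Lemma continuous_Rintegral d (T : measurableType d)
    (mu : {measure set T -> \bar R}) (V : normedModType R) (f : V -> T -> R)
    (p : V) (g : T -> R) :
  (\forall q \near p, measurable_fun setT (f q)) ->
  (forall x, {for p, continuous (f ^~ x)}) ->
  mu.-integrable setT (EFin \o g) ->
  (\forall q \near p, forall x, `|f q x| <= g x) ->
  {for p, continuous (fun q => \int[mu]_x f q x)}.
Proof.
move=> mf cf ig fg; apply/cvgrPdist_lt => e e0; apply: contrapT => nfar.
have pick n : exists q, [/\ `|p - q| < n.+1%:R^-1, measurable_fun setT (f q),
    forall x, `|f q x| <= g x & e <= `|\int[mu]_x f p x - \int[mu]_x f q x|].
  apply: contrapT => nq; apply: nfar.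
  have h0 : 0 < n.+1%:R^-1 :> R by rewrite invr_gt0.
  near=> q; rewrite ltNge; apply/negP => bad; apply: nq; exists q.
  split; last exact: bad.
  - near: q. exact: (@cvgr_dist_lt R V V (nbhs p) _ id p (@cvg_id _ (nbhs p)) _ h0).
  - by near: q.
  - by near: q.
have [u Hu] := choice pick.
have up : u n @[n --> \oo] --> p.
  apply/cvgrPdist_lt => r r0.
  near=> n; have [+ _ _ _] := Hu n => /lt_le_trans; apply.
  rewrite ltW //; near: n; exact: near_infty_natSinv_lt (PosNum r0).
have /cvgrPdist_lt /(_ e e0) [N _ /(_ N)] := @Rintegral_dominated_cvg _ _ mu
  (fun n => f (u n)) (f p) g (fun n => let: And4 _ m _ _ := Hu n in m)
  (fun x => cvg_comp _ _ up (cf x)) ig (fun n => let: And4 _ _ m _ := Hu n in m).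
rewrite /= leqnn => /(_ isT); have [_ _ _] := Hu N.
by move=> /le_lt_trans /[apply]; rewrite ltxx.
Unshelve. all: by end_near. Qed.

Lemma is_derive_Rintegral d (T : measurableType d)
    (mu : {measure set T -> \bar R}) (f f' : R -> T -> R) (a u v : R)
    (G : T -> R) :
  a \in `]u, v[ ->
  (forall x, x \in `]u, v[ -> mu.-integrable setT (EFin \o f x)) ->
  (forall x y, x \in `]u, v[ -> is_derive x 1 (f ^~ y) (f' x y)) ->
  mu.-integrable setT (EFin \o G) ->
  (forall x y, x \in `]u, v[ -> `|f' x y| <= G y) ->
  is_derive a 1 (fun x => \int[mu]_y f x y) (\int[mu]_y f' a y).
Proof.
move=> auv intf df intG fG.
have dE x y : x \in `]u, v[ -> partial1of2 f x y = f' x y.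
  by move=> xuv; rewrite partial1of2E; have := df x y xuv => ?; exact: derive_val.
have G0 y : 0 <= G y by apply: le_trans (fG a y auv).
have H1 : forall x y, `]u, v[%classic x -> setT y -> derivable (f ^~ y) x 1.
  by move=> x y xuv _; have ? := df x y xuv; exact: ex_derive.
have H2 : forall x y, `]u, v[%classic x -> setT y -> `|partial1of2 f x y| <= G y.
  by move=> x y xuv _; rewrite dE //; exact: fG.
have := @derivable_under_integral _ _ _ mu f setT measurableT a u v auv intf H1 G G0 intG H2.
have := @differentiation_under_integral _ _ _ mu f setT measurableT a u v auv intf H1 G G0 intG H2.
rewrite derive1E => e1 e2; apply: DeriveDef => //.
rewrite e1; apply: eq_Rintegral => y _; exact: dE.
Qed.

Lemma lee_abs_fine (x : \bar R) : (`|(fine x)%:E| <= `|x|)%E.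
Proof. by case: x => [r| |] /=; rewrite ?normr0 ?leey. Qed.

Section fubini.
Context d1 d2 (T1 : measurableType d1) (T2 : measurableType d2).
Variable m1 : {sigma_finite_measure set T1 -> \bar R}.
Variable m2 : {sigma_finite_measure set T2 -> \bar R}.
Variable f : T1 * T2 -> R.
Hypothesis intf : (m1 \x m2)%E.-integrable setT (EFin \o f).

Lemma integrable_Rfubini1 :
  m1.-integrable setT (EFin \o (fun x => \int[m2]_y f (x, y))).
Proof.
apply: (le_integrable measurableT _ _ (integrable_fubini_F intf)).
  apply/measurable_EFinP; apply: measurableT_comp => //.
  exact: (measurable_fubini_F intf).
by move=> x _ /=; exact: lee_abs_fine.
Qed.

(** The real inner integral is the [fine] of the extended one. The two agree wherever the slice is
    integrable, hence almost everywhere, which is all the outer integral sees. *)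
Lemma Rintegral_fubini1 :
  \int[(m1 \x m2)%E]_p f p = \int[m1]_x \int[m2]_y f (x, y).
Proof.
congr fine; rewrite -(integral12_prod_meas1 intf).
apply: ae_eq_integral => //.
- exact: (measurable_fubini_F intf).
- by have /integrableP[] := integrable_Rfubini1.
have [N [mN N0 sN]] := ae_integrable1 intf.
exists N; split => // x /= nx; apply: sN => /= ix; apply: nx => _.
by rewrite /Rintegral /fubini_F fineK //; apply: integrable_fin_num.
Qed.

(** The inner integral is bounded by that of the absolute value, whose outer integral is finite
    because [f] is integrable on the product. *)
Lemma integrable_Rfubini2 :
  m2.-integrable setT (EFin \o (fun y => \int[m1]_x f (x, y))).
Proof.
have mG := measurable_fubini_G intf.
have mf : measurable_fun setT (EFin \o f) by case/integrableP: intf.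
have iG : m2.-integrable setT (fubini_G m1 (EFin \o f)).
  apply/integrableP; split => //.
  apply: le_lt_trans ((integrable21ltyP _ _ mf).1 intf).
  apply: ge0_le_integral => //.
  - exact: measurableT_comp.
  - apply: (measurable_fun_fubini_tonelli_G (abse \o (EFin \o f))).
    exact: measurableT_comp.
    by move=> x; exact: abse_ge0.
  - move=> y _; rewrite /fubini_G; apply: le_abse_integral => //.
    exact: (measurableT_comp mf).
apply: (le_integrable measurableT _ _ iG).
  apply/measurable_EFinP; exact: (measurableT_comp (fine_measurable measurableT)).
by move=> x _ /=; exact: lee_abs_fine.
Qed.

Lemma Rintegral_fubini2 :
  \int[(m1 \x m2)%E]_p f p = \int[m2]_y \int[m1]_x f (x, y).
Proof.
congr fine; rewrite -(integral21_prod_meas1 intf).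
apply: ae_eq_integral => //.
- exact: (measurable_fubini_G intf).
- by have /integrableP[] := integrable_Rfubini2.
have [N [mN N0 sN]] := ae_integrable2 intf.
exists N; split => // x /= nx; apply: sN => /= ix; apply: nx => _.
by rewrite /Rintegral /fubini_G fineK //; apply: integrable_fin_num.
Qed.

End fubini.

Section sigma_finite_product.
Context d1 d2 (T1 : measurableType d1) (T2 : measurableType d2).
Variable m1 : {sigma_finite_measure set T1 -> \bar R}.
Variable m2 : {sigma_finite_measure set T2 -> \bar R}.

(* On [product_measure1] itself, instance inference only finds the
   sigma-finite structure when both factors are finite. *)
Definition sigma_product : set (T1 * T2) -> \bar R := (m1 \x m2)%E.

HB.instance Definition _ := Measure.on sigma_product.

Let sigma_product_sigma_finite : sigma_finite setT sigma_product.
Proof.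
have /sigma_finiteP[F [TF ndF Foo]] := sigma_finiteT m1.
have /sigma_finiteP[G [TG ndG Goo]] := sigma_finiteT m2.
exists (fun i => F i `*` G i).
  rewrite -setXTT TF TG; apply/seteqP; split => [[x y] /= [[i _ Fi] [j _ Gj]]|].
    exists (maxn i j) => //; split.
    - by move: Fi; exact/subsetPset/ndF/leq_maxl.
    - by move: Gj; exact/subsetPset/ndG/leq_maxr.
  by move=> [x y] [i _ [Fi Gi]]; split; exists i.
move=> i; have [mF Fi] := Foo i; have [mG Gi] := Goo i.
split; first exact: measurableX.
by rewrite [sigma_product _]product_measure1E// lte_mul_pinfty// ge0_fin_numE.
Qed.

HB.instance Definition _ := Measure_isSigmaFinite.Build _ _ _ sigma_product
  sigma_product_sigma_finite.

End sigma_finite_product.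

Lemma integrable_prodM d1 d2 (T1 : measurableType d1) (T2 : measurableType d2)
    (m1 : {sigma_finite_measure set T1 -> \bar R})
    (m2 : {sigma_finite_measure set T2 -> \bar R}) (g : T1 -> R) (h : T2 -> R) :
  m1.-integrable setT (EFin \o g) -> m2.-integrable setT (EFin \o h) ->
  (m1 \x m2)%E.-integrable setT (EFin \o (fun p => g p.1 * h p.2)).
Proof.
move=> ig ih.
have mg : measurable_fun setT g by case/integrableP: ig => /measurable_EFinP.
have mh : measurable_fun setT h by case/integrableP: ih => /measurable_EFinP.
apply/integrable12ltyP.
  by apply/measurable_EFinP; apply: measurable_funM; apply: measurableT_comp.
rewrite [ltLHS](_ : _ = \int[m1]_x (`|g x|%:E * \int[m2]_y `|h y|%:E))%E; last first.
  apply: eq_integral => x _ /=; rewrite -ge0_integralZl ?lee_fin //.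
  - by apply: eq_integral => y _; rewrite normrM EFinM.
  - by apply/measurable_EFinP; apply: measurableT_comp.
rewrite ge0_integralZr //; last 2 first.
- by apply/measurable_EFinP; apply: measurableT_comp.
- exact: integral_ge0.
case/integrableP: ig => _ /= ig; case/integrableP: ih => _ /= ih.
apply: lte_mul_pinfty => //; first exact: integral_ge0.
by rewrite ge0_fin_numE //; exact: integral_ge0.
Qed.

End real_integrals.

(** * Measurability of continuous functions of row vectors *)

Section measurable_rV.
Context {R : realType}.

(** Only the coordinates of [X] are assumed measurable; no sigma-algebra on row vectors enters.
    Rounding the coordinates down to multiples of [1 / (m + 1)] leaves countably many values, so the
    composite with [g] is measurable; continuity of [g] then gives a pointwise limit. *)
Lemma continuous_rV_comp_measurable N d (T : measurableType d)
    (g : 'rV[R]_N -> R) (X : T -> 'rV[R]_N) :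
  continuous g -> (forall i, measurable_fun setT (fun t => X t 0 i)) ->
  measurable_fun setT (fun t => g (X t)).
Proof.
move=> cg mX.
pose z (m : nat) t : {ffun 'I_N -> int} := [ffun i => Num.floor (X t 0 i * m.+1%:R)].
pose q (m : nat) (y : {ffun 'I_N -> int}) : 'rV[R]_N := \row_i ((y i)%:~R / m.+1%:R).
apply: (@measurable_fun_cvg _ _ _ _ (fun m t => g (q m (z m t)))).
  move=> m _ B mB; rewrite setTI.
  (* Countable union over the grid points, enumerated by [pickle] on integer-valued finite
     functions. *)
  rewrite (_ : _ @^-1` _ = \bigcup_(j in setT) (match unpickle j with
     | Some y => [set t | g (q m y) \in B /\ forall i, z m t i = y i]
     | None => set0 end)); last first.
    apply/seteqP; split => t /=.
      move=> Bt; exists (pickle (z m t)) => //; rewrite pickleK /=; split => //.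
      exact/mem_set.
    move=> [j _]; case: unpickle => // y /= [/set_mem gB zy].
    by rewrite (_ : z m t = y) //; apply/ffunP.
  apply: bigcup_measurable => j _; case: unpickle => // y.
  have [gB|gB] := boolP (g (q m y) \in B); last first.
    by rewrite (_ : [set _ | _] = set0) //; apply/seteqP; split => // t [].
  rewrite (_ : [set _ | _] = \bigcap_(i in [set: 'I_N]) [set t | z m t i = y i]).
    apply: fin_bigcap_measurable => [|i _]; first exact: finite_finset.
    rewrite (_ : [set _ | _] = (fun t => X t 0 i * m.+1%:R) @^-1` `[(y i)%:~R, (y i + 1)%:~R[%classic).
      rewrite -[X in measurable X]setTI; apply: measurable_funM => //.
    apply/seteqP; split => t /=; rewrite /z ffunE in_itv/=.
      by move=> <-; exact: floor_itv.
    move=> h; exact: floor_def.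
  by apply/seteqP; split => t /=; [move=> [_ h] i _|move=> h; split => // i]; exact: h.
move=> t _.
suff qX : q m (z m t) @[m --> \oo] --> X t by exact: (cvg_comp _ _ qX (cg (X t))).
apply/cvgrPdist_le => e e0; near=> m.
rewrite [`|_|]mx_normrE; apply/bigmax_leP; split; first exact: ltW.
move=> [i j] _ /=; rewrite !mxE /z ffunE ord1.
have m0 : 0 < m.+1%:R :> R by [].
have -> : X t 0 j - (Num.floor (X t 0 j * m.+1%:R))%:~R / m.+1%:R =
    (X t 0 j * m.+1%:R - (Num.floor (X t 0 j * m.+1%:R))%:~R) / m.+1%:R.
  by rewrite mulrBl mulfK // gt_eqF.
have /andP[f1 f2] := floor_itv (X t 0 j * m.+1%:R).
rewrite ger0_norm; last by rewrite mulr_ge0 ?invr_ge0 ?subr_ge0.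
apply: (@le_trans _ _ (m.+1%:R^-1)).
  rewrite ler_piMl ?invr_ge0 // lerBlDl.
  by move: f2; rewrite intrD => /ltW.
by rewrite ltW //; near: m; exact: near_infty_natSinv_lt (PosNum e0).
Unshelve. all: by end_near. Qed.

End measurable_rV.

(** * Polynomially decaying weights *)

Section directional.
Context {R : realType} {V : normedModType R}.

(** Both difference quotients are the same function of [h]. This carries one-variable rules, and
    differentiation under the integral, over to directional derivatives. *)
Lemma is_derive_line (F : V -> R) (x v : V) (a l : R) :
  is_derive (a *: v + x) v F l <-> is_derive a 1 (fun h => F (h *: v + x)) l.
Proof.
have E : (fun h => h^-1 *: ((F \o shift (a *: v + x)) (h *: v) - F (a *: v + x))) =
  (fun h => h^-1 *: (((fun h => F (h *: v + x)) \o shift a) (h *: (1 : R)) - F (a *: v + x))).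
  by apply/funext => h /=; rewrite addrA -scalerDl [h *: 1]mulr1.
by split => -[d1 d2]; split; rewrite ?/derivable ?/derive in d1 d2 *; rewrite ?E // -?E.
Qed.

Lemma is_derive_line0 (F : V -> R) (x v : V) (l : R) :
  is_derive x v F l <-> is_derive (0 : R) 1 (fun h => F (h *: v + x)) l.
Proof. by rewrite -is_derive_line scale0r add0r. Qed.

End directional.

Section weights.
Context {R : realType}.
Local Notation mR := (measurableTypeR R).
Local Notation leb := (@lebesgue_measure R).
Local Notation lebt := (@lebesgue_tuple R).

(** A product rather than a power of a norm: the integral of its inverse factors into integrals of
    [1 / (1 + x^2)], and the weight is multiplicative under concatenation. *)
Definition wt d (x : 'rV[R]_d) : R := \prod_(i < d) (1 + x 0 i ^+ 2).

Lemma measurable_vec d (i : 'I_d) :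
  measurable_fun setT (fun x : d.-tuple mR => vec x 0 i).
Proof.
rewrite (_ : (fun _ => _) = (@tnth _ mR ^~ i)); first exact: measurable_tnth.
by apply/funext => x; rewrite mxE.
Qed.

Lemma add1sqr_ge1 (x : R) : 1 <= 1 + x ^+ 2.
Proof. by rewrite lerDl sqr_ge0. Qed.

Lemma wt_ge1 d (x : 'rV[R]_d) : 1 <= wt x.
Proof.
rewrite /wt; elim/big_ind: _ => // [a b a1 b1|i _]; last exact: add1sqr_ge1.
by rewrite -[1]mulr1 ler_pM.
Qed.

Lemma wt_gt0 d (x : 'rV[R]_d) : 0 < wt x.
Proof. exact: lt_le_trans (wt_ge1 x). Qed.

Lemma add1sqr_le_wt d (x : 'rV[R]_d) i : 1 + x 0 i ^+ 2 <= wt x.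
Proof.
rewrite /wt (bigD1 i) //= ler_peMr //; first exact: le_trans (add1sqr_ge1 _).
elim/big_ind: _ => // [a b a1 b1|j _]; last exact: add1sqr_ge1.
by rewrite -[1]mulr1 ler_pM.
Qed.

Lemma coord_le_wt d (x : 'rV[R]_d) i : `|x 0 i| <= wt x.
Proof.
apply: le_trans (add1sqr_le_wt x i); rewrite -[_ ^+ 2]real_normK ?num_real //.
have : 0 <= (`|x 0 i| - 1) ^+ 2 by exact: sqr_ge0.
have : 0 <= `|x 0 i| by [].
set y := `|_|; nra.
Qed.

Lemma measurable_wtV d :
  measurable_fun setT (fun x : d.-tuple mR => (wt (vec x))^-1).
Proof.
rewrite (_ : (fun _ => _) = fun x : d.-tuple mR => \prod_(i < d) (1 + vec x 0 i ^+ 2)^-1).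
  apply: measurable_prod => i _.
  apply: (measurableT_comp (continuous_measurable_fun (@continuous_oneDsqrV R))).
  exact: measurable_vec.
by apply/funext => x; rewrite /wt prodfV.
Qed.

Lemma integral_add1sqrV : (\int[leb]_x ((1 + x ^+ 2)^-1)%:E = pi%:E)%E.
Proof.
rewrite (@ge0_symfun_integralT _ (fun x => (1 + x ^+ 2)^-1)).
- rewrite (_ : [set x | _] = `[0, +oo[%classic); last first.
    by apply/seteqP; split => x/=; rewrite in_itv/= andbT.
  have := integral0y_oneDsqr R; rewrite /oneDsqr => ->.
  by rewrite -EFinM; congr (_%:E); field.
- by move=> x; rewrite invr_ge0 (le_trans _ (add1sqr_ge1 _)).
- exact: continuous_oneDsqrV.
- by move=> x/=; rewrite sqrrN.
Qed.

Lemma integrable_wtV d :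
  (lebt d).-integrable setT (EFin \o (fun x => (wt (vec x))^-1)).
Proof.
apply/integrableP; split.
  by apply/measurable_EFinP; exact: measurable_wtV.
rewrite [ltLHS](_ : _ = \prod_(i < d) \int[leb]_x ((1 + x ^+ 2)^-1)%:E)%E.
  under eq_bigr do rewrite integral_add1sqrV.
  by rewrite prodEFin ltry.
rewrite -(@ge0_integral_prod_tuple R d (fun _ x => (1 + x ^+ 2)^-1)).
- apply: eq_integral => x _ /=; congr (_%:E).
  rewrite ger0_norm ?invr_ge0 ?(ltW (wt_gt0 _)) // /wt -prodfV.
  by apply: eq_bigr => i _; rewrite mxE.
- by move=> _ x; rewrite invr_ge0 (le_trans _ (add1sqr_ge1 _)).
- move=> _; exact: (continuous_measurable_fun continuous_oneDsqrV).
Qed.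

Lemma vec_affine_tuple d (a : 'rV[R]_d) c (x : d.-tuple mR) :
  vec (affine_tuple (fun i => a 0 i) c x) = a + c *: vec x.
Proof. by apply/rowP => i; rewrite !mxE tnth_mktuple. Qed.

Lemma integrable_affine d (a : 'rV[R]_d) (c : R) (f : 'rV[R]_d -> R) : 0 < c ->
  (lebt d).-integrable setT (EFin \o (fun x => f (vec x))) ->
  (lebt d).-integrable setT (EFin \o (fun x => f (a + c *: vec x))).
Proof.
move=> c0 /integrableP[mf intf]; apply/integrableP.
have mfa : measurable_fun setT (EFin \o (fun x : d.-tuple mR => f (a + c *: vec x))).
  rewrite (_ : _ \o _ = (EFin \o (fun x => f (vec x))) \o affine_tuple (fun i => a 0 i) c).
    by apply: (measurableT_comp mf); exact: measurable_affine_tuple.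
  by apply/funext => x /=; rewrite vec_affine_tuple.
split=> //; move: intf.
rewrite (@ge0_integral_affine_tuple _ _ (fun i => a 0 i) c) //; last exact: measurableT_comp.
rewrite (_ : (\int[_]_x _ = \int[lebt d]_x `|(f (a + c *: vec x))%:E|)%E); last first.
  by apply: eq_integral => x _ /=; rewrite vec_affine_tuple.
case: (\int[_]_x _)%E => [r| |]; rewrite ?ltry ?ltNyr //.
by rewrite gt0_muley ?ltxx // lte_fin exprn_gt0.
Qed.

(** The positive and negative parts are rescaled separately; integrability makes both integrals
    finite, so the factor [c ^+ d] can be taken out of their difference. *)
Lemma Rintegral_affine d (a : 'rV[R]_d) (c : R) (f : 'rV[R]_d -> R) : 0 < c ->
  (lebt d).-integrable setT (EFin \o (fun x => f (vec x))) ->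
  \int[lebt d]_x f (vec x) = c ^+ d * \int[lebt d]_x f (a + c *: vec x).
Proof.
move=> c0 intf.
pose g (x : d.-tuple mR) := (f (vec x))%:E.
have mg : measurable_fun setT g by case/integrableP: intf.
have E (h : d.-tuple mR -> \bar R) : measurable_fun setT h -> (forall x, 0 <= h x)%E ->
    (\int[lebt d]_x h x = (c ^+ d)%:E * \int[lebt d]_x h (affine_tuple (fun i => a 0%R i) c x))%E.
  by move=> mh h0; exact: ge0_integral_affine_tuple.
rewrite /Rintegral [in LHS]integralE E; last 2 first.
- exact: measurable_funepos.
- by move=> x; exact: funepos_ge0.
rewrite [X in (_ - X)%E]E; last 2 first.
- exact: measurable_funeneg.
- by move=> x; exact: funeneg_ge0.
have ia := integrable_affine a c0 intf.
have fp := integrable_pos_fin_num measurableT ia.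
have fn := integrable_neg_fin_num measurableT ia.
rewrite [in RHS]integralE.
have Ep : (\int[lebt d]_x (fun x => (f (vec x))%:E)^\+ (affine_tuple (fun i => a 0%R i) c x) =
  \int[lebt d]_x (fun x => (f (a + c *: vec x)%R)%:E)^\+ x)%E.
  by apply: eq_integral => x _; rewrite !funeposE vec_affine_tuple.
have En : (\int[lebt d]_x (fun x => (f (vec x))%:E)^\- (affine_tuple (fun i => a 0%R i) c x) =
  \int[lebt d]_x (fun x => (f (a + c *: vec x)%R)%:E)^\- x)%E.
  by apply: eq_integral => x _; rewrite !funenegE vec_affine_tuple.
rewrite Ep En -muleBr //; first by rewrite fineM // fin_numB fp fn.
by rewrite fin_num_adde_defr.
Qed.

Lemma Rintegral_shift d (a : 'rV[R]_d) (f : 'rV[R]_d -> R) :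
  (lebt d).-integrable setT (EFin \o (fun x => f (vec x))) ->
  \int[lebt d]_x f (vec x + a) = \int[lebt d]_x f (vec x).
Proof.
move=> intf; rewrite (Rintegral_affine a ltr01 intf) expr1n mul1r.
by apply: eq_Rintegral => x _; rewrite scale1r addrC.
Qed.

(** Only coordinate [j] moves. With [y] its value, [y^2 <= 2 (h + y)^2 + 2 h^2], the difference
    being [(2 h + y)^2]; since [h^2 <= 1], this gives [1 + y^2 <= 3 (1 + (h + y)^2)]. *)
Lemma wtV_shift d (x : 'rV[R]_d) (j : 'I_d) (h : R) : `|h| <= 1 ->
  (wt (h *: dirv R j + x))^-1 <= 3 * (wt x)^-1.
Proof.
move=> h1; rewrite -[3]invrK -invfM lef_pV2 ?posrE ?mulr_gt0 ?invr_gt0 ?wt_gt0 //.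
rewrite /wt (bigD1 j) //= [leRHS](bigD1 j) //= mulrA.
rewrite (eq_bigr (fun i => 1 + (h *: dirv R j + x) 0 i ^+ 2)); last first.
  by move=> i ij; rewrite !mxE eqxx /= (negbTE ij) mulr0 add0r.
apply: ler_wpM2r.
  by apply: prodr_ge0 => i _; rewrite (le_trans _ (add1sqr_ge1 _)).
rewrite !mxE !eqxx /= mulr1.
have : h ^+ 2 <= 1 by rewrite -real_normK ?num_real // expr_le1.
have : 0 <= (2 * h + x 0 j) ^+ 2 by exact: sqr_ge0.
set y := x 0 j; nra.
Qed.

(* Translating the integral along [dirv R j] does not change it, so its
   derivative, the integral of [F'], vanishes. *)
Lemma Rintegral_derive_eq0 d (j : 'I_d) (F F' : 'rV[R]_d -> R) (C : R) :
  measurable_fun setT (fun x : d.-tuple mR => F (vec x)) ->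
  (forall x, is_derive x (dirv R j) F (F' x)) ->
  (forall x, `|F x| <= C * (wt x)^-1) ->
  (forall x, `|F' x| <= C * (wt x)^-1) ->
  \int[lebt d]_x F' (vec x) = 0.
Proof.
move=> mF dF bF bF'.
have ifF : (lebt d).-integrable setT (EFin \o (fun x => F (vec x))).
  apply: (integrable_dominated (g := fun x => C * (wt (vec x))^-1)) => //.
  exact: integrableZl (integrable_wtV d).
have C0 : 0 <= C.
  have := le_trans (normr_ge0 _) (bF 0).
  by rewrite pmulr_lge0 // invr_gt0 wt_gt0.
have inI (h : R) : h \in `](-1), 1[ -> `|h| <= 1.
  by rewrite in_itv /= ler_norml => /andP[/ltW -> /ltW ->].
have D : is_derive (0 : R) 1 (fun h => \int[lebt d]_x F (h *: dirv R j + vec x))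
    (\int[lebt d]_x F' (0 *: dirv R j + vec x)).
  apply: (@is_derive_Rintegral _ _ _ _ (fun h x => F (h *: dirv R j + vec x))
    (fun h x => F' (h *: dirv R j + vec x)) 0 (-1) 1 (fun x => C * (3 * (wt (vec x))^-1))).
  - by rewrite in_itv /= ltr01 ltrN10.
  - move=> h _; have := integrable_affine (h *: dirv R j) ltr01 ifF.
    by apply: eq_integrable => // x _ /=; rewrite scale1r.
  - move=> h x _; exact: ((is_derive_line F (vec x) (dirv R j) h _).1 (dF _)).
  - exact: (integrableZl _ C (integrableZl _ 3 (integrable_wtV d))).
  - move=> h x hI; apply: le_trans (bF' _) _.
    by apply: ler_wpM2l => //; apply: wtV_shift; exact: inI.
have E : (fun h => \int[lebt d]_x F (h *: dirv R j + vec x)) = cst (\int[lebt d]_x F (vec x)).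
  apply/funext => h; rewrite /= -(Rintegral_shift (h *: dirv R j)) //.
  by apply: eq_Rintegral => x _; rewrite addrC.
rewrite E in D; have := @derive_val _ _ _ _ _ _ _ D.
rewrite derive_cst => ->.
by apply: eq_Rintegral => x _; rewrite scale0r add0r.
Qed.

End weights.

(** * The Mehler coefficients *)

Section hyperbolic.
Context {R : realType}.
Implicit Types r t x : R.

(** On each open half-line the inverse is, up to sign, [expR (- ln |x|)]; the default value
    [0^-1 = 0] is a separate case. *)
Lemma measurable_invr : measurable_fun setT (fun x : R => x^-1).
Proof.
rewrite (_ : (fun _ => _) = fun x : R => if x == 0 then 0 else
  if 0 < x then expR (- ln x) else - expR (- ln (- x))).
  have mln : measurable_fun setT (fun x : R => expR (- ln x)).
    apply: (measurableT_comp (@measurable_expR R)).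
    apply: measurableT_comp => //; exact: measurable_ln.
  apply: measurable_fun_ifT => //.
    by apply: measurable_fun_eqr.
  apply: measurable_fun_ifT => //.
    by apply: measurable_fun_ltr.
  apply: measurableT_comp => //.
  apply: (@measurableT_comp _ _ _ _ _ _ _ _ (fun x : R => - x) mln).
  exact: oppr_measurable.
apply/funext => x; case: (ltgtP x 0) => [x0|x0|->]; last by rewrite invr0.
  by rewrite expRN lnK ?posrE ?oppr_gt0 // invrN opprK.
by rewrite expRN lnK.
Qed.

Lemma cosh_gt0 x : 0 < cosh x.
Proof. by rewrite divr_gt0 // addr_gt0 // expR_gt0. Qed.

Lemma cosh_ge1 x : 1 <= cosh x.
Proof.
rewrite ler_pdivlMr // mul1r expRN.
have e0 := expR_gt0 x; set y := expR x in e0 *.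
rewrite -subr_ge0 (_ : _ - _ = (y - 1) ^+ 2 / y); last by field; rewrite gt_eqF.
by rewrite divr_ge0 ?sqr_ge0 // ltW.
Qed.

Lemma cosh2_sinh2 x : cosh x ^+ 2 = 1 + sinh x ^+ 2.
Proof.
rewrite /cosh /sinh expRN; have := expR_gt0 x; set y := expR x => e0.
by field; rewrite gt_eqF.
Qed.

Lemma sinh_gt0 x : 0 < x -> 0 < sinh x.
Proof. by move=> x0; rewrite divr_gt0 // subr_gt0 ltr_expR; lra. Qed.

Lemma sinh0 : sinh 0 = 0 :> R.
Proof. by rewrite /sinh oppr0 subrr mul0r. Qed.

Lemma is_derive_expRN x : is_derive x 1 (fun y => expR (- y)) (- expR (- x)).
Proof.
rewrite -mulrN1; apply: (@is_derive1_comp _ expR -%R).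
Qed.

Lemma is_derive_sinh x : is_derive x 1 (@sinh R) (cosh x).
Proof.
have := is_derive_expRN x => h.
apply: is_derive_eq; rewrite /cosh opprK !scaler0 add0r /GRing.scale /=; lra.
Qed.

Lemma is_derive_cosh x : is_derive x 1 (@cosh R) (sinh x).
Proof.
have := is_derive_expRN x => h.
apply: is_derive_eq; rewrite /sinh !scaler0 add0r /GRing.scale /=; lra.
Qed.

(** With [y = e^(x/2)], [2 sinh x = (y - 1/y) (y + 1/y)]; the first factor is at least [x / 2], the
    second at least [y]. This is the source of the exponential decay of [mehlerA]. *)
Lemma sinh_ge x : 0 <= x -> x * expR (x / 2) / 4 <= sinh x.
Proof.
move=> x0; rewrite /sinh expRN.
have e1 := expR_ge1Dx (x / 2).
rewrite (_ : expR x = expR (x / 2) ^+ 2); last first.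
  by rewrite -expRM_natl; congr expR; field.
move: e1; set y := expR (x / 2) => e1.
have y1 : 0 < y by apply: expR_gt0.
have y2 : y^-1 <= 1 by rewrite invf_le1 //; lra.
have y3 : y * y^-1 = 1 by rewrite divff // gt_eqF.
rewrite expr2 invfM; have z0 : 0 < y^-1 by rewrite invr_gt0.
set z := y^-1 in z0 y2 y3 *.
suff : x * y / 2 <= y * y - z * z by lra.
have -> : y * y - z * z = (y - z) * (y + z) by ring.
have : x / 2 <= y - z by lra.
nra.
Qed.

(* [mehlerA r t = r / sinh (r t)] and [mehlerT r t = r / tanh (r t)], extended
   by [1 / t] at [r = 0]. *)
Definition mehlerA r t : R := div_sinh (r * t) / t.
Definition mehlerT r t : R := div_tanh (r * t) / t.

Lemma mehlerA0 t : mehlerA 0 t = t^-1.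
Proof. by rewrite /mehlerA mul0r /div_sinh eqxx mul1r. Qed.

Lemma mehlerT0 t : mehlerT 0 t = t^-1.
Proof. by rewrite /mehlerT mul0r /div_tanh eqxx mul1r. Qed.

Lemma mehlerAE r t : 0 < r -> 0 < t -> mehlerA r t = r / sinh (r * t).
Proof.
move=> r0 t0; rewrite /mehlerA /div_sinh gt_eqF ?mulr_gt0 //.
by have := sinh_gt0 (mulr_gt0 r0 t0) => s0; field; rewrite !gt_eqF.
Qed.

Lemma mehlerTE r t : 0 < r -> 0 < t ->
  mehlerT r t = r * cosh (r * t) / sinh (r * t).
Proof.
move=> r0 t0; rewrite /mehlerT /div_tanh gt_eqF ?mulr_gt0 // /tanh.
have := sinh_gt0 (mulr_gt0 r0 t0) => s0; have := cosh_gt0 (r * t) => c0.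
by field; rewrite !gt_eqF.
Qed.

Section bounds.
Variables (r t : R).
Hypotheses (r0 : 0 <= r) (t0 : 0 < t).

Lemma mehlerA_gt0 : 0 < mehlerA r t.
Proof.
move: r0; rewrite le_eqVlt => /predU1P[<-|r1]; first by rewrite mehlerA0 invr_gt0.
by rewrite mehlerAE // divr_gt0 // sinh_gt0 // mulr_gt0.
Qed.

Lemma mehlerA_leT : mehlerA r t <= mehlerT r t.
Proof.
move: r0; rewrite le_eqVlt => /predU1P[<-|r1]; first by rewrite mehlerA0 mehlerT0.
rewrite mehlerAE // mehlerTE // ler_pM2r ?invr_gt0 ?sinh_gt0 ?mulr_gt0 //.
by rewrite ler_peMr // cosh_ge1.
Qed.

Lemma mehlerT_sqr : mehlerT r t ^+ 2 = mehlerA r t ^+ 2 + r ^+ 2.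
Proof.
move: r0; rewrite le_eqVlt => /predU1P[<-|r1].
  by rewrite mehlerA0 mehlerT0 expr0n /= addr0.
rewrite mehlerAE // mehlerTE // expr_div_n exprMn cosh2_sinh2.
by have := sinh_gt0 (mulr_gt0 r1 t0) => s0; field; rewrite gt_eqF.
Qed.

(** Absorbs the factor [sech] in the cross term of the kernel's exponent, leaving a quadratic form
    in [A] and [T] alone. *)
Lemma mehlerT_sech : mehlerT r t * sech (r * t) = mehlerA r t.
Proof.
move: r0; rewrite le_eqVlt => /predU1P[<-|r1].
  rewrite mehlerA0 mehlerT0 mul0r /sech /cosh oppr0 expR0.
  by field; rewrite gt_eqF.
rewrite mehlerAE // mehlerTE // /sech.
have := sinh_gt0 (mulr_gt0 r1 t0) => s0; have := cosh_gt0 (r * t) => c0.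
by field; rewrite !gt_eqF.
Qed.

Lemma mehlerA_le : mehlerA r t <= 4 / t * expR (- (r * t / 2)).
Proof.
move: r0; rewrite le_eqVlt => /predU1P[<-|r1].
  rewrite mehlerA0 !mul0r oppr0 expR0 mulr1 ler_peMl ?invr_ge0 ?ltW //; lra.
rewrite mehlerAE // ler_pdivrMr ?sinh_gt0 ?mulr_gt0 //.
have := sinh_ge (mulr_ge0 r0 (ltW t0)).
rewrite expRN; have := expR_gt0 (r * t / 2); set y := expR _ => y0 h.
have E : r = (4 / t * y^-1) * (r * t * y / 4) by field; rewrite !gt_eqF.
rewrite [leLHS]E ler_wpM2l //.
by apply/ltW; rewrite mulr_gt0 // ?divr_gt0 // invr_gt0.
Qed.

(** From [T^2 = A^2 + r^2 <= (A + r)^2] and [A <= 4 / t]. Growth linear in [r] is what later lets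
    [T] serve as a polynomially bounded coefficient. *)
Lemma mehlerT_le : mehlerT r t <= 4 / t + r.
Proof.
have A1 : mehlerA r t <= 4 / t.
  apply: le_trans mehlerA_le _; rewrite ler_piMr //; first by rewrite divr_ge0 // ltW.
  by rewrite -expR0 ler_expR oppr_le0 divr_ge0 // mulr_ge0 // ltW.
have := mehlerT_sqr; have := mehlerA_gt0; have := mehlerA_leT.
move: A1 r0; set A := mehlerA _ _; set T := mehlerT _ _ => A1 r0' AT A0 E.
suff : T <= A + r by lra.
rewrite leNgt; apply/negP => h.
have h1 : 0 < T - (A + r) by lra.
have h2 : 0 < T + (A + r) by lra.
have h3 : 0 <= A * r by rewrite mulr_ge0 // ltW.
have := mulr_gt0 h1 h2; nra.
Qed.

(** The case [r = 0] is treated apart: there [A = T = 1 / t], and the formula reads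
    [(1 / t)' = - 1 / t^2]. *)
Lemma is_derive_mehlerA :
  is_derive t 1 (mehlerA r) (- (mehlerA r t * mehlerT r t)).
Proof.
move: r0; rewrite le_eqVlt => /predU1P[<-|r1].
  rewrite (_ : mehlerA 0 = fun t => t^-1); last by apply/funext => s; rewrite mehlerA0.
  rewrite mehlerT0; apply: is_derive_eq.
    by apply: is_deriveV; rewrite gt_eqF.
  by rewrite /GRing.scale /= mulr1 -invfM expr2.
have s0 : sinh (r * t) != 0 by rewrite gt_eqF // sinh_gt0 // mulr_gt0.
apply: (near_eq_is_derive (f := fun t => r * (sinh (r * t))^-1)).
  near=> s; rewrite mehlerAE //; near: s; exact: lt_nbhsr.
have d1 : is_derive t 1 (fun s => sinh (r * s)) (cosh (r * t) * r).
  apply: (@is_derive1_comp _ (@sinh R)); first exact: is_derive_sinh.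
  by apply: is_derive_eq; rewrite /GRing.scale /= mulr1.
have d2 := @is_deriveV _ (fun s => sinh (r * s)) _ _ _ s0 d1.
apply: is_derive_eq; rewrite mehlerAE // mehlerTE // /GRing.scale /=.
by field.
Unshelve. all: by end_near. Qed.

Lemma is_derive_mehlerT : is_derive t 1 (mehlerT r) (- mehlerA r t ^+ 2).
Proof.
move: r0; rewrite le_eqVlt => /predU1P[<-|r1].
  rewrite (_ : mehlerT 0 = fun t => t^-1); last by apply/funext => s; rewrite mehlerT0.
  rewrite mehlerA0; apply: is_derive_eq.
    by apply: is_deriveV; rewrite gt_eqF.
  by rewrite /GRing.scale /= mulr1 exprVn.
have s0 : sinh (r * t) != 0 by rewrite gt_eqF // sinh_gt0 // mulr_gt0.
apply: (near_eq_is_derive (f := fun t => r * cosh (r * t) * (sinh (r * t))^-1)).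
  near=> s; rewrite mehlerTE //; near: s; exact: lt_nbhsr.
have dr : is_derive t 1 (fun s => r * s) r.
  by apply: is_derive_eq; rewrite /GRing.scale /= mulr1.
have d1 : is_derive t 1 (fun s => sinh (r * s)) (cosh (r * t) * r).
  by apply: (@is_derive1_comp _ (@sinh R)); first exact: is_derive_sinh.
have d3 : is_derive t 1 (fun s => cosh (r * s)) (sinh (r * t) * r).
  by apply: (@is_derive1_comp _ (@cosh R)); first exact: is_derive_cosh.
have d2 := @is_deriveV _ (fun s => sinh (r * s)) _ _ _ s0 d1.
apply: is_derive_eq; rewrite mehlerAE // /GRing.scale /=.
have := cosh2_sinh2 (r * t); set c := cosh _; set s := sinh _ in s0 * => cs.
suff -> : r * c * (- s ^- 2 * (c * r)) + s^-1 * (r * (s * r)) =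
  - (c ^+ 2 - s ^+ 2) * r ^+ 2 / s ^+ 2 by rewrite cs; field.
by field.
Unshelve. all: by end_near. Qed.

End bounds.

Lemma measurable_mehlerA t : measurable_fun setT (mehlerA ^~ t).
Proof.
apply: measurable_funM => //.
apply: (@measurableT_comp _ _ _ _ _ _ (@div_sinh R) _ (fun r => r * t)); last exact: measurable_funM.
apply: measurable_fun_ifT => //; first exact: measurable_fun_eqr.
apply: measurable_funM => //.
apply: (measurableT_comp measurable_invr).
apply: continuous_measurable_fun => x; apply/differentiable_continuous.
by apply/derivable1_diffP; have := is_derive_sinh x => ?; exact: ex_derive.
Qed.

Lemma measurable_mehlerT t : measurable_fun setT (mehlerT ^~ t).
Proof.
apply: measurable_funM => //.
apply: (@measurableT_comp _ _ _ _ _ _ (@div_tanh R) _ (fun r => r * t)); last exact: measurable_funM.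
apply: measurable_fun_ifT => //; first exact: measurable_fun_eqr.
apply: measurable_funM => //.
apply: (measurableT_comp measurable_invr).
apply: measurable_funM.
  apply: continuous_measurable_fun => x; apply/differentiable_continuous.
  by apply/derivable1_diffP; have := is_derive_sinh x => ?; exact: ex_derive.
apply: (measurableT_comp measurable_invr).
apply: continuous_measurable_fun => x; apply/differentiable_continuous.
by apply/derivable1_diffP; have := is_derive_cosh x => ?; exact: ex_derive.
Qed.

End hyperbolic.

(** * Schwartz functions *)

Section euclid.
Context {R : realType}.

Lemma dotvC d (x y : 'rV[R]_d) : dotv x y = dotv y x.
Proof. by apply: eq_bigr => i _; rewrite mulrC. Qed.

Lemma dotv_ge0 d (x : 'rV[R]_d) : 0 <= dotv x x.
Proof. by apply: sumr_ge0 => i _; rewrite -expr2 sqr_ge0. Qed.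

Lemma enorm_ge0 d (x : 'rV[R]_d) : 0 <= enorm x.
Proof. exact: sqrtr_ge0. Qed.

Lemma enorm_sqr d (x : 'rV[R]_d) : enorm x ^+ 2 = dotv x x.
Proof. by rewrite sqr_sqrtr // dotv_ge0. Qed.

Lemma dotv_le d (x y : 'rV[R]_d) : 2 * dotv x y <= dotv x x + dotv y y.
Proof.
rewrite /dotv mulr_sumr -big_split /=; apply: ler_sum => i _.
have := sqr_ge0 (x 0 i - y 0 i); rewrite expr2; lra.
Qed.

Lemma coord_le_enorm d (x : 'rV[R]_d) i : `|x 0 i| <= enorm x.
Proof.
rewrite -(@ler_pXn2r _ 2) ?nnegrE ?enorm_ge0 // enorm_sqr real_normK ?num_real //.
rewrite /dotv (bigD1 i) //= expr2 lerDl.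
by apply: sumr_ge0 => j _; rewrite -expr2 sqr_ge0.
Qed.

Lemma wt_le_enorm d (x : 'rV[R]_d) : wt x <= (1 + enorm x) ^+ (2 * d).
Proof.
have -> : (1 + enorm x) ^+ (2 * d) = \prod_(i < d) (1 + enorm x) ^+ 2.
  by rewrite prodr_const card_ord exprM.
apply: ler_prod => i _.
rewrite (le_trans ler01 (add1sqr_ge1 _)) /=.
have := coord_le_enorm x i; have := enorm_ge0 x.
have : x 0 i ^+ 2 = `|x 0 i| ^+ 2 by rewrite real_normK ?num_real.
move=> ->; have := normr_ge0 (x 0 i).
set a := `|_|; set b := enorm _; nra.
Qed.

(** Expanding the product gives [wt x >= 1 + |x|^2 >= |x|]. *)
Lemma enorm_le_wt d (x : 'rV[R]_d) : enorm x <= wt x.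
Proof.
have P (s : seq 'I_d) : 1 + \sum_(i <- s) x 0 i ^+ 2 <= \prod_(i <- s) (1 + x 0 i ^+ 2).
  elim: s => [|i s IH]; first by rewrite !(big_nil, addr0).
  rewrite !big_cons; move: IH; set a := \sum_(_ <- _) _; set b := \prod_(_ <- _) _.
  have a0 : 0 <= a by apply: sumr_ge0 => j _; exact: sqr_ge0.
  have := sqr_ge0 (x 0 i); set c := x 0 i ^+ 2; nra.
apply: le_trans (P _).
have -> : \sum_i x 0 i ^+ 2 = enorm x ^+ 2.
  by rewrite enorm_sqr; apply: eq_bigr => i _; rewrite expr2.
have := sqr_ge0 (enorm x - 1); nra.
Qed.

(** Each factor [1 + r] is paid for with half of the rate: [1 + r <= (1 + 2/c) (1 + c r / 2) <= (1 +
    2/c) e^(c r / 2)]. *)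
Lemma expr_le_expR (c : R) (m : nat) : 0 < c ->
  exists2 C : R, 0 < C & forall r, 0 <= r -> (1 + r) ^+ m <= C * expR (c * r).
Proof.
elim: m c => [|m IH] c c0.
  exists 1 => // r r0; rewrite expr0 mul1r -expR0 ler_expR mulr_ge0 //; exact: ltW.
have [//|C C0 HC] := IH (c / 2); first by rewrite divr_gt0.
have K0 : 0 < 1 + 2 / c by rewrite addr_gt0 // divr_gt0.
exists (C * (1 + 2 / c)) => [|r r0]; first by rewrite mulr_gt0.
have -> : expR (c * r) = expR (c / 2 * r) * expR (c / 2 * r).
  by rewrite -expRD; congr expR; field.
rewrite exprSr mulrACA; apply: ler_pM => //; last 2 first.
- exact: HC.
- apply: le_trans (ler_wpM2l (ltW K0) (expR_ge1Dx (c / 2 * r))).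
  have -> : (1 + 2 / c) * (1 + c / 2 * r) = 1 + r + 2 / c + c / 2 * r.
    by field; rewrite gt_eqF.
  have := divr_gt0 (ltr0Sn R 1) c0; have := mulr_ge0 (ltW c0) r0; lra.
- by rewrite exprn_ge0 // addr_ge0.
- by rewrite addr_ge0.
Qed.

Lemma expRN_enorm_le d (c : R) (m : nat) : 0 < c ->
  exists2 C : R, 0 < C &
    forall x : 'rV[R]_d, expR (- (c * enorm x)) <= C / wt x ^+ m.
Proof.
move=> c0; have [C C0 HC] := expr_le_expR (2 * d * m) c0.
exists C => // x; rewrite ler_pdivlMr ?exprn_gt0 ?wt_gt0 //.
rewrite expRN ler_pdivrMl ?expR_gt0 // mulrC.
apply: le_trans (HC _ (enorm_ge0 x)).
rewrite exprM; apply: lerXn2r (wt_le_enorm x).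
  by rewrite nnegrE (ltW (wt_gt0 _)).
by rewrite nnegrE exprn_ge0 // addr_ge0 // enorm_ge0.
Qed.

Lemma wt_row_mx a b (x : 'rV[R]_a) (y : 'rV[R]_b) :
  wt (row_mx x y) = wt x * wt y.
Proof.
rewrite /wt big_split_ord /=; congr (_ * _); apply: eq_bigr => i _.
  by rewrite row_mxEl.
by rewrite row_mxEr.
Qed.

Lemma measurable_sumr d (T : measurableType d) I (s : seq I) (h : I -> T -> R) :
  (forall i, measurable_fun setT (h i)) ->
  measurable_fun setT (fun x => \sum_(i <- s) h i x).
Proof. by move=> mh; apply: measurable_sum. Qed.

Lemma measurable_dotv d (T : measurableType d) m (x y : T -> 'rV[R]_m) :
  (forall i, measurable_fun setT (fun t => x t 0 i)) ->
  (forall i, measurable_fun setT (fun t => y t 0 i)) ->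
  measurable_fun setT (fun t => dotv (x t) (y t)).
Proof.
by move=> mx my; apply: measurable_sumr => i; apply: measurable_funM.
Qed.

Lemma measurable_enorm d (T : measurableType d) m (x : T -> 'rV[R]_m) :
  (forall i, measurable_fun setT (fun t => x t 0 i)) ->
  measurable_fun setT (fun t => enorm (x t)).
Proof.
move=> mx; apply: (@measurableT_comp _ _ _ _ _ _ (@Num.sqrt R)).
  apply: continuous_measurable_fun; exact: sqrt_continuous.
exact: measurable_dotv.
Qed.

End euclid.

Section directional_rules.
Context {R : realType} {V : normedModType R}.

Lemma is_derive_comp_dir (f : R -> R) (g : V -> R) (x v : V) (a b : R) :
  is_derive (g x) 1 f a -> is_derive x v g b ->
  is_derive x v (f \o g) (a * b).
Proof.
move=> df /is_derive_line0 dg; apply/is_derive_line0.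
apply: (@is_derive1_comp _ f (fun h => g (h *: v + x))) => //.
by rewrite scale0r add0r.
Qed.

End directional_rules.

Lemma is_derive_coord {R : realType} N (x v : 'rV[R]_N) (i : 'I_N) :
  is_derive x v (fun y : 'rV[R]_N => y 0 i) (v 0 i).
Proof.
apply/is_derive_line0.
rewrite (_ : (fun _ => _) = fun h : R => h * v 0 i + x 0 i); last first.
  by apply/funext => h; rewrite !mxE.
apply: is_derive_eq; rewrite /GRing.scale /=; ring.
Qed.

(** * Rapidly decreasing real functions *)

Section rapid_decay.
Context {R : realType} {N : nat}.
Implicit Types g : 'rV[R]_N -> R.

Definition rpartial (i : 'I_N) g : 'rV[R]_N -> R := fun x => 'D_(dirv R i) g x.

Definition rpartials (s : seq 'I_N) g := foldr rpartial g s.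

(** The Schwartz condition in the form used below: decay against every power of [wt] instead of
    bounds for each monomial, for one real function, so that real and imaginary parts can be
    recombined freely. *)
Definition rschwartz g := forall s : seq 'I_N,
  [/\ continuous (rpartials s g),
      forall i x, derivable (rpartials s g) x (dirv R i) &
      forall m, exists M, forall x, `|rpartials s g x| <= M / wt x ^+ m].

Lemma rschwartz_partial i g : rschwartz g -> rschwartz (rpartial i g).
Proof.
move=> sg s; have := sg (rcons s i).
by rewrite /rpartials foldr_rcons.
Qed.

Lemma rschwartzN g : rschwartz g -> rschwartz (\- g).
Proof.
move=> sg s.
have E : rpartials s (\- g) = \- (rpartials s g).
  elim: s => //= i s ->; apply/funext => x; rewrite /rpartial deriveN //.
  by have [_ d _] := sg s; exact: d.
have [c d b] := sg s; rewrite E; split.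
- by move=> x; apply: continuousN; exact: c.
- by move=> i x; apply: derivableN; exact: d.
- by move=> m; have [M HM] := b m; exists M => x; rewrite normrN.
Qed.

(** Multiplying by one factor [1 + x_j^2] adds the bound for the exponents [a] to the one for [a]
    raised by 2 at [j]; hence the induction over a list of coordinates, with [a] general. *)
Lemma monomial_decay (g : 'rV[R]_N -> R) :
  (forall a : 'I_N -> nat, exists M, forall x : 'rV[R]_N, `|\prod_(i < N) x 0 i ^+ a i * g x| <= M) ->
  forall m, exists M, forall x, `|g x| <= M / wt x ^+ m.
Proof.
move=> H m.
have P (l : seq 'I_N) : forall a, exists M, forall x : 'rV[R]_N,
    \prod_(i <- l) (1 + x 0 i ^+ 2) * `|\prod_(i < N) x 0 i ^+ a i * g x| <= M.
  elim: l => [|j l IH] a.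
    by have [M HM] := H a; exists M => x; rewrite big_nil mul1r.
  have [M1 H1] := IH a.
  have [M2 H2] := IH (fun i => a i + (i == j) * 2)%N.
  exists (M1 + M2) => x; rewrite big_cons.
  apply: le_trans (lerD (H1 x) (H2 x)).
  rewrite -mulrA mulrDl mul1r lerD2l mulrCA ler_wpM2l //.
    by apply: prodr_ge0 => i _; rewrite (le_trans ler01 (add1sqr_ge1 _)).
  rewrite -[X in X * _]ger0_norm ?sqr_ge0 // -normrM mulrA.
  rewrite [in leRHS](eq_bigr (fun i => x 0 i ^+ a i * x 0 i ^+ ((i == j) * 2))); last first.
    by move=> i _; rewrite exprD.
  rewrite big_split /= [X in _ <= `|_ * X * _|](bigD1 j) //= eqxx mul1n.
  rewrite [X in _ <= `|_ * (_ * X) * _|]big1 ?mulr1 1?[_ ^+ 2 * _]mulrC //.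
  by move=> i /negbTE ->; rewrite mul0n expr0.
(* Listing every coordinate [m] times makes the product over the list equal to [wt x ^+ m]. *)
have [M HM] := P (flatten (nseq m (index_enum 'I_N))) (fun=> 0%N).
exists M => x; rewrite ler_pdivlMr ?exprn_gt0 ?wt_gt0 // mulrC.
apply: le_trans (HM x).
rewrite [X in `|X * _|]big1 ?mul1r // ler_wpM2r //.
by elim: m {HM P} => [|m IH] /=; rewrite ?big_nil ?expr0 // big_cat exprS ler_pM // ltW // ?exprn_gt0 ?wt_gt0.
Qed.

Lemma schwartz_Re (f : 'rV[R]_N -> R[i]) :
  schwartz f -> rschwartz (fun x => complex.Re (f x)).
Proof.
move=> [sm dec] s.
have E u : rpartials u (fun x => complex.Re (f x)) = (fun x => complex.Re (partials u f x)).
  by elim: u => //= i u ->.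
rewrite E; split.
- by move=> x; have [[c _] _] := sm s x; exact: c.
- by move=> i x; have [_ d] := sm s x; have [? _] := d i.
apply: monomial_decay => a; have [M HM] := dec a s; exists M => x.
have := HM x; case: (partials s f x) => u v /=.
rewrite lecE /= => /andP[_]; apply: le_trans.
rewrite !mul0r !subr0 !addr0.
by rewrite -[leLHS]sqrtr_sqr ler_wsqrtr // lerDl sqr_ge0.
Qed.

Lemma schwartz_Im (f : 'rV[R]_N -> R[i]) :
  schwartz f -> rschwartz (fun x => complex.Im (f x)).
Proof.
move=> [sm dec] s.
have E u : rpartials u (fun x => complex.Im (f x)) = (fun x => complex.Im (partials u f x)).
  by elim: u => //= i u ->.
rewrite E; split.
- by move=> x; have [[_ c] _] := sm s x; exact: c.
- by move=> i x; have [_ d] := sm s x; have [_ ?] := d i.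
apply: monomial_decay => a; have [M HM] := dec a s; exists M => x.
have := HM x; case: (partials s f x) => u v /=.
rewrite lecE /= => /andP[_]; apply: le_trans.
rewrite !mul0r !subr0 !addr0.
by rewrite -[leLHS]sqrtr_sqr ler_wsqrtr // lerDr sqr_ge0.
Qed.

End rapid_decay.

(** * The kernel integrand and its symbols *)

Lemma continuous_at_sum {R : realType} (V : topologicalType) I (s : seq I)
    (h : I -> V -> R) (p : V) :
  (forall i, {for p, continuous (h i)}) ->
  {for p, continuous (fun q => \sum_(i <- s) h i q)}.
Proof.
move=> ch; elim: s => [|i s IH].
  rewrite (_ : (fun _ => _) = cst 0); first exact: cst_continuous.
  by apply/funext => q; rewrite big_nil.
rewrite (_ : (fun _ => _) = fun q => h i q + \sum_(j <- s) h j q).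
  by apply: continuousD => //; exact: ch.
by apply/funext => q; rewrite big_cons.
Qed.

(** Along a line, the linear and quadratic expressions below become polynomials in [h], so this
    single derivative at 0 settles them. *)
Lemma is_derive_quad {R : realType} (a b c : R) :
  is_derive (0 : R) 1 (fun h => a + b * h + c * h ^+ 2) b.
Proof. by apply: is_derive_eq; rewrite /GRing.scale /=; ring. Qed.

Section dotv_linear.
Context {R : realType} {d : nat}.
Implicit Types x y z : 'rV[R]_d.

Lemma dotvDl x y z : dotv (x + y) z = dotv x z + dotv y z.
Proof. by rewrite /dotv -big_split; apply: eq_bigr => i _; rewrite mxE mulrDl. Qed.

Lemma dotvDr x y z : dotv x (y + z) = dotv x y + dotv x z.
Proof. by rewrite dotvC dotvDl !(dotvC _ x). Qed.

Lemma dotvZl a x y : dotv (a *: x) y = a * dotv x y.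
Proof. by rewrite /dotv mulr_sumr; apply: eq_bigr => i _; rewrite mxE mulrA. Qed.

Lemma dotvZr a x y : dotv x (a *: y) = a * dotv x y.
Proof. by rewrite dotvC dotvZl dotvC. Qed.

Lemma dotvNr x y : dotv x (- y) = - dotv x y.
Proof. by rewrite -scaleN1r dotvZr mulN1r. Qed.

Lemma dotv_dirv x i : dotv x (dirv R i) = x 0 i.
Proof.
rewrite /dotv (bigD1 i) //= mxE !eqxx mulr1 big1 ?addr0 // => j ji.
by rewrite mxE eqxx (negbTE ji) mulr0.
Qed.

Lemma dotv0r x : dotv x 0 = 0.
Proof. by rewrite /dotv big1 // => i _; rewrite mxE mulr0. Qed.

End dotv_linear.

Section mehler_kernel.
Context {R : realType} {n k : nat}.
Local Notation mR := (measurableTypeR R).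
Local Notation P := ('rV[R]_(n + k) * R)%type.
Local Notation Om := ((n.-tuple mR * k.-tuple mR) * k.-tuple mR)%type.
Implicit Types (p q : P) (y : 'rV[R]_n) (z xi : 'rV[R]_k) (X : 'rV[R]_(n + k)).

Definition wt3 y z xi : R := wt y * wt z * wt xi.

(** Here and below [p = (X, t)] with [X = (w, s)], and [y], [z], [xi] stand for [w'], [s'] and
    [lambda / t]. *)
Definition kA p xi := mehlerA (enorm xi) p.2.
Definition kT p xi := mehlerT (enorm xi) p.2.

Definition mquad p y xi : R :=
  kT p xi * (dotv (lsubmx p.1) (lsubmx p.1) + dotv y y)
  - 2 * kA p xi * dotv (lsubmx p.1) y.

(** Logarithm of the unnormalized Mehler kernel [A^(n/2) exp (- mquad / 4)]. In exponential form,
    each derivative is multiplication by a logarithmic derivative. *)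
Definition mexp p y xi : R := n%:R / 2 * ln (kA p xi) - mquad p y xi / 4.

Definition theta X z xi : R := dotv xi (z - rsubmx X).

(** One parameter bounds the space coordinates and keeps the time away from both 0 and infinity; all
    dominations are uniform on such sets. *)
Definition box (B : R) p := (forall i, `|p.1 0 i| <= B) /\ B^-1 <= p.2 <= B.

Lemma box_gt0 B p : 0 < B -> box B p -> 0 < p.2.
Proof. by move=> B0 [_ /andP[h _]]; apply: lt_le_trans h; rewrite invr_gt0. Qed.

Lemma coord_le_norm N (x : 'rV[R]_N) i : `|x 0 i| <= `|x|.
Proof.
rewrite [leRHS]mx_normrE.
exact: (le_bigmax _ (fun ij : 'I_1 * 'I_N => `|x ij.1 ij.2|) (0, i)).
Qed.

Lemma near_box p : 0 < p.2 -> exists2 B, 0 < B & \forall q \near p, box B q.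
Proof.
(* Leaves room for a unit move in space and for times between [p.2 / 2] and [3 p.2 / 2]. *)
move=> p0; pose B := `|p.1| + 1 + 2 * p.2 + 2 / p.2.
have ip : 0 < 2 / p.2 by rewrite divr_gt0.
have np := normr_ge0 p.1.
have B0 : 0 < B by rewrite /B; lra.
have /cvgrPdistC_le /(_ 1 ltr01) N1 : q.1 @[q --> p] --> p.1 by exact: cvg_fst.
have p2 : 0 < p.2 / 2 by rewrite divr_gt0.
have /cvgrPdistC_le /(_ _ p2) N2 : q.2 @[q --> p] --> p.2 by exact: cvg_snd.
exists B => //; near=> q; split.
  move=> i; apply: le_trans (coord_le_norm _ _) _.
  have : `|q.1 - p.1| <= 1 by near: q.
  have := ler_normD (q.1 - p.1) p.1; rewrite subrK /B; lra.
have : `|q.2 - p.2| <= p.2 / 2 by near: q.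
rewrite ler_norml => /andP[h1 h2]; apply/andP; split; last by rewrite /B; lra.
apply: (@le_trans _ _ (p.2 / 2)); last lra.
rewrite -[leRHS]invrK lef_pV2 ?posrE ?invr_gt0 ?divr_gt0 // invf_div /B; lra.
Unshelve. all: by end_near. Qed.

Lemma kA_gt0 p xi : 0 < p.2 -> 0 < kA p xi.
Proof. by move=> p0; apply: mehlerA_gt0 => //; exact: enorm_ge0. Qed.

(** [mquad = A |w - y|^2 + (T - A) (|w|^2 + |y|^2)] with [0 < A <= T]. *)
Lemma mquad_ge0 p y xi : 0 < p.2 -> 0 <= mquad p y xi.
Proof.
move=> p0; have := dotv_le (lsubmx p.1) y; have := kA_gt0 xi p0.
have : kA p xi <= kT p xi by apply: mehlerA_leT => //; exact: enorm_ge0.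
rewrite /mquad; have := dotv_ge0 (lsubmx p.1); have := dotv_ge0 y.
set a := dotv _ _; set b := dotv (lsubmx p.1) (lsubmx p.1); set c := dotv _ _.
set A := kA _ _; set T := kT _ _ => a0 b0 AT A0 h.
have h1 : 0 <= (T - A) * (b + a) by rewrite mulr_ge0 //; lra.
have h2 : 0 <= A * (b + a - 2 * c) by rewrite mulr_ge0 //; lra.
lra.
Qed.

(** The quadratic part only helps and is dropped. On the box [A <= 4 B e^(- |xi| / (2 B))], so
    [A^(n/2)] decays at rate [n / (4 B)], positive since [0 < n], and an exponential beats every
    power of [wt xi]. *)
Lemma expR_mexp_bound (hn : (0 < n)%N) B m : 0 < B ->
  exists2 C, 0 < C & forall p y xi, box B p ->
    expR (mexp p y xi) <= C / wt xi ^+ m.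
Proof.
move=> B0.
have n0 : 0 < n%:R :> R by rewrite ltr0n.
have c0 : 0 < n%:R / (4 * B) by rewrite divr_gt0 // mulr_gt0.
have [C C0 HC] := @expRN_enorm_le R k _ m c0.
exists (expR (n%:R / 2 * ln (4 * B)) * C) => [|p y xi pB].
  by rewrite mulr_gt0 // expR_gt0.
have p0 := box_gt0 B0 pB; have [_ /andP[Bp pB2]] := pB.
rewrite -[leRHS]mulrA; apply: le_trans (ler_wpM2l (expR_ge0 _) (HC xi)).
rewrite -expRD ler_expR /mexp.
apply: (@le_trans _ _ (n%:R / 2 * ln (kA p xi))).
  by rewrite lerBlDr lerDl divr_ge0 // mquad_ge0.
have e0 := enorm_ge0 xi.
have -> : n%:R / 2 * ln (4 * B) - n%:R / (4 * B) * enorm xi =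
    n%:R / 2 * (ln (4 * B) + (- (enorm xi / (2 * B)))).
  by field; rewrite gt_eqF.
rewrite ler_wpM2l ?divr_ge0 // -[X in _ <= _ + X]expRK -lnM ?posrE ?mulr_gt0 ?expR_gt0 //.
rewrite ler_ln ?posrE ?kA_gt0 //; last by rewrite mulr_gt0 ?expR_gt0 // mulr_gt0.
apply: le_trans (mehlerA_le e0 p0) _; apply: ler_pM.
- by rewrite divr_ge0 // ltW.
- exact: expR_ge0.
- by rewrite ler_wpM2l // -[leRHS]invrK lef_pV2 ?posrE ?invr_gt0.
- rewrite ler_expR lerN2 ler_pdivrMr ?mulr_gt0 //.
  have : 1 <= p.2 * B by rewrite -ler_pdivrMr // mul1r.
  by move=> h; have := ler_wpM2l e0 h; lra.
Qed.

Section with_data.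
Variables (f1 f2 : 'rV[R]_(n + k) -> R).

(* The real part of [expi (- (theta + phi)) * (f1 + 'i f2)]. *)
Definition phase (phi : R) X y z xi : R :=
  cos (theta X z xi + phi) * f1 (row_mx y z) +
  sin (theta X z xi + phi) * f2 (row_mx y z).

Definition Eker phi p y z xi : R := phase phi p.1 y z xi * expR (mexp p y xi).

Hypotheses (sf1 : rschwartz f1) (sf2 : rschwartz f2).

Lemma normr_cos_le (x : R) : `|cos x| <= 1.
Proof. by rewrite ler_norml cos_geN1 cos_le1. Qed.

Lemma normr_sin_le (x : R) : `|sin x| <= 1.
Proof. by rewrite ler_norml sin_geN1 sin_le1. Qed.

Lemma phase_bound m : exists2 C, 0 <= C & forall phi X y z xi,
  `|phase phi X y z xi| <= C / (wt y * wt z) ^+ m.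
Proof.
have [_ _ /(_ m)[M1 H1]] := sf1 [::]; have [_ _ /(_ m)[M2 H2]] := sf2 [::].
exists (`|M1| + `|M2|) => [|phi X y z xi]; first by rewrite addr_ge0.
rewrite mulrDl -wt_row_mx; set x := row_mx _ _.
have w0 : 0 <= (wt x ^+ m)^-1 by rewrite invr_ge0 exprn_ge0 // ltW // wt_gt0.
apply: le_trans (ler_normD _ _) _; rewrite !normrM; apply: lerD.
  apply: (@le_trans _ _ (1 * `|f1 x|)); first by rewrite ler_wpM2r // normr_cos_le.
  by rewrite mul1r (le_trans (H1 x)) // ler_wpM2r // ler_norm.
apply: (@le_trans _ _ (1 * `|f2 x|)); first by rewrite ler_wpM2r // normr_sin_le.
by rewrite mul1r (le_trans (H2 x)) // ler_wpM2r // ler_norm.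
Qed.

Lemma Eker_bound (hn : (0 < n)%N) B m : 0 < B ->
  exists2 C, 0 <= C & forall phi p y z xi, box B p ->
    `|Eker phi p y z xi| <= C / wt3 y z xi ^+ m.
Proof.
move=> B0; have [C1 C10 H1] := phase_bound m.
have [C2 C20 H2] := expR_mexp_bound hn m B0.
exists (C1 * C2) => [|phi p y z xi pB]; first by rewrite mulr_ge0 // ltW.
rewrite /Eker normrM (ger0_norm (expR_ge0 _)) /wt3 exprMn invfM mulrACA.
apply: ler_pM; [exact: normr_ge0|exact: expR_ge0|exact: H1|exact: H2].
Qed.

End with_data.

(** The coefficients that differentiation produces in front of the kernel. Their growth in [y] and
    [xi] is polynomial, locally uniformly in positive time, so the decay of [Eker] absorbs it. There
    is no argument [z]: differentiating the phase in [X] brings down only [xi]. *)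
Definition symbol (Q : P -> 'rV[R]_n -> 'rV[R]_k -> R) :=
  [/\ forall p, measurable_fun setT (fun o : Om => Q p (vec o.1.1) (vec o.2)),
      forall p y xi, 0 < p.2 -> {for p, continuous (fun q => Q q y xi)} &
      forall B, 0 < B -> exists C m, 0 <= C /\ forall p y xi, box B p ->
        `|Q p y xi| <= C * (wt y * wt xi) ^+ m].

Lemma wt2_ge1 y xi : 1 <= wt y * wt xi.
Proof. by rewrite -[1]mulr1 ler_pM ?wt_ge1. Qed.

Lemma symbol_cst c : symbol (fun _ _ _ => c).
Proof.
split=> [p|p y xi _|B B0]; [exact: measurable_cst|exact: cst_continuous|].
exists `|c|, 0%N; split => // p y xi _; by rewrite expr0 mulr1.
Qed.

Lemma symbolD Q1 Q2 : symbol Q1 -> symbol Q2 ->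
  symbol (fun p y xi => Q1 p y xi + Q2 p y xi).
Proof.
move=> [m1 c1 b1] [m2 c2 b2]; split.
- by move=> p; apply: measurable_funD.
- by move=> p y xi p0; apply: continuousD; [exact: c1|exact: c2].
move=> B B0; have [C1 [k1 [C10 H1]]] := b1 B B0; have [C2 [k2 [C20 H2]]] := b2 B B0.
exists (C1 + C2), (k1 + k2)%N; split => [|p y xi pB]; first by rewrite addr_ge0.
apply: le_trans (ler_normD _ _) _; rewrite mulrDl; apply: lerD.
  apply: le_trans (H1 _ _ _ pB) _; rewrite ler_wpM2l // ler_weXn2l ?wt2_ge1 //.
  exact: leq_addr.
apply: le_trans (H2 _ _ _ pB) _; rewrite ler_wpM2l // ler_weXn2l ?wt2_ge1 //.
exact: leq_addl.
Qed.

Lemma symbolM Q1 Q2 : symbol Q1 -> symbol Q2 ->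
  symbol (fun p y xi => Q1 p y xi * Q2 p y xi).
Proof.
move=> [m1 c1 b1] [m2 c2 b2]; split.
- by move=> p; apply: measurable_funM.
- by move=> p y xi p0; apply: continuousM; [exact: c1|exact: c2].
move=> B B0; have [C1 [k1 [C10 H1]]] := b1 B B0; have [C2 [k2 [C20 H2]]] := b2 B B0.
exists (C1 * C2), (k1 + k2)%N; split => [|p y xi pB]; first by rewrite mulr_ge0.
by rewrite normrM exprD mulrACA ler_pM // ?H1 // H2.
Qed.

Lemma symbol_sum I (s : seq I) Q : (forall i, symbol (Q i)) ->
  symbol (fun p y xi => \sum_(i <- s) Q i p y xi).
Proof.
move=> sQ; elim: s => [|i s IH].
  have := symbol_cst 0; congr symbol; apply/funext => p; apply/funext => y.
  by apply/funext => xi; rewrite big_nil.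
have := symbolD (sQ i) IH; congr symbol; apply/funext => p; apply/funext => y.
by apply/funext => xi; rewrite big_cons.
Qed.

Lemma continuous_coord i p : {for p, continuous (fun q : P => q.1 0 i)}.
Proof.
apply: (@continuous_comp _ _ _ fst (fun M : 'rV[R]_(n + k) => M 0 i)).
  exact: cvg_fst.
exact: coord_continuous.
Qed.

Lemma symbol_coord i : symbol (fun p _ _ => p.1 0 i).
Proof.
split=> [p|p y xi _|B B0]; [exact: measurable_cst|exact: continuous_coord|].
exists B, 0%N; split => [|p y xi [h _]]; first exact: ltW.
by rewrite expr0 mulr1.
Qed.

Lemma symbol_y a : symbol (fun _ y _ => y 0 a).
Proof.
split=> [p|p y xi _|B B0]; [|exact: cst_continuous|].
  apply: (measurableT_comp (measurable_vec a)).
  by apply: (measurableT_comp measurable_fst measurable_fst).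
exists 1, 1%N; split => // p y xi _; rewrite expr1 mul1r.
by apply: le_trans (coord_le_wt y a) _; rewrite ler_peMr ?wt_ge1 // ltW // wt_gt0.
Qed.

Lemma symbol_xi b : symbol (fun _ _ xi => xi 0 b).
Proof.
split=> [p|p y xi _|B B0]; [|exact: cst_continuous|].
  by apply: (measurableT_comp (measurable_vec b)).
exists 1, 1%N; split => // p y xi _; rewrite expr1 mul1r.
by apply: le_trans (coord_le_wt xi b) _; rewrite ler_peMl ?wt_ge1 // ltW // wt_gt0.
Qed.

Lemma continuous_kA p xi : 0 < p.2 -> {for p, continuous (fun q => kA q xi)}.
Proof.
move=> p0; apply: (@continuous_comp _ _ _ snd (mehlerA (enorm xi))).
  exact: cvg_snd.
apply/differentiable_continuous/derivable1_diffP.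
by have := is_derive_mehlerA (enorm_ge0 xi) p0 => ?; exact: ex_derive.
Qed.

Lemma continuous_kT p xi : 0 < p.2 -> {for p, continuous (fun q => kT q xi)}.
Proof.
move=> p0; apply: (@continuous_comp _ _ _ snd (mehlerT (enorm xi))).
  exact: cvg_snd.
apply/differentiable_continuous/derivable1_diffP.
by have := is_derive_mehlerT (enorm_ge0 xi) p0 => ?; exact: ex_derive.
Qed.

Lemma measurable_enorm_xi : measurable_fun setT (fun o : Om => enorm (vec o.2)).
Proof.
by apply: measurable_enorm => i; exact: (measurableT_comp (measurable_vec i)).
Qed.

Lemma kT_bound B p y xi : 0 < B -> box B p ->
  `|kT p xi| <= (4 * B + 1) * (wt y * wt xi).
Proof.
move=> B0 pB; have p0 := box_gt0 B0 pB; have [_ /andP[Bp _]] := pB.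
have e0 := enorm_ge0 xi.
rewrite ger0_norm; last first.
  by rewrite (le_trans _ (mehlerA_leT e0 p0)) // ltW // mehlerA_gt0.
apply: le_trans (mehlerT_le e0 p0) _.
have h1 : 4 / p.2 <= 4 * B.
  by rewrite ler_wpM2l // -[leRHS]invrK lef_pV2 ?posrE ?invr_gt0.
have h2 := enorm_le_wt xi; have h3 := wt_ge1 xi; have h4 := wt_ge1 y.
have h5 : wt xi <= wt y * wt xi by rewrite ler_peMl // (le_trans ler01).
set a := wt y * wt xi in h5 *; nra.
Qed.

Lemma symbol_kT : symbol (fun p _ xi => kT p xi).
Proof.
split=> [p|p y xi|B B0].
- exact: (measurableT_comp (measurable_mehlerT p.2) measurable_enorm_xi).
- exact: continuous_kT.
- exists (4 * B + 1), 1%N; split => [|p y xi pB].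
    by rewrite addr_ge0 // mulr_ge0 // ltW.
  by rewrite expr1; exact: kT_bound.
Qed.

Lemma symbol_kA : symbol (fun p _ xi => kA p xi).
Proof.
split=> [p|p y xi|B B0].
- exact: (measurableT_comp (measurable_mehlerA p.2) measurable_enorm_xi).
- exact: continuous_kA.
- exists (4 * B + 1), 1%N; split => [|p y xi pB].
    by rewrite addr_ge0 // mulr_ge0 // ltW.
  rewrite expr1; apply: le_trans (kT_bound y xi B0 pB).
  have p0 := box_gt0 B0 pB; have e0 := enorm_ge0 xi.
  rewrite !ger0_norm ?mehlerA_leT // ?(ltW (mehlerA_gt0 _ _)) //.
  by rewrite (le_trans _ (mehlerA_leT e0 p0)) // ltW // mehlerA_gt0.
Qed.

Lemma symbol_mquad : symbol mquad.
Proof.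
have -> : mquad = fun p y xi => kT p xi * ((\sum_(a < n) p.1 0 (lshift k a) * p.1 0 (lshift k a))
    + (\sum_(a < n) y 0 a * y 0 a))
    + (-2) * (kA p xi * (\sum_(a < n) p.1 0 (lshift k a) * y 0 a)).
  apply/funext => p; apply/funext => y; apply/funext => xi.
  have dE v : dotv (lsubmx p.1) v = \sum_(a < n) p.1 0 (lshift k a) * v 0 a.
    by apply: eq_bigr => i _; rewrite mxE.
  have dE2 : dotv (lsubmx p.1) (lsubmx p.1) =
      \sum_(a < n) p.1 0 (lshift k a) * p.1 0 (lshift k a).
    by rewrite dE; apply: eq_bigr => i _; rewrite mxE.
  by rewrite /mquad dE2 dE /dotv; ring.
have sw a := symbol_coord (lshift k a).
exact: (symbolD
  (symbolM symbol_kT (symbolD (symbol_sum _ (fun a => symbolM (sw a) (sw a)))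
    (symbol_sum _ (fun a => symbolM (symbol_y a) (symbol_y a)))))
  (symbolM (symbol_cst (-2)) (symbolM symbol_kA
    (symbol_sum _ (fun a => symbolM (sw a) (symbol_y a)))))).
Qed.

Lemma measurable_mexp p : measurable_fun setT (fun o : Om => mexp p (vec o.1.1) (vec o.2)).
Proof.
apply: measurable_funB.
  apply: measurable_funM => //; apply: measurableT_comp; first exact: measurable_ln.
  by have [+ _ _] := symbol_kA; apply.
by apply: measurable_funM => //; have [+ _ _] := symbol_mquad; apply.
Qed.

Lemma continuous_mexp p y xi : 0 < p.2 -> {for p, continuous (fun q => mexp q y xi)}.
Proof.
move=> p0; apply: continuousB.
  apply: continuousM; first exact: cst_continuous.
  apply: (@continuous_comp _ _ _ (fun q => kA q xi) (@ln R)); first exact: continuous_kA.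
  by apply: continuous_ln; exact: kA_gt0.
apply: continuousM; last exact: cst_continuous.
by have [_ + _] := symbol_mquad; apply.
Qed.

End mehler_kernel.

(** * Differentiation of kernel integrals *)

Section regularity.
Context {R : realType} {n k : nat}.
Local Notation mR := (measurableTypeR R).
Local Notation lebt := (@lebesgue_tuple R).
Local Notation P := ('rV[R]_(n + k) * R)%type.
Local Notation Om := ((n.-tuple mR * k.-tuple mR) * k.-tuple mR)%type.
Local Notation mu := (sigma_product (lebt n) (lebt k) \x lebt k)%E.
Implicit Types (p q : P) (y : 'rV[R]_n) (z xi : 'rV[R]_k) (X : 'rV[R]_(n + k)).

Lemma integrable_wt3V :
  mu.-integrable setT (EFin \o (fun o : Om => (wt3 (vec o.1.1) (vec o.1.2) (vec o.2))^-1)).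
Proof.
have h := @integrable_prodM _ _ _ _ _ (lebt n) (lebt k) (fun x => (wt (vec x))^-1)
  (fun x => (wt (vec x))^-1) (integrable_wtV n) (integrable_wtV k).
have := @integrable_prodM R _ _ (n.-tuple mR * k.-tuple mR)%type (k.-tuple mR)
  (sigma_product (lebt n) (lebt k)) (lebt k)
  (fun o => (wt (vec o.1))^-1 * (wt (vec o.2))^-1)
  (fun x => (wt (vec x))^-1) h (integrable_wtV k).
by apply: eq_integrable => // o _ /=; rewrite /wt3 !invfM.
Qed.

Lemma wt3_ge1 y z xi : 1 <= wt3 y z xi.
Proof.
by rewrite /wt3 -[1]mulr1 ler_pM ?wt_ge1 // -[1]mulr1 ler_pM ?wt_ge1.
Qed.

Variables (f1 f2 : 'rV[R]_(n + k) -> R).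
Hypotheses (sf1 : rschwartz f1) (sf2 : rschwartz f2) (hn : (0 < n)%N).

Lemma measurable_theta X :
  measurable_fun setT (fun o : Om => theta X (vec o.1.2) (vec o.2)).
Proof.
apply: measurable_dotv => i; first exact: (measurableT_comp (measurable_vec i)).
rewrite (_ : (fun _ => _) = fun o : Om => vec o.1.2 0 i - rsubmx X 0 i); last first.
  by apply/funext => o; rewrite !mxE.
apply: measurable_funB => //.
apply: (measurableT_comp (measurable_vec i)).
exact: (measurableT_comp measurable_snd measurable_fst).
Qed.

Lemma measurable_data (g : 'rV[R]_(n + k) -> R) : rschwartz g ->
  measurable_fun setT (fun o : n.-tuple mR * k.-tuple mR => g (row_mx (vec o.1) (vec o.2))).
Proof.
move=> sg; have [cg _ _] := sg [::]; apply: continuous_rV_comp_measurable cg _ => i.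
case: (split_ordP i) => j ->.
  rewrite (_ : (fun _ => _) = fun o : n.-tuple mR * k.-tuple mR => vec o.1 0 j).
    by apply: (measurableT_comp (measurable_vec j)).
  by apply/funext => o; rewrite row_mxEl.
rewrite (_ : (fun _ => _) = fun o : n.-tuple mR * k.-tuple mR => vec o.2 0 j).
  by apply: (measurableT_comp (measurable_vec j)).
by apply/funext => o; rewrite row_mxEr.
Qed.

Lemma measurable_phase phi X : measurable_fun setT
  (fun o : Om => phase f1 f2 phi X (vec o.1.1) (vec o.1.2) (vec o.2)).
Proof.
have mt : measurable_fun setT (fun o : Om => theta X (vec o.1.2) (vec o.2) + phi).
  by apply: measurable_funD => //; exact: measurable_theta.
apply: measurable_funD; apply: measurable_funM.
- by apply: measurableT_comp mt; apply: continuous_measurable_fun; exact: continuous_cos.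
- exact: (measurableT_comp (measurable_data sf1) measurable_fst).
- by apply: measurableT_comp mt; apply: continuous_measurable_fun; exact: continuous_sin.
- exact: (measurableT_comp (measurable_data sf2) measurable_fst).
Qed.

Lemma measurable_Eker phi p : measurable_fun setT
  (fun o : Om => Eker f1 f2 phi p (vec o.1.1) (vec o.1.2) (vec o.2)).
Proof.
apply: measurable_funM; first exact: measurable_phase.
by apply: measurableT_comp; [exact: measurable_expR|exact: measurable_mexp].
Qed.

Lemma continuous_theta p z xi : {for p, continuous (fun q => theta q.1 z xi)}.
Proof.
rewrite /theta /dotv; apply: continuous_at_sum => i.
rewrite (_ : (fun _ => _) = fun q : P => xi 0 i * (z 0 i - q.1 0 (rshift n i))); last first.
  by apply/funext => q; rewrite !mxE.
apply: continuousM; first exact: cst_continuous.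
by apply: continuousB; [exact: cst_continuous|exact: continuous_coord].
Qed.

Lemma continuous_Eker phi p y z xi : 0 < p.2 ->
  {for p, continuous (fun q => Eker f1 f2 phi q y z xi)}.
Proof.
move=> p0.
have ct : {for p, continuous (fun q => theta q.1 z xi + phi)}.
  by apply: continuousD; [exact: continuous_theta|exact: cst_continuous].
apply: continuousM; last first.
  apply: (@continuous_comp _ _ _ (fun q => mexp q y xi) expR).
    exact: continuous_mexp.
  exact: continuous_expR.
apply: continuousD; apply: continuousM.
- apply: (@continuous_comp _ _ _ (fun q : P => theta q.1 z xi + phi) (@cos R)) => //.
  exact: continuous_cos.
- exact: cst_continuous.
- apply: (@continuous_comp _ _ _ (fun q : P => theta q.1 z xi + phi) (@sin R)) => //.
  exact: continuous_sin.
- exact: cst_continuous.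
Qed.

Definition integ (Q : P -> 'rV[R]_n -> 'rV[R]_k -> R) phi p (o : Om) : R :=
  Q p (vec o.1.1) (vec o.2) * Eker f1 f2 phi p (vec o.1.1) (vec o.1.2) (vec o.2).

(** With [Q] the constant [kconst] and [phi = 0], this is the real part of the solution when [f1]
    and [f2] are the real and imaginary parts of the data; the derivatives needed have the same
    form, with another symbol and a shifted phase. *)
Definition kint Q phi p : R := \int[mu]_o integ Q phi p o.

(** The symbol grows at most like [wt3 ^+ m]; taking the kernel's decay with exponent [m + 1] leaves
    exactly one integrable inverse weight. *)
Lemma integ_bound Q B : symbol Q -> 0 < B -> exists2 C, 0 <= C & forall phi p o,
  box B p -> `|integ Q phi p o| <= C * (wt3 (vec o.1.1) (vec o.1.2) (vec o.2))^-1.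
Proof.
move=> [_ _ bQ] B0; have [C1 [m [C10 H1]]] := bQ B B0.
have [C2 C20 H2] := Eker_bound sf1 sf2 hn m.+1 B0.
exists (C1 * C2) => [|phi p o pB]; first by rewrite mulr_ge0.
set y := vec _; set z := vec o.1.2; set xi := vec o.2.
have w1 := wt3_ge1 y z xi; have w0 : 0 < wt3 y z xi by apply: lt_le_trans w1.
rewrite /integ normrM.
apply: (@le_trans _ _ ((C1 * wt3 y z xi ^+ m) * (C2 / wt3 y z xi ^+ m.+1))).
  apply: ler_pM; [exact: normr_ge0|exact: normr_ge0| |exact: H2].
  apply: le_trans (H1 _ _ _ pB) _; rewrite ler_wpM2l //.
  apply: lerXn2r; rewrite ?nnegrE ?(le_trans ler01 (wt2_ge1 _ _)) ?(ltW w0) //.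
  rewrite /wt3 -mulrA [wt z * _]mulrC mulrA ler_peMr ?wt_ge1 //.
  exact: le_trans ler01 (wt2_ge1 _ _).
rewrite exprS invfM [C2 * _]mulrA mulrACA mulrCA mulrA.
rewrite [X in X <= _](_ : _ = C1 * C2 / wt3 y z xi) //.
by field; rewrite !gt_eqF // exprn_gt0.
Qed.

Lemma measurable_integ Q phi p : symbol Q -> measurable_fun setT (integ Q phi p).
Proof. by move=> [mQ _ _]; apply: measurable_funM => //; exact: measurable_Eker. Qed.

Lemma integrable_bound (C : R) :
  mu.-integrable setT (EFin \o (fun o : Om => C * (wt3 (vec o.1.1) (vec o.1.2) (vec o.2))^-1)).
Proof. exact: (integrableZl measurableT C integrable_wt3V). Qed.

Lemma integrable_integ Q phi p : symbol Q -> 0 < p.2 ->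
  mu.-integrable setT (EFin \o integ Q phi p).
Proof.
move=> sQ p0; have [B B0 /nbhs_singleton pB] := near_box p0.
have [C _ HC] := integ_bound sQ B0.
apply: (integrable_dominated (measurable_integ _ _ sQ) (integrable_bound C)) => o.
exact: HC.
Qed.

Lemma kint_continuous Q phi p : symbol Q -> 0 < p.2 -> {for p, continuous (kint Q phi)}.
Proof.
move=> sQ p0; have [B B0 pB] := near_box p0.
have [C _ HC] := integ_bound sQ B0.
apply: (@continuous_Rintegral _ _ _ mu _ (integ Q phi) p _ _ _ (integrable_bound C)).
- by near=> q; exact: measurable_integ.
- move=> o; apply: continuousM; last exact: continuous_Eker.
  by have [_ + _] := sQ; apply.
- by near=> q => o; apply: HC; near: q.
Unshelve. all: by end_near. Qed.

Lemma kint_is_derive_x Q Q' phi phi' i X t : symbol Q -> symbol Q' -> 0 < t ->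
  (forall X y z xi, is_derive X (dirv R i)
     (fun X => Q (X, t) y xi * Eker f1 f2 phi (X, t) y z xi)
     (Q' (X, t) y xi * Eker f1 f2 phi' (X, t) y z xi)) ->
  is_derive X (dirv R i) (fun X => kint Q phi (X, t)) (kint Q' phi' (X, t)).
Proof.
move=> sQ sQ' t0 dQ; apply/is_derive_line0.
(* The box must contain the segment traced by [h] in []-1, 1[] at the fixed time [t]. *)
pose B := `|X| + 1 + t + t^-1.
have [nX it0] : 0 <= `|X| /\ 0 < t^-1 by rewrite normr_ge0 invr_gt0.
have B0 : 0 < B by rewrite /B; lra.
have inB h : h \in `](-1), 1[ -> box B (h *: dirv R i + X, t).
  rewrite in_itv /= => /andP[h1 h2]; split => /= [j|].
    apply: le_trans (coord_le_norm _ _) _; apply: le_trans (ler_normD _ _) _.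
    have : `|h *: dirv R i| <= 1.
      rewrite normrZ -[leRHS]mulr1 ler_pM ?normr_ge0 //.
        by rewrite ler_norml !ltW.
      rewrite [leLHS]mx_normrE; apply/bigmax_leP; split => // ij _.
      by rewrite mxE; case: (_ && _); rewrite ?normr1 ?normr0.
    rewrite /B; lra.
  apply/andP; split; last by rewrite /B; lra.
  by rewrite -[leRHS]invrK lef_pV2 ?posrE // /B; lra.
have [C _ HC] := integ_bound sQ' B0.
have := @is_derive_Rintegral _ _ _ mu (fun h o => integ Q phi (h *: dirv R i + X, t) o)
  (fun h o => integ Q' phi' (h *: dirv R i + X, t) o) 0 (-1) 1 _ _ _ _ (integrable_bound C).
rewrite scale0r add0r; apply.
- by rewrite in_itv /= ltr01 ltrN10.
- by move=> h _; exact: integrable_integ.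
- move=> h o _.
  exact: ((is_derive_line (fun X => Q (X, t) _ _ * Eker f1 f2 phi (X, t) _ _ _) X (dirv R i) h _).1 (dQ _ _ _ _)).
- by move=> h o hI; apply: HC; exact: inB.
Qed.

Lemma kint_is_derive_t (Q Q' : P -> 'rV[R]_n -> 'rV[R]_k -> R) phi X (t : R) : symbol Q -> symbol Q' -> 0 < t ->
  (forall y z xi (t : R), 0 < t -> is_derive t 1
     (fun t => Q (X, t) y xi * Eker f1 f2 phi (X, t) y z xi)
     (Q' (X, t) y xi * Eker f1 f2 phi (X, t) y z xi)) ->
  is_derive t 1 (fun t => kint Q phi (X, t)) (kint Q' phi (X, t)).
Proof.
move=> sQ sQ' t0 dQ.
(* The box must contain [X] at all times in []t / 2, 2 t[], an interval bounded away from 0. *)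
pose B := `|X| + 2 * t + 2 / t.
have [nX it0] : 0 <= `|X| /\ 0 < 2 / t by rewrite normr_ge0 divr_gt0.
have B0 : 0 < B by rewrite /B; lra.
have pos s : s \in `](t / 2), (2 * t)[ -> 0 < s.
  by rewrite in_itv /= => /andP[+ _]; apply: lt_trans; rewrite divr_gt0.
have inB s : s \in `](t / 2), (2 * t)[ -> box B (X, s).
  move=> sI; have s0 := pos s sI; move: sI.
  rewrite in_itv /= => /andP[h1 h2]; split => /= [j|].
    by apply: le_trans (coord_le_norm _ _) _; rewrite /B; lra.
  apply/andP; split; last by rewrite /B; lra.
  apply: le_trans (ltW h1); rewrite -[leRHS]invrK lef_pV2 ?posrE ?invr_gt0 ?divr_gt0 //.
  by rewrite invf_div /B; lra.
have [C _ HC] := integ_bound sQ' B0.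
apply: (@is_derive_Rintegral _ _ _ mu (fun s o => integ Q phi (X, s) o)
  (fun s o => integ Q' phi (X, s) o) t (t / 2) (2 * t) _ _ _ _ (integrable_bound C)).
- by rewrite in_itv /=; apply/andP; split; lra.
- by move=> s /pos s0; exact: integrable_integ.
- by move=> s o /pos s0; exact: dQ.
- by move=> s o sI; apply: HC; exact: inB.
Qed.

End regularity.

(** * Logarithmic derivatives of the kernel *)

Lemma scaleRR {R : realType} (a b : R) : a *: b = a * b.
Proof. by []. Qed.

Lemma is_derive_ext {R : realType} {V : normedModType R} (f g : V -> R)
    (x v : V) (a b : R) :
  is_derive x v f a -> f =1 g -> a = b -> is_derive x v g b.
Proof. by move=> df /funext <- <-. Qed.

Section split_shift.
Variables n k : nat.

Lemma split_lshift (a : 'I_n) : fintype.split (lshift k a) = inl a.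
Proof. exact: (unsplitK (inl a)). Qed.

Lemma split_rshift (b : 'I_k) : fintype.split (rshift n b) = inr b.
Proof. exact: (unsplitK (inr b)). Qed.

End split_shift.

Section kernel_derivatives.
Context {R : realType} {n k : nat}.
Local Notation mR := (measurableTypeR R).
Local Notation lebt := (@lebesgue_tuple R).
Local Notation P := ('rV[R]_(n + k) * R)%type.
Implicit Types (p q : P) (y : 'rV[R]_n) (z xi : 'rV[R]_k) (X v : 'rV[R]_(n + k)).

(* [dlog i] and [dphase i]: differentiating the kernel along coordinate [i]
   multiplies it by [dlog i] and shifts its phase by [dphase i]. *)
Definition dlog (i : 'I_(n + k)) p y xi : R :=
  match fintype.split i with
  | inl a => - ((kT p xi * p.1 0 i - kA p xi * y 0 a) / 2)
  | inr b => xi 0 b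
  end.

Definition dphase (i : 'I_(n + k)) : R :=
  match fintype.split i with inl _ => 0 | inr _ => - (pi / 2) end.

(** The partial derivative of [dlog j] along coordinate [i]. *)
Definition ddlog (i j : 'I_(n + k)) p xi : R :=
  match fintype.split j with
  | inl _ => if i == j then - (kT p xi / 2) else 0
  | inr _ => 0
  end.

(** The time derivative of [mexp], computed with [A' = - A T] and [T' = - A^2]. *)
Definition dtlog p y xi : R :=
  - (n%:R / 2 * kT p xi) + (kA p xi ^+ 2 *
    (dotv (lsubmx p.1) (lsubmx p.1) + dotv y y) -
    2 * kA p xi * kT p xi * dotv (lsubmx p.1) y) / 4.

Lemma eq_symbol (Q1 Q2 : P -> 'rV[R]_n -> 'rV[R]_k -> R) :
  (forall p y xi, Q1 p y xi = Q2 p y xi) -> symbol Q1 -> symbol Q2.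
Proof.
by move=> E; congr symbol; apply/funext => p; apply/funext => y; apply/funext.
Qed.

Lemma symbol_dlog i : symbol (dlog i).
Proof.
rewrite /dlog; case: (fintype.split i) => [a|b]; last exact: symbol_xi.
apply: eq_symbol (symbolM (symbol_cst (- 2^-1)) (symbolD
  (symbolM symbol_kT (symbol_coord i))
  (symbolM (symbol_cst (-1)) (symbolM symbol_kA (symbol_y a))))).
by move=> p y xi; ring.
Qed.

Lemma symbol_ddlog i j : symbol (fun p _ xi => ddlog i j p xi).
Proof.
rewrite /ddlog; case: (fintype.split j) => [a|b]; last exact: symbol_cst.
case: (i == j); last exact: symbol_cst.
apply: eq_symbol (symbolM (symbol_cst (- 2^-1)) symbol_kT).
by move=> p y xi; ring.
Qed.

Lemma symbol_dotw : symbol (fun p _ _ => dotv (lsubmx p.1) (lsubmx p.1)).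
Proof.
apply: eq_symbol (symbol_sum (index_enum 'I_n) (fun a =>
  symbolM (symbol_coord (lshift k a)) (symbol_coord (lshift k a)))).
by move=> p y xi; apply: eq_bigr => a _; rewrite !mxE.
Qed.

Lemma symbol_doty : symbol (fun (p : P) y (xi : 'rV[R]_k) => dotv y y).
Proof.
exact: eq_symbol (symbol_sum (index_enum 'I_n) (fun a => symbolM (symbol_y a) (symbol_y a))).
Qed.

Lemma symbol_dotwy : symbol (fun (p : P) y (xi : 'rV[R]_k) => dotv (lsubmx p.1) y).
Proof.
apply: eq_symbol (symbol_sum (index_enum 'I_n) (fun a =>
  symbolM (symbol_coord (lshift k a)) (symbol_y a))).
by move=> p y xi; apply: eq_bigr => a _; rewrite !mxE.
Qed.

Lemma symbol_dtlog : symbol dtlog.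
Proof.
apply: eq_symbol (symbolD (symbolM (symbol_cst (- (n%:R / 2))) symbol_kT)
  (symbolM (symbol_cst 4^-1) (symbolD
    (symbolM (symbolM symbol_kA symbol_kA) (symbolD symbol_dotw symbol_doty))
    (symbolM (symbol_cst (-2)) (symbolM (symbolM symbol_kA symbol_kT) symbol_dotwy))))).
by move=> p y xi; rewrite /dtlog; ring.
Qed.

Lemma is_derive_theta X v z xi :
  is_derive X v (fun X => theta X z xi) (- dotv xi (rsubmx v)).
Proof.
apply/is_derive_line0.
rewrite (_ : (fun _ => _) = fun h => theta X z xi + (- dotv xi (rsubmx v)) * h + 0 * h ^+ 2).
  exact: is_derive_quad.
apply/funext => h; rewrite /theta linearD linearZ /= !dotvDr !dotvNr dotvDr dotvZr; ring.
Qed.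

Lemma is_derive_mexp_x X v t y xi :
  is_derive X v (fun X => mexp (X, t) y xi)
    (- ((kT (X, t) xi * dotv (lsubmx X) (lsubmx v) - kA (X, t) xi * dotv (lsubmx v) y) / 2)).
Proof.
apply/is_derive_line0.
pose b : R := - ((kT (X, t) xi * dotv (lsubmx X) (lsubmx v) - kA (X, t) xi * dotv (lsubmx v) y) / 2).
pose c : R := - (kT (X, t) xi * dotv (lsubmx v) (lsubmx v) / 4).
rewrite (_ : (fun _ => _) = fun h => mexp (X, t) y xi + b * h + c * h ^+ 2).
  exact: is_derive_quad.
apply/funext => h; rewrite /mexp /mquad /b /c /kA /kT /=.
have -> : lsubmx (h *: v + X) = h *: lsubmx v + lsubmx X by rewrite linearD linearZ.
rewrite !(dotvDl, dotvDr) !(dotvZl, dotvZr) [dotv (lsubmx v) (lsubmx X)]dotvC.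
by field.
Qed.

Lemma is_derive_mexp_t X (t : R) y xi : 0 < t ->
  is_derive t 1 (fun t => mexp (X, t) y xi) (dtlog (X, t) y xi).
Proof.
move=> t0; have e0 := enorm_ge0 xi.
have dA := is_derive_mehlerA e0 t0.
have dT := is_derive_mehlerT e0 t0.
have A0 := mehlerA_gt0 e0 t0.
have dl : is_derive t 1 (fun t => ln (mehlerA (enorm xi) t)) (- mehlerT (enorm xi) t).
  have := is_derive1_comp (is_derive1_ln A0) dA; rewrite -mulrN mulrA mulVf ?gt_eqF // mul1r.
  by [].
rewrite /mexp /mquad /kA /kT /=.
set a := _ + dotv y y; set b := dotv _ y.
apply: (is_derive_ext (is_deriveB (is_deriveZ (n%:R / 2) dl)
  (is_deriveZ 4^-1 (is_deriveB (is_deriveZ a dT) (is_deriveZ (2 * b) dA))))).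
  by move=> s; rewrite !fctE /= ?scaleRR; ring.
by rewrite /dtlog /kA /kT /GRing.scale /= -/a -/b; ring.
Qed.

Section with_data.
Variables (f1 f2 : 'rV[R]_(n + k) -> R).
Local Notation Ek := (Eker f1 f2).

Lemma is_derive_phase phi X v y z xi :
  is_derive X v (fun X => phase f1 f2 phi X y z xi)
    (dotv xi (rsubmx v) * (sin (theta X z xi + phi) * f1 (row_mx y z) -
                           cos (theta X z xi + phi) * f2 (row_mx y z))).
Proof.
have dth : is_derive X v (fun X => theta X z xi + phi) (- dotv xi (rsubmx v)).
  have := is_deriveD (is_derive_theta X v z xi) (is_derive_cst phi X v).
  by rewrite addr0.
have dc := @is_derive_comp_dir _ _ cos (fun X => theta X z xi + phi) X v _ _ (is_derive_cos _) dth.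
have ds := @is_derive_comp_dir _ _ sin (fun X => theta X z xi + phi) X v _ _ (is_derive_sin _) dth.
apply: (is_derive_ext (is_deriveD (is_deriveZ (f1 (row_mx y z)) dc)
  (is_deriveZ (f2 (row_mx y z)) ds))).
  by move=> X'; rewrite !fctE /phase /= ?scaleRR; ring.
by rewrite /GRing.scale /=; ring.
Qed.

Lemma is_derive_Eker_dir phi X v t y z xi :
  is_derive X v (fun X => Ek phi (X, t) y z xi)
    ((dotv xi (rsubmx v) * (sin (theta X z xi + phi) * f1 (row_mx y z) -
                           cos (theta X z xi + phi) * f2 (row_mx y z)) -
     (kT (X, t) xi * dotv (lsubmx X) (lsubmx v) - kA (X, t) xi * dotv (lsubmx v) y) / 2 *
       phase f1 f2 phi X y z xi) * expR (mexp (X, t) y xi)).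
Proof.
have de := @is_derive_comp_dir _ _ expR (fun X => mexp (X, t) y xi) X v _ _ (is_derive_expR _)
  (is_derive_mexp_x X v t y xi).
have := is_deriveM (is_derive_phase phi X v y z xi) de.
move/is_derive_eq; apply; rewrite /GRing.scale /=; ring.
Qed.

Lemma lsubmx_dirv (i : 'I_(n + k)) : lsubmx (dirv R i) =
  match fintype.split i with inl a => dirv R a | inr _ => 0 end.
Proof.
apply/rowP => j; rewrite !mxE eqxx /=.
case: (split_ordP i) => a ->; rewrite ?split_lshift ?split_rshift !mxE ?eqxx /=.
  by rewrite (inj_eq (@lshift_inj _ _)).
by rewrite eq_lrshift.
Qed.

Lemma rsubmx_dirv (i : 'I_(n + k)) : rsubmx (dirv R i) =
  match fintype.split i with inl a => 0 | inr b => dirv R b end.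
Proof.
apply/rowP => j; rewrite !mxE eqxx /=.
case: (split_ordP i) => a ->; rewrite ?split_lshift ?split_rshift !mxE ?eqxx /=.
  by rewrite eq_rlshift.
by rewrite (inj_eq (@rshift_inj _ _)).
Qed.

(** Along a [w]-coordinate only [mexp] varies. Along an [s]-coordinate only the phase does, and
    [cos (a - pi/2) = sin a], [sin (a - pi/2) = - cos a] express its derivative as [xi 0 b] times
    the phase turned by [- pi/2]. *)
Lemma is_derive_Eker_x i phi X t y z xi :
  is_derive X (dirv R i) (fun X => Ek phi (X, t) y z xi)
    (dlog i (X, t) y xi * Ek (phi + dphase i) (X, t) y z xi).
Proof.
apply: is_derive_eq (is_derive_Eker_dir phi X (dirv R i) t y z xi) _.
rewrite lsubmx_dirv rsubmx_dirv /dlog /dphase /Eker /phase /=.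
case: (split_ordP i) => j ij.
  rewrite ij dotv0r dotv_dirv [dotv (dirv R j) y]dotvC dotv_dirv mxE addr0; ring.
rewrite dotv_dirv dotv0r dotvC dotv0r addrA cosB sinB cos_pihalf sin_pihalf; ring.
Qed.

Lemma is_derive_Eker_t phi X (t : R) y z xi : 0 < t ->
  is_derive t 1 (fun t => Ek phi (X, t) y z xi)
    (dtlog (X, t) y xi * Ek phi (X, t) y z xi).
Proof.
move=> t0.
have de := @is_derive1_comp _ expR (fun t => mexp (X, t) y xi) t _ _ (is_derive_expR _)
  (is_derive_mexp_t X y xi t0).
have := is_deriveZ (phase f1 f2 phi X y z xi) de.
by move/is_derive_eq; apply; rewrite /Eker /GRing.scale /=; ring.
Qed.

Lemma is_derive_dlog i j X t y xi :
  is_derive X (dirv R i) (fun X => dlog j (X, t) y xi) (ddlog i j (X, t) xi).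
Proof.
rewrite /dlog /ddlog; case: (fintype.split j) => [a|b]; last exact: is_derive_cst.
apply: (is_derive_ext (is_deriveD
    (is_deriveZ (- (kT (X, t) xi / 2)) (is_derive_coord X (dirv R i) j))
    (is_derive_cst (kA (X, t) xi * y 0 a / 2) X (dirv R i)))).
  by move=> X'; rewrite !fctE /kT /kA /= ?scaleRR; field.
rewrite mxE eqxx /= eq_sym /GRing.scale /=.
by case: (i == j); rewrite /= ?mulr1 ?mulr0 addr0.
Qed.

Lemma is_derive_dlog_Eker i j phi X t y z xi :
  is_derive X (dirv R i) (fun X => dlog j (X, t) y xi * Ek phi (X, t) y z xi)
    ((dlog j (X, t) y xi * dlog i (X, t) y xi + ddlog i j (X, t) xi) *
      Ek (phi + dphase i) (X, t) y z xi).
Proof.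
have := is_deriveM (is_derive_dlog i j X t y xi) (is_derive_Eker_x i phi X t y z xi).
move/is_derive_eq; apply; rewrite /GRing.scale /=.
(* The two terms of the product rule carry different phases. They can be merged because [ddlog i j]
   vanishes unless [i = j] is a [w]-coordinate, and then [dphase i = 0]. *)
have -> : Ek phi (X, t) y z xi * ddlog i j (X, t) xi =
    Ek (phi + dphase i) (X, t) y z xi * ddlog i j (X, t) xi.
  rewrite /ddlog /dphase; case: (split_ordP j) => a ja; last by rewrite !mulr0.
  case: eqP => [->|_]; last by rewrite !mulr0.
  by rewrite ja split_lshift addr0.
ring.
Qed.

End with_data.

(** The minus sign anticipates the half-turn of the phase caused by two [s]-derivatives. The second
    sum is [|xi|^2], and [T^2 - |xi|^2 = A^2] turns the coefficient of [|w|^2] into the one in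
    [dtlog]. *)
Lemma dlog_laplacian p y xi : 0 < p.2 ->
  \sum_(a < n) (dlog (lshift k a) p y xi * dlog (lshift k a) p y xi +
                ddlog (lshift k a) (lshift k a) p xi) -
  enorm (lsubmx p.1) ^+ 2 / 4 *
    \sum_(b < k) (dlog (rshift n b) p y xi * dlog (rshift n b) p y xi +
                ddlog (rshift n b) (rshift n b) p xi) = dtlog p y xi.
Proof.
move=> p0; rewrite enorm_sqr.
have -> : \sum_(b < k) (dlog (rshift n b) p y xi * dlog (rshift n b) p y xi +
                ddlog (rshift n b) (rshift n b) p xi) = enorm xi ^+ 2.
  rewrite enorm_sqr; apply: eq_bigr => b _.
  by rewrite /dlog /ddlog split_rshift addr0.
have TA : kT p xi ^+ 2 = kA p xi ^+ 2 + enorm xi ^+ 2.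
  by rewrite /kT mehlerT_sqr // enorm_ge0.
rewrite (eq_bigr (fun a => kT p xi ^+ 2 / 4 * (lsubmx p.1 0 a * lsubmx p.1 0 a)
  + (- (kT p xi * kA p xi / 2)) * (lsubmx p.1 0 a * y 0 a)
  + kA p xi ^+ 2 / 4 * (y 0 a * y 0 a) + (- (kT p xi / 2)))); last first.
  move=> a _; rewrite /dlog /ddlog split_lshift eqxx mxE.
  by field.
rewrite !big_split /= -!mulr_sumr -/(dotv _ _) -/(dotv _ _) -/(dotv y y).
rewrite sumr_const card_ord -mulr_natl /dtlog TA.
by field.
Qed.

End kernel_derivatives.

(** * The heat equation *)

Section heat_equation.
Context {R : realType} {n k : nat}.
Local Notation mR := (measurableTypeR R).
Local Notation lebt := (@lebesgue_tuple R).
Local Notation P := ('rV[R]_(n + k) * R)%type.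
Local Notation mu := (sigma_product (lebt n) (lebt k) \x lebt k)%E.
Implicit Types (p q : P) (y : 'rV[R]_n) (z xi : 'rV[R]_k) (X v : 'rV[R]_(n + k)).

Variables (f1 f2 : 'rV[R]_(n + k) -> R).
Hypotheses (sf1 : rschwartz f1) (sf2 : rschwartz f2) (hn : (0 < n)%N).
Variable c : R.

Definition sym1 (j : 'I_(n + k)) p y xi : R := c * dlog j p y xi.
Definition sym2 (i j : 'I_(n + k)) p y xi : R :=
  c * (dlog j p y xi * dlog i p y xi + ddlog i j p xi).
Definition symt p y xi : R := c * dtlog p y xi.

Lemma symbol1 j : symbol (sym1 j).
Proof. exact: symbolM (symbol_cst c) (symbol_dlog j). Qed.

Lemma symbol2 i j : symbol (sym2 i j).
Proof.
exact: symbolM (symbol_cst c) (symbolD (symbolM (symbol_dlog j) (symbol_dlog i)) (symbol_ddlog i j)).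
Qed.

Lemma symbolt : symbol symt.
Proof. exact: symbolM (symbol_cst c) symbol_dtlog. Qed.

Local Notation W := (kint f1 f2).

Lemma kint_derive1 phi j X t : 0 < t ->
  is_derive X (dirv R j) (fun X => W (fun _ _ _ => c) phi (X, t))
    (W (sym1 j) (phi + dphase j) (X, t)).
Proof.
move=> t0; apply: (kint_is_derive_x sf1 sf2 hn) => //.
- exact: symbol_cst.
- exact: symbol1.
move=> X' y z xi; apply: (is_derive_ext (is_deriveZ c (is_derive_Eker_x f1 f2 j phi X' t y z xi))) => //.
by rewrite scaleRR /sym1 mulrA.
Qed.

Lemma kint_derive2 phi i j X t : 0 < t ->
  is_derive X (dirv R i) (fun X => W (sym1 j) phi (X, t))
    (W (sym2 i j) (phi + dphase i) (X, t)).
Proof.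
move=> t0; apply: (kint_is_derive_x sf1 sf2 hn) => //.
- exact: symbol1.
- exact: symbol2.
move=> X' y z xi; apply: (is_derive_ext (is_deriveZ c (is_derive_dlog_Eker f1 f2 i j phi X' t y z xi))).
  by move=> X''; rewrite /sym1 -mulrA.
by rewrite scaleRR /sym2 mulrA.
Qed.

Lemma kint_derivet phi X (t : R) : 0 < t ->
  is_derive t 1 (fun t => W (fun _ _ _ => c) phi (X, t)) (W symt phi (X, t)).
Proof.
move=> t0; apply: (kint_is_derive_t sf1 sf2 hn) => //.
- exact: symbol_cst.
- exact: symbolt.
move=> y z xi s s0; apply: (is_derive_ext (is_deriveZ c (is_derive_Eker_t f1 f2 phi X y z xi s0))) => //.
by rewrite scaleRR /symt mulrA.
Qed.

Lemma kintD Q1 Q2 phi p : symbol Q1 -> symbol Q2 -> 0 < p.2 ->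
  W (fun p y xi => Q1 p y xi + Q2 p y xi) phi p = W Q1 phi p + W Q2 phi p.
Proof.
move=> s1 s2 p0; rewrite /kint -RintegralD //; last 2 first.
- exact: integrable_integ.
- exact: integrable_integ.
by apply: eq_Rintegral => o _; rewrite /integ mulrDl.
Qed.

Lemma kintZ (a : R) Q phi p : symbol Q -> 0 < p.2 ->
  W (fun p y xi => a * Q p y xi) phi p = a * W Q phi p.
Proof.
move=> sQ p0; rewrite /kint -RintegralZl //; last exact: integrable_integ.
by apply: eq_Rintegral => o _; rewrite /integ mulrA.
Qed.

Lemma kint0 phi p : W (fun _ _ _ => 0) phi p = 0.
Proof.
transitivity (\int[mu]_o (cst 0 o : R)); last by rewrite /Rintegral integral0.
by apply: eq_Rintegral => o _; rewrite /integ mul0r.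
Qed.

Lemma kint_sum I (s : seq I) Q phi p : (forall i, symbol (Q i)) -> 0 < p.2 ->
  W (fun p y xi => \sum_(i <- s) Q i p y xi) phi p = \sum_(i <- s) W (Q i) phi p.
Proof.
move=> sQ p0; elim: s => [|i s IH].
  rewrite big_nil -[RHS](kint0 phi p); congr (W _ _ _).
  by apply/funext => p'; apply/funext => y; apply/funext => xi; rewrite big_nil.
rewrite big_cons -IH -kintD //; last exact: symbol_sum.
congr (W _ _ _).
by apply/funext => p'; apply/funext => y; apply/funext => xi; rewrite big_cons.
Qed.

(** Two quarter-turns make a half-turn, which changes the sign of both cosine and sine. *)
Lemma kint_phaseNpi Q phi p : symbol Q -> 0 < p.2 ->
  W Q (phi + - (pi / 2) + - (pi / 2)) p = - W Q phi p.
Proof.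
move=> sQ p0; rewrite -[RHS]mulN1r -kintZ //; apply: eq_Rintegral => o _.
rewrite /integ /Eker /phase.
have -> (th : R) : th + (phi + - (pi / 2) + - (pi / 2)) = th + phi - pi.
  by field.
rewrite cosB sinB cospi sinpi; ring.
Qed.

(** Linearity in the symbol collects all terms into one integral at phase 0, whose symbol vanishes
    pointwise by [dlog_laplacian]. *)
Lemma kint_heat X t : 0 < t ->
  \sum_(a < n) W (sym2 (lshift k a) (lshift k a))
      (0 + dphase (lshift k a) + dphase (lshift k a)) (X, t)
  + enorm (lsubmx X) ^+ 2 / 4 * \sum_(b < k) W (sym2 (rshift n b) (rshift n b))
      (0 + dphase (rshift n b) + dphase (rshift n b)) (X, t)
  - W symt 0 (X, t) = 0.
Proof.
move=> t0.
rewrite (eq_bigr (fun a => W (sym2 (lshift k a) (lshift k a)) 0 (X, t))); last first.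
  by move=> a _; rewrite /dphase split_lshift !addr0.
rewrite [X in _ + _ * X](eq_bigr (fun b => W (fun p y xi => (-1) * sym2 (rshift n b) (rshift n b) p y xi) 0 (X, t))); last first.
  move=> b _; rewrite /dphase split_rshift kint_phaseNpi //; last exact: symbol2.
  by rewrite (@kintZ (-1) (sym2 (rshift n b) (rshift n b)) 0 (X, t) (symbol2 _ _) t0) mulN1r.
have sN b : symbol (fun p y xi => (-1) * sym2 (rshift n b) (rshift n b) p y xi).
  exact: symbolM (symbol_cst _) (symbol2 _ _).
have sN' := symbol_sum (index_enum 'I_k) sN.
have sL := symbol_sum (index_enum 'I_n) (fun a => symbol2 (lshift k a) (lshift k a)).
rewrite -!kint_sum //; last by move=> a; exact: symbol2.
rewrite -kintZ // -kintD //; last exact: symbolM (symbol_cst _) sN'.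
rewrite -[X in _ + X]mulN1r -kintZ //; last exact: symbolt.
rewrite -kintD //; last 2 first.
- exact: symbolD sL (symbolM (symbol_cst _) sN').
- exact: symbolM (symbol_cst _) symbolt.
rewrite -[RHS](kint0 0 (X, t)).
apply: eq_Rintegral => o _; congr (_ * _).
rewrite /symt -(@dlog_laplacian _ _ _ (X, t)) // /sym2 -!mulr_sumr /=.
ring.
Qed.

End heat_equation.

(** * The Gaussian *)

Section gaussian.
Context {R : realType}.
Local Notation mR := (measurableTypeR R).
Local Notation lebt := (@lebesgue_tuple R).

Definition gaussv d (x : 'rV[R]_d) : R := expR (- dotv x x).

Lemma gaussv_ge0 d (x : 'rV[R]_d) : 0 <= gaussv x.
Proof. exact: expR_ge0. Qed.

(** [- r^2 <= 1 - 2 r] bounds the Gaussian by [e] times an exponential of rate 2. *)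
Lemma gaussv_le d m : exists2 C : R, 0 < C &
  forall x : 'rV[R]_d, gaussv x <= C / wt x ^+ m.
Proof.
have [C C0 HC] := @expRN_enorm_le R d 2 m (ltr0Sn R 1).
exists (expR 1 * C) => [|x]; first by rewrite mulr_gt0 // expR_gt0.
rewrite -mulrA; apply: le_trans (ler_wpM2l (expR_ge0 1) (HC x)).
rewrite -expRD ler_expR -enorm_sqr.
have := sqr_ge0 (enorm x - 1); nra.
Qed.

Lemma measurable_gaussv d : measurable_fun setT (fun x : d.-tuple mR => gaussv (vec x)).
Proof.
apply: measurableT_comp; first exact: measurable_expR.
apply: measurableT_comp => //; apply: measurable_dotv => i; exact: measurable_vec.
Qed.

Lemma integrable_le_wtV d (F : d.-tuple mR -> R) C : measurable_fun setT F ->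
  (forall x, `|F x| <= C / wt (vec x)) -> (lebt d).-integrable setT (EFin \o F).
Proof.
move=> mF bF; apply: (integrable_dominated mF _ bF).
exact: (integrableZl measurableT C (integrable_wtV d)).
Qed.

Lemma integrable_gaussv d : (lebt d).-integrable setT (EFin \o (fun x => gaussv (vec x))).
Proof.
have [C C0 HC] := gaussv_le d 1.
apply: (@integrable_le_wtV _ _ C); first exact: measurable_gaussv.
move=> x.
by rewrite ger0_norm ?gaussv_ge0 // -[wt _]expr1.
Qed.

Lemma Rintegral_gaussv d : \int[lebt d]_x gaussv (vec x) = Num.sqrt pi ^+ d.
Proof.
rewrite /Rintegral.
rewrite (eq_integral (fun x : d.-tuple mR => (\prod_(i < d) gauss_fun (tnth x i))%:E)); last first.
  move=> x _; congr (_%:E); rewrite /gaussv /dotv -sumrN expR_sum.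
  by apply: eq_bigr => i _; rewrite mxE /gauss_fun expr2.
rewrite (@ge0_integral_prod_tuple R d (fun _ => gauss_fun)).
- under eq_bigr do rewrite integralT_gauss.
  by rewrite prodEFin /= prodr_const card_ord.
- by move=> _ x; exact: gauss_fun_ge0.
- by move=> _; exact: measurable_gauss_fun.
Qed.

Section fourier.
Variables (d : nat) (y : 'rV[R]_d) (phi : R).

Let Psi (s : R) := \int[lebt d]_x (cos (s * dotv (vec x) y + phi) * gaussv (vec x)).

Let measurable_arg (s : R) :
  measurable_fun setT (fun x : d.-tuple mR => s * dotv (vec x) y + phi).
Proof.
apply: measurable_funD => //; apply: measurable_funM => //.
by apply: measurable_dotv => i //; exact: measurable_vec.
Qed.

Let measurable_cos_arg s :
  measurable_fun setT (fun x : d.-tuple mR => cos (s * dotv (vec x) y + phi)).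
Proof.
apply: measurableT_comp (measurable_arg s); apply: continuous_measurable_fun.
exact: continuous_cos.
Qed.

Let measurable_sin_arg s :
  measurable_fun setT (fun x : d.-tuple mR => sin (s * dotv (vec x) y + phi)).
Proof.
apply: measurableT_comp (measurable_arg s); apply: continuous_measurable_fun.
exact: continuous_sin.
Qed.

Let dot_bound (x : 'rV[R]_d) : `|dotv x y| <= (\sum_(i < d) `|y 0 i|) * wt x.
Proof.
rewrite mulr_suml; apply: le_trans (ler_norm_sum _ _ _) _; apply: ler_sum => i _.
by rewrite normrM mulrC ler_wpM2l // coord_le_wt.
Qed.

Let integrable_coord (g : d.-tuple mR -> R) i : measurable_fun setT g ->
  (forall x, `|g x| <= 1) ->
  (lebt d).-integrable setT (EFin \o (fun x => vec x 0 i * g x * gaussv (vec x))).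
Proof.
move=> mg g1; have [C C0 HC] := gaussv_le d 2.
apply: (@integrable_le_wtV _ _ C).
  apply: measurable_funM; last exact: measurable_gaussv.
  by apply: measurable_funM => //; exact: measurable_vec.
move=> x; rewrite !normrM [X in _ * X]ger0_norm ?gaussv_ge0 //.
have w0 := wt_gt0 (vec x).
apply: (@le_trans _ _ (wt (vec x) * 1 * (C / wt (vec x) ^+ 2))).
  apply: ler_pM; rewrite ?mulr_ge0 ?gaussv_ge0 //.
  by apply: ler_pM => //; exact: coord_le_wt.
by rewrite le_eqVlt; apply/orP; left; apply/eqP; field; rewrite gt_eqF.
Qed.

Let derive_Psi (s : R) : is_derive s 1 Psi
  (\int[lebt d]_x (- (dotv (vec x) y * sin (s * dotv (vec x) y + phi) * gaussv (vec x)))).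
Proof.
have [C C0 HC] := gaussv_le d 2.
pose Y := \sum_(i < d) `|y 0 i|.
have Y0 : 0 <= Y by apply: sumr_ge0.
apply: (@is_derive_Rintegral _ _ _ (lebt d)
  (fun s x => cos (s * dotv (vec x) y + phi) * gaussv (vec x))
  (fun s x => - (dotv (vec x) y * sin (s * dotv (vec x) y + phi) * gaussv (vec x)))
  s (s - 1) (s + 1) (fun x => Y * C * (wt (vec x))^-1)).
- by rewrite in_itv /=; apply/andP; split; lra.
- move=> u _; apply: (integrable_dominated _ (integrable_gaussv d)).
    by apply: measurable_funM; [exact: measurable_cos_arg|exact: measurable_gaussv].
  move=> x; rewrite normrM [X in _ * X]ger0_norm ?gaussv_ge0 //.
  by rewrite ler_piMl ?gaussv_ge0 // normr_cos_le.
- move=> u x _; set a := dotv _ _; set g := gaussv _.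
  have da : is_derive u 1 (fun u => u * a + phi) a.
    by apply: is_derive_eq; rewrite !scaleRR; ring.
  have dc := @is_derive1_comp _ cos (fun u => u * a + phi) u _ _ (is_derive_cos _) da.
  apply: (is_derive_ext (is_deriveZ g dc)).
    by move=> v; exact: mulrC.
  by rewrite scaleRR; ring.
- exact: (integrableZl measurableT (Y * C) (integrable_wtV d)).
- move=> u x _; rewrite normrN !normrM [X in _ * X]ger0_norm ?gaussv_ge0 //.
  have w0 := wt_gt0 (vec x).
  apply: (@le_trans _ _ (Y * wt (vec x) * 1 * (C / wt (vec x) ^+ 2))).
    apply: ler_pM; rewrite ?mulr_ge0 ?gaussv_ge0 //.
    by apply: ler_pM; rewrite ?normr_ge0 ?normr_sin_le //; exact: dot_bound.
  by rewrite le_eqVlt; apply/orP; left; apply/eqP; field; rewrite gt_eqF.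
Qed.

(** The derivative of [sin * gaussv] along coordinate [i], namely
    [s y_i cos * gaussv - 2 x_i sin * gaussv], integrates to 0. *)
Let by_parts s (i : 'I_d) :
  \int[lebt d]_x (vec x 0 i * sin (s * dotv (vec x) y + phi) * gaussv (vec x)) =
  s * y 0 i / 2 * Psi s.
Proof.
pose F (x : 'rV[R]_d) := sin (s * dotv x y + phi) * gaussv x.
pose F' (x : 'rV[R]_d) := s * y 0 i * (cos (s * dotv x y + phi) * gaussv x)
  - 2 * (x 0 i * sin (s * dotv x y + phi) * gaussv x).
have dF x : is_derive x (dirv R i) F (F' x).
  have da : is_derive x (dirv R i) (fun x => s * dotv x y + phi) (s * y 0 i).
    apply/is_derive_line0.
    rewrite (_ : (fun _ => _) = fun h => (s * dotv x y + phi) + (s * y 0 i) * h + 0 * h ^+ 2).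
      exact: is_derive_quad.
    apply/funext => h; rewrite dotvDl dotvZl [dotv (dirv R i) y]dotvC dotv_dirv; ring.
  have dn : is_derive x (dirv R i) (fun x => - dotv x x) (- 2 * x 0 i).
    apply/is_derive_line0.
    rewrite (_ : (fun _ => _) = fun h => (- dotv x x) + (- 2 * x 0 i) * h +
      (- dotv (dirv R i) (dirv R i)) * h ^+ 2); first exact: is_derive_quad.
    apply/funext => h; rewrite !(dotvDl, dotvDr) !(dotvZl, dotvZr) [dotv (dirv R i) x]dotvC.
    by rewrite [dotv x (dirv R i)]dotv_dirv; ring.
  have ds := @is_derive_comp_dir _ _ sin (fun x => s * dotv x y + phi) x _ _ _ (is_derive_sin _) da.
  have de := @is_derive_comp_dir _ _ expR (fun x => - dotv x x) x _ _ _ (is_derive_expR _) dn.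
  apply: (is_derive_ext (is_deriveM ds de)) => //.
  by rewrite !scaleRR /F' /gaussv /=; ring.
have [C C0 HC] := gaussv_le d 2.
pose K := C * (`|s * y 0 i| + 2).
have wC (x : 'rV[R]_d) : C / wt x ^+ 2 <= C / wt x.
  rewrite ler_wpM2l ?(ltW C0) // lef_pV2 ?posrE ?exprn_gt0 ?wt_gt0 //.
  by rewrite expr2 ler_peMr ?wt_ge1 // ltW ?wt_gt0.
have bF x : `|F x| <= K * (wt x)^-1.
  rewrite normrM [X in _ * X]ger0_norm ?gaussv_ge0 //.
  apply: (@le_trans _ _ (1 * (C / wt x ^+ 2))).
    by apply: ler_pM; rewrite ?gaussv_ge0 // normr_sin_le.
  rewrite mul1r (le_trans (wC x)) // /K -mulrA ler_wpM2l ?(ltW C0) //.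
  by rewrite ler_peMl ?invr_ge0 ?(ltW (wt_gt0 _)) //; have := normr_ge0 (s * y 0 i); lra.
have bF' x : `|F' x| <= K * (wt x)^-1.
  apply: le_trans (ler_normB _ _) _; rewrite /K mulrDr mulrDl.
  have w0 := wt_gt0 x.
  apply: lerD.
    rewrite normrM [leRHS]mulrAC [leLHS]mulrC ler_wpM2r // normrM [X in _ * X]ger0_norm ?gaussv_ge0 //.
    apply: le_trans (wC x); rewrite -[leRHS]mul1r.
    by apply: ler_pM; rewrite ?gaussv_ge0 // normr_cos_le.
  rewrite normrM (@ger0_norm _ 2) // [leRHS]mulrAC [leLHS]mulrC ler_wpM2r // !normrM.
  rewrite [X in _ * X]ger0_norm ?gaussv_ge0 //.
  apply: (@le_trans _ _ (wt x * 1 * (C / wt x ^+ 2))).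
    apply: ler_pM; rewrite ?mulr_ge0 ?gaussv_ge0 //.
    by apply: ler_pM => //; [exact: coord_le_wt|exact: normr_sin_le].
  by rewrite le_eqVlt; apply/orP; left; apply/eqP; field; rewrite gt_eqF.
have mF : measurable_fun setT (fun x : d.-tuple mR => F (vec x)).
  by apply: measurable_funM; [exact: measurable_sin_arg|exact: measurable_gaussv].
have := Rintegral_derive_eq0 mF dF bF bF'.
have i1 : (lebt d).-integrable setT
    (EFin \o (fun x => cos (s * dotv (vec x) y + phi) * gaussv (vec x))).
  apply: (integrable_dominated _ (integrable_gaussv d)).
    by apply: measurable_funM; [exact: measurable_cos_arg|exact: measurable_gaussv].
  move=> x; rewrite normrM [X in _ * X]ger0_norm ?gaussv_ge0 //.
  by rewrite ler_piMl ?gaussv_ge0 // normr_cos_le.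
have i2 := integrable_coord i (measurable_sin_arg s) (fun x => normr_sin_le _).
rewrite /F' RintegralB //; last 2 first.
- exact: (integrableZl measurableT (s * y 0 i) i1).
- exact: (integrableZl measurableT 2 i2).
rewrite RintegralZl // RintegralZl // -/(Psi s).
set J := \int[_]_x _; move=> h; lra.
Qed.

(** Scaling the frequency by [s] gives [Psi' = - (s/2) |y|^2 Psi], by parts. Hence
    [Psi s * e^(s^2 |y|^2 / 4)] is constant, and its values at 0 and 1 are compared. The phase [phi]
    covers cosine and sine at once. *)
Lemma gaussian_fourier :
  \int[lebt d]_x (cos (dotv (vec x) y + phi) * gaussv (vec x)) =
  cos phi * Num.sqrt pi ^+ d * expR (- (dotv y y / 4)).
Proof.
have dPsi (s : R) : is_derive s 1 Psi (- (s / 2 * dotv y y) * Psi s).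
  apply: is_derive_eq (derive_Psi s) _.
  transitivity (\int[lebt d]_x (\sum_(i < d) - y 0 i *
      (vec x 0 i * sin (s * dotv (vec x) y + phi) * gaussv (vec x)))).
    apply: eq_Rintegral => x _; rewrite {1}/dotv !mulr_suml -sumrN.
    by apply: eq_bigr => i _; ring.
  have iS i := integrable_coord i (measurable_sin_arg s) (fun x => normr_sin_le _).
  (* Integrability and value of the partial sums are proved together: splitting off one term needs
     the rest to be integrable. *)
  have P (r : seq 'I_d) :
     (lebt d).-integrable setT (EFin \o (fun x => \sum_(i <- r) - y 0 i *
      (vec x 0 i * sin (s * dotv (vec x) y + phi) * gaussv (vec x)))) /\
     \int[lebt d]_x (\sum_(i <- r) - y 0 i *
      (vec x 0 i * sin (s * dotv (vec x) y + phi) * gaussv (vec x))) =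
     \sum_(i <- r) - y 0 i * (s * y 0 i / 2 * Psi s).
    elim: r => [|i r [IH1 IH2]].
      split; first by under [X in EFin \o X]eq_fun do rewrite big_nil; exact: integrable0.
      under eq_Rintegral do rewrite big_nil.
      by rewrite big_nil /Rintegral integral0.
    have iZ := integrableZl measurableT (- y 0 i) (iS i).
    split.
      under [X in EFin \o X]eq_fun do rewrite big_cons.
      exact: (integrableD measurableT iZ IH1).
    under eq_Rintegral do rewrite big_cons.
    by rewrite RintegralD // IH2 RintegralZl // by_parts big_cons.
  have [_ ->] := P (index_enum 'I_d).
  rewrite {1}/dotv mulr_sumr -sumrN mulr_suml; apply: eq_bigr => i _; by field.
pose H s := Psi s * expR (s ^+ 2 / 4 * dotv y y).
have dH (s : R) : is_derive s 1 H 0.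
  have da : is_derive s 1 (fun s => s ^+ 2 / 4 * dotv y y) (s / 2 * dotv y y).
    by apply: is_derive_eq; rewrite !scaleRR; field.
  have de := @is_derive1_comp _ expR (fun s => s ^+ 2 / 4 * dotv y y) s _ _ (is_derive_expR _) da.
  apply: (is_derive_ext (is_deriveM (dPsi s) de)) => //.
  by rewrite !scaleRR /=; ring.
have H01 : H 1 = H 0.
  have cH : {within `[0, 1], continuous H}.
    by apply: derivable_within_continuous => s _; have ? := dH s; exact: ex_derive.
  have [c _] := @MVT _ H (fun=> 0) 0 1 ltr01 (fun s _ => dH s) cH.
  by rewrite mul0r => /eqP; rewrite subr_eq0 => /eqP.
have H0 : H 0 = cos phi * Num.sqrt pi ^+ d.
  rewrite /H expr0n /= !mul0r expR0 mulr1 /Psi -Rintegral_gaussv -RintegralZl //; last first.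
    exact: integrable_gaussv.
  by apply: eq_Rintegral => x _; rewrite mul0r add0r.
rewrite -H0 -H01 /H expr1n -[RHS]mulrA -expRD.
rewrite (_ : 1 / 4 * dotv y y + - (dotv y y / 4) = 0) ?expR0 ?mulr1; last by field.
by apply: eq_Rintegral => x _; rewrite mul1r.
Qed.

End fourier.
End gaussian.

(** * Partial Fourier transforms *)

Section phase_integral.
Context {R : realType} {n k : nat}.
Local Notation mR := (measurableTypeR R).
Local Notation lebt := (@lebesgue_tuple R).
Implicit Types (y : 'rV[R]_n) (z xi : 'rV[R]_k) (X : 'rV[R]_(n + k)).
Implicit Types (g : 'rV[R]_(n + k) -> R).

(** Partial Fourier transform of the data in the last [k] variables, centred at [rsubmx X], in its
    real form with phase. *)
Definition pint (f1 f2 : 'rV[R]_(n + k) -> R) phi X y xi : R :=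
  \int[lebt k]_z phase f1 f2 phi X y (vec z) xi.

Lemma measurable_row_mx g y : rschwartz g ->
  measurable_fun setT (fun z : k.-tuple mR => g (row_mx y (vec z))).
Proof.
move=> sg; have [cg _ _] := sg [::]; apply: continuous_rV_comp_measurable cg _ => i.
case: (split_ordP i) => j ->.
  rewrite (_ : (fun _ => _) = cst (y 0 j)); first exact: measurable_cst.
  by apply/funext => o; rewrite row_mxEl.
rewrite (_ : (fun _ => _) = fun o : k.-tuple mR => vec o 0 j); first exact: measurable_vec.
by apply/funext => o; rewrite row_mxEr.
Qed.

Lemma phase_bound_z (f1 f2 : 'rV[R]_(n + k) -> R) : rschwartz f1 -> rschwartz f2 ->
  exists2 C, 0 <= C & forall phi X y z xi, `|phase f1 f2 phi X y z xi| <= C * (wt z)^-1.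
Proof.
move=> sf1 sf2; have [C C0 HC] := phase_bound sf1 sf2 1.
exists C => // phi X y z xi; apply: le_trans (HC _ _ _ _ _) _.
rewrite expr1 ler_wpM2l // lef_pV2 ?posrE ?mulr_gt0 ?wt_gt0 //.
by rewrite ler_peMl ?wt_ge1 // ltW ?wt_gt0.
Qed.

Lemma measurable_phase_pair (f1 f2 : 'rV[R]_(n + k) -> R) phi X y : rschwartz f1 -> rschwartz f2 ->
  measurable_fun setT (fun o : k.-tuple mR * k.-tuple mR => phase f1 f2 phi X y (vec o.2) (vec o.1)).
Proof.
move=> sf1 sf2.
have mt : measurable_fun setT (fun o : k.-tuple mR * k.-tuple mR => theta X (vec o.2) (vec o.1) + phi).
  apply: measurable_funD => //; apply: measurable_dotv => i.
    exact: (measurableT_comp (measurable_vec i)).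
  rewrite (_ : (fun _ => _) = fun o : k.-tuple mR * k.-tuple mR => vec o.2 0 i - rsubmx X 0 i); last first.
    by apply/funext => o; rewrite !mxE.
  by apply: measurable_funB => //; exact: (measurableT_comp (measurable_vec i)).
apply: measurable_funD; apply: measurable_funM.
- by apply: measurableT_comp mt; apply: continuous_measurable_fun; exact: continuous_cos.
- exact: (measurableT_comp (measurable_row_mx y sf1) measurable_snd).
- by apply: measurableT_comp mt; apply: continuous_measurable_fun; exact: continuous_sin.
- exact: (measurableT_comp (measurable_row_mx y sf2) measurable_snd).
Qed.

(** Lets a fixed row vector be replaced by a tuple, so that measurability of a section follows from
    joint measurability. *)
Lemma vec_surj d (x : 'rV[R]_d) : exists u : d.-tuple mR, vec u = x.
Proof.
exists [tuple (x 0 i : mR) | i < d]; apply/rowP => i.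
by rewrite mxE tnth_mktuple.
Qed.

Lemma measurable_phase_z (f1 f2 : 'rV[R]_(n + k) -> R) phi X y xi : rschwartz f1 -> rschwartz f2 ->
  measurable_fun setT (fun z : k.-tuple mR => phase f1 f2 phi X y (vec z) xi).
Proof.
move=> sf1 sf2; have [u <-] := vec_surj xi.
exact: (measurableT_comp (measurable_phase_pair phi X y sf1 sf2) (measurable_pair1 u)).
Qed.

Lemma integrable_phase_z (f1 f2 : 'rV[R]_(n + k) -> R) phi X y xi : rschwartz f1 -> rschwartz f2 ->
  (lebt k).-integrable setT (EFin \o (fun z : k.-tuple mR => phase f1 f2 phi X y (vec z) xi)).
Proof.
move=> sf1 sf2; have [C C0 HC] := phase_bound_z sf1 sf2.
apply: (@integrable_le_wtV _ _ _ C); first exact: measurable_phase_z.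
by move=> z; exact: HC.
Qed.

Lemma pint_bound0 (f1 f2 : 'rV[R]_(n + k) -> R) : rschwartz f1 -> rschwartz f2 ->
  exists M, forall phi X y xi, `|pint f1 f2 phi X y xi| <= M.
Proof.
move=> sf1 sf2; have [C C0 HC] := phase_bound_z sf1 sf2.
exists (\int[lebt k]_z (C * (wt (vec z))^-1)) => phi X y xi.
have ip := integrable_phase_z phi X y xi sf1 sf2.
apply: le_trans (le_normr_Rintegral measurableT ip) _.
apply: le_Rintegral => //.
- exact: (integrable_norm ip).
- exact: (integrableZl measurableT C (integrable_wtV k)).
Qed.

Lemma row_mx_dirv y z (j : 'I_k) h :
  row_mx y (h *: dirv R j + z) = h *: dirv R (rshift n j) + row_mx y z.
Proof.
apply/rowP => i; rewrite !mxE; case: (split_ordP i) => a ->.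
  by rewrite eq_lrshift andbF mulr0 add0r.
by rewrite !mxE (inj_eq (@rshift_inj _ _)).
Qed.

(** The quarter-turn is opposite to that of [dphase], because [z] and [rsubmx X] enter [theta] with
    opposite signs. The second term differentiates the data. *)
Lemma is_derive_phase_z (f1 f2 : 'rV[R]_(n + k) -> R) (j : 'I_k) phi X y z xi :
  rschwartz f1 -> rschwartz f2 ->
  is_derive z (dirv R j) (fun z => phase f1 f2 phi X y z xi)
    (xi 0 j * phase f1 f2 (phi + pi / 2) X y z xi +
     phase (rpartial (rshift n j) f1) (rpartial (rshift n j) f2) phi X y z xi).
Proof.
move=> sf1 sf2.
have dth : is_derive z (dirv R j) (fun z => theta X z xi + phi) (xi 0 j).
  apply/is_derive_line0.
  rewrite (_ : (fun _ => _) = fun h => (theta X z xi + phi) + xi 0 j * h + 0 * h ^+ 2).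
    exact: is_derive_quad.
  apply/funext => h; rewrite /theta !dotvDr dotvZr dotv_dirv; ring.
have dg g : rschwartz g -> is_derive z (dirv R j) (fun z => g (row_mx y z))
    (rpartial (rshift n j) g (row_mx y z)).
  move=> sg; apply/is_derive_line0; have [_ d _] := sg [::].
  rewrite (_ : (fun _ => _) = fun h => g (h *: dirv R (rshift n j) + row_mx y z)); last first.
    by apply/funext => h; rewrite row_mx_dirv.
  exact: ((is_derive_line0 g (row_mx y z) (dirv R (rshift n j)) _).1 (derivableP (d _ _))).
have dc := @is_derive_comp_dir _ _ cos (fun z => theta X z xi + phi) z _ _ _ (is_derive_cos _) dth.
have ds := @is_derive_comp_dir _ _ sin (fun z => theta X z xi + phi) z _ _ _ (is_derive_sin _) dth.
apply: (is_derive_ext (is_deriveD (is_deriveM dc (dg f1 sf1)) (is_deriveM ds (dg f2 sf2)))) => //.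
have Ec (th : R) : cos (th + (phi + pi / 2)) = - sin (th + phi).
  by rewrite addrA cosD cos_pihalf sin_pihalf mulr0 mulr1 add0r.
have Es (th : R) : sin (th + (phi + pi / 2)) = cos (th + phi).
  by rewrite addrA sinD cos_pihalf sin_pihalf mulr0 mulr1 add0r.
rewrite !scaleRR /phase Ec Es /=; ring.
Qed.

Lemma pint_by_parts (f1 f2 : 'rV[R]_(n + k) -> R) (j : 'I_k) phi X y xi : rschwartz f1 -> rschwartz f2 ->
  xi 0 j * pint f1 f2 (phi + pi / 2) X y xi =
  - pint (rpartial (rshift n j) f1) (rpartial (rshift n j) f2) phi X y xi.
Proof.
move=> sf1 sf2.
have sd1 := rschwartz_partial (rshift n j) sf1.
have sd2 := rschwartz_partial (rshift n j) sf2.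
have [C C0 HC] := phase_bound_z sf1 sf2; have [D D0 HD] := phase_bound_z sd1 sd2.
pose K := C + `|xi 0 j| * C + D.
have KC : C <= K by rewrite /K -addrA lerDl addr_ge0 // mulr_ge0.
have KD : `|xi 0 j| * C + D <= K by rewrite /K -addrA lerDr.
have w0 (z : 'rV[R]_k) : 0 <= (wt z)^-1 by rewrite invr_ge0 ltW // wt_gt0.
have := @Rintegral_derive_eq0 _ _ j _ _ K
  (measurable_phase_z phi X y xi sf1 sf2)
  (fun z => is_derive_phase_z j phi X y z xi sf1 sf2).
move=> /(_ (fun z => le_trans (HC _ _ _ _ _) (ler_wpM2r (w0 z) KC))).
have b z : `|xi 0 j * phase f1 f2 (phi + pi / 2) X y z xi +
     phase (rpartial (rshift n j) f1) (rpartial (rshift n j) f2) phi X y z xi| <= K * (wt z)^-1.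
  apply: le_trans (ler_wpM2r (w0 z) KD); rewrite [leRHS]mulrDl.
  apply: le_trans (ler_normD _ _) _; apply: lerD => //.
  by rewrite normrM -mulrA ler_wpM2l.
move=> /(_ b).
have i1 := integrable_phase_z (phi + pi / 2) X y xi sf1 sf2.
rewrite RintegralD //; last 2 first.
- exact: (integrableZl measurableT (xi 0 j) i1).
- exact: integrable_phase_z.
by rewrite RintegralZl // => /eqP; rewrite addr_eq0 => /eqP.
Qed.

(** Each factor [1 + xi_j^2] of the weight is paid for by two integrations by parts in [z_j]. The
    data are general in the induction since each step replaces them by their derivatives; the phases
    are moved back by [pi/2] to match [pint_by_parts]. The bound is uniform in [y], which makes the
    domination independent of time later. *)
Lemma pint_decay (f1 f2 : 'rV[R]_(n + k) -> R) : rschwartz f1 -> rschwartz f2 ->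
  exists2 M, 0 <= M & forall phi X y xi, `|pint f1 f2 phi X y xi| <= M * (wt xi)^-1.
Proof.
have P (l : seq 'I_k) : forall f1 f2, rschwartz f1 -> rschwartz f2 ->
    exists M, forall phi X y xi,
      \prod_(j <- l) (1 + xi 0 j ^+ 2) * `|pint f1 f2 phi X y xi| <= M.
  elim: l => [|j l IH] g1 g2 s1 s2.
    have [M HM] := pint_bound0 s1 s2; exists M => phi X y xi.
    by rewrite big_nil mul1r.
  have sd1 := rschwartz_partial (rshift n j) s1.
  have sd2 := rschwartz_partial (rshift n j) s2.
  have sdd1 := rschwartz_partial (rshift n j) sd1.
  have sdd2 := rschwartz_partial (rshift n j) sd2.
  have [M1 H1] := IH _ _ s1 s2; have [M2 H2] := IH _ _ sdd1 sdd2.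
  exists (M1 + M2) => phi X y xi.
  apply: le_trans (lerD (H1 phi X y xi) (H2 (phi - pi / 2 - pi / 2) X y xi)).
  rewrite big_cons -mulrA mulrDl mul1r lerD2l mulrCA ler_wpM2l //.
    by apply: prodr_ge0 => i _; rewrite (le_trans ler01 (add1sqr_ge1 _)).
  rewrite -[X in X * _]ger0_norm ?sqr_ge0 // -normrM.
  rewrite expr2 -mulrA -{1}[phi](subrK (pi / 2)) pint_by_parts //.
  rewrite mulrN normrN -{1}[phi - pi / 2](subrK (pi / 2)) pint_by_parts //.
  by rewrite normrN.
move=> sf1 sf2; have [M HM] := P (index_enum 'I_k) f1 f2 sf1 sf2.
exists `|M| => // phi X y xi.
rewrite ler_pdivlMr ?wt_gt0 // mulrC (le_trans (HM _ _ _ _)) //.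
exact: ler_norm.
Qed.

Section continuity.
Variables (f1 f2 : 'rV[R]_(n + k) -> R) (phi : R) (X : 'rV[R]_(n + k)).
Hypotheses (sf1 : rschwartz f1) (sf2 : rschwartz f2).

Lemma continuous_pint_y y xi :
  {for y, continuous (fun y => pint f1 f2 phi X y xi)}.
Proof.
have [C C0 HC] := phase_bound_z sf1 sf2.
apply: (@continuous_Rintegral R _ _ (lebt k) 'rV[R]_n (fun y (z : k.-tuple mR) => phase f1 f2 phi X y (vec z) xi)
  y (fun z : k.-tuple mR => C * (wt (vec z))^-1)).
- by near=> q; exact: measurable_phase_z.
- move=> z.
  have cr : (fun q : 'rV[R]_n => row_mx q (vec z)) @ y --> row_mx y (vec z).
    apply: (@cvgrPdist_le R 'rV[R]_(n + k) _ (nbhs y) (nbhs_filter y) _ _).2 => e e0; near=> q.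
    rewrite opp_row_mx add_row_mx subrr [leLHS]mx_normrE.
    apply/bigmax_leP; split; first exact: ltW.
    move=> [i j] _ /=; rewrite ord1; case: (split_ordP j) => a ->.
      rewrite row_mxEl; apply: le_trans (coord_le_norm _ _) _.
      by near: q; exact: (@cvgr_dist_le R 'rV[R]_n _ (nbhs y) (nbhs_filter y) id y (@cvg_id _ (nbhs y)) _ e0).
    by rewrite row_mxEr mxE normr0 ltW.
  have cg g : rschwartz g -> {for y, continuous (fun q => g (row_mx q (vec z)))}.
    move=> sg; have [c _ _] := sg [::].
    exact: (cvg_comp _ _ cr (c _)).
  apply: continuousD; apply: continuousM; try exact: cst_continuous.
    exact: cg.
  exact: cg.
- exact: (integrableZl measurableT C (integrable_wtV k)).
- by near=> q => z; exact: HC.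
Unshelve. all: by end_near. Qed.

Lemma continuous_pint_xi y xi :
  {for xi, continuous (fun xi => pint f1 f2 phi X y xi)}.
Proof.
have [C C0 HC] := phase_bound_z sf1 sf2.
apply: (@continuous_Rintegral R _ _ (lebt k) 'rV[R]_k (fun xi (z : k.-tuple mR) => phase f1 f2 phi X y (vec z) xi)
  xi (fun z : k.-tuple mR => C * (wt (vec z))^-1)).
- by near=> q; exact: measurable_phase_z.
- move=> z.
  have ct : {for xi, continuous (fun q => theta X (vec z) q + phi)}.
    apply: continuousD; last exact: cst_continuous.
    apply: continuous_at_sum => i.
    apply: continuousM; last exact: cst_continuous.
    exact: coord_continuous.
  apply: continuousD; apply: continuousM; try exact: cst_continuous.
    by apply: (@continuous_comp _ _ _ (fun q => theta X (vec z) q + phi) (@cos R)) => //; exact: continuous_cos.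
  by apply: (@continuous_comp _ _ _ (fun q => theta X (vec z) q + phi) (@sin R)) => //; exact: continuous_sin.
- exact: (integrableZl measurableT C (integrable_wtV k)).
- by near=> q => z; exact: HC.
Unshelve. all: by end_near. Qed.

Lemma measurable_pint y :
  measurable_fun setT (fun xi : k.-tuple mR => pint f1 f2 phi X y (vec xi)).
Proof.
apply: continuous_rV_comp_measurable; first by move=> xi; exact: continuous_pint_xi.
by move=> i; exact: measurable_vec.
Qed.

End continuity.

End phase_integral.

(** * Fourier inversion by Gaussian regularization *)

Section inversion.
Context {R : realType} {n k : nat}.
Local Notation mR := (measurableTypeR R).
Local Notation lebt := (@lebesgue_tuple R).
Implicit Types (y : 'rV[R]_n) (X : 'rV[R]_(n + k)).

Lemma integrable_cos_gaussv d (v : 'rV[R]_d) phi :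
  (lebt d).-integrable setT
    (EFin \o (fun x => cos (dotv (vec x) v + phi) * gaussv (vec x))).
Proof.
apply: (integrable_dominated _ (integrable_gaussv d)).
  apply: measurable_funM; last exact: measurable_gaussv.
  apply: (@measurableT_comp _ _ _ _ _ _ (@cos R)).
    by apply: continuous_measurable_fun; exact: continuous_cos.
  apply: measurable_funD => //; apply: measurable_dotv => i //; exact: measurable_vec.
move=> x; rewrite normrM [X in _ * X]ger0_norm ?gaussv_ge0 //.
by rewrite ler_piMl ?gaussv_ge0 // normr_cos_le.
Qed.

Lemma scaled_cos_gaussv d (v x : 'rV[R]_d) phi e : e != 0 ->
  cos (dotv x v + phi) * gaussv (e *: x) =
  cos (dotv (0 + e *: x) (e^-1 *: v) + phi) * gaussv (0 + e *: x).
Proof. by move=> e0; rewrite !add0r dotvZl dotvZr mulrA divff // mul1r. Qed.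

Lemma integrable_scaled_cos_gaussv d (v : 'rV[R]_d) phi e : 0 < e ->
  (lebt d).-integrable setT
    (EFin \o (fun x => cos (dotv (vec x) v + phi) * gaussv (e *: vec x))).
Proof.
move=> e0; have := @integrable_affine R d 0 e (fun x => cos (dotv x (e^-1 *: v) + phi) * gaussv x)
  e0 (integrable_cos_gaussv (e^-1 *: v) phi).
by apply: eq_integrable => // x _ /=; rewrite -scaled_cos_gaussv // gt_eqF.
Qed.

Lemma gaussian_fourier_scaled d (v : 'rV[R]_d) phi e : 0 < e ->
  \int[lebt d]_x (cos (dotv (vec x) v + phi) * gaussv (e *: vec x)) =
  e ^- d * (cos phi * Num.sqrt pi ^+ d * gaussv ((2 * e)^-1 *: v)).
Proof.
move=> e0; have := @Rintegral_affine R d 0 e (fun x => cos (dotv x (e^-1 *: v) + phi) * gaussv x)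
  e0 (integrable_cos_gaussv (e^-1 *: v) phi).
rewrite gaussian_fourier => h.
have -> : gaussv ((2 * e)^-1 *: v) = expR (- (dotv (e^-1 *: v) (e^-1 *: v) / 4)).
  rewrite /gaussv !(dotvZl, dotvZr); congr expR; field; exact: lt0r_neq0.
rewrite h mulrA mulVf ?mul1r ?expf_neq0 ?gt_eqF //.
by apply: eq_Rintegral => x _; rewrite -scaled_cos_gaussv // gt_eqF.
Qed.

Variables (f1 f2 : 'rV[R]_(n + k) -> R).
Hypotheses (sf1 : rschwartz f1) (sf2 : rschwartz f2).

Lemma row_mx_bound (g : 'rV[R]_(n + k) -> R) : rschwartz g ->
  exists2 C, 0 <= C & forall x, `|g x| <= C.
Proof.
move=> sg; have [_ _ /(_ 0%N)[M HM]] := sg [::].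
exists `|M| => // x; apply: le_trans (ler_norm _); have := HM x.
by rewrite expr0 divr1 => h; rewrite (le_trans h).
Qed.

Lemma measurable_gaussv_scaled d e :
  measurable_fun setT (fun x : d.-tuple mR => gaussv (e *: vec x)).
Proof.
apply: measurableT_comp; first exact: measurable_expR.
apply: measurableT_comp => //; apply: measurable_dotv => i;
  rewrite (_ : (fun _ => _) = fun x : d.-tuple mR => e * vec x 0 i);
  do ?[by apply: measurable_funM => //; exact: measurable_vec];
  by apply/funext => x; rewrite mxE.
Qed.

Lemma gaussv_le1 d (x : 'rV[R]_d) : gaussv x <= 1.
Proof. by rewrite -expR0 ler_expR oppr_le0 dotv_ge0. Qed.

(** The Gaussian makes the double integral in [(xi, z)] absolutely convergent, so [xi] can be
    integrated first. This leaves a Gaussian in [z] of width [2 e] around [rsubmx X], normalized by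
    [z = rsubmx X + 2 e u]; the constant is [e^-k * sqrt pi ^ k * (2 e)^k]. *)
Lemma regularized_inversion X y e : 0 < e ->
  \int[lebt k]_xi (gaussv (e *: vec xi) * pint f1 f2 0 X y (vec xi)) =
  (2 * Num.sqrt pi) ^+ k * \int[lebt k]_u
    (f1 (row_mx y (rsubmx X + (2 * e) *: vec u)) * gaussv (vec u)).
Proof.
move=> e0; have ne0 : e != 0 by rewrite gt_eqF.
pose F (o : k.-tuple mR * k.-tuple mR) :=
  gaussv (e *: vec o.1) * phase f1 f2 0 X y (vec o.2) (vec o.1).
have [C C0 HC] := phase_bound_z sf1 sf2.
have [D D0 HD] := @gaussv_le R k 1.
have ig : (lebt k).-integrable setT (EFin \o (fun x : k.-tuple mR => gaussv (e *: vec x))).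
  have := integrable_affine 0 e0 (integrable_gaussv k).
  by apply: eq_integrable => // x _ /=; rewrite add0r.
have iF : (lebt k \x lebt k)%E.-integrable setT (EFin \o F).
  have := @integrable_prodM R _ _ _ _ (lebt k) (lebt k) _ _ ig
    (integrableZl measurableT C (integrable_wtV k)).
  move/integrable_dominated; apply.
    apply: measurable_funM; last exact: measurable_phase_pair.
    exact: (measurableT_comp (measurable_gaussv_scaled e)).
  move=> o; rewrite /F normrM ger0_norm ?gaussv_ge0 //.
  by rewrite ler_wpM2l ?gaussv_ge0.
transitivity (\int[lebt k]_xi \int[lebt k]_z F (xi, z)).
  apply: eq_Rintegral => xi _; rewrite /F /pint /= RintegralZl //.
  exact: integrable_phase_z.
rewrite -Rintegral_fubini1 // Rintegral_fubini2 //.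
pose s := rsubmx X.
transitivity (\int[lebt k]_z (f1 (row_mx y (vec z)) *
    (e ^- k * (Num.sqrt pi ^+ k * gaussv ((2 * e)^-1 *: (vec z - s)))))).
  apply: eq_Rintegral => z _.
  have ic phi := integrable_scaled_cos_gaussv (vec z - s) phi e0.
  (* The sine is written as a cosine with phase [- pi/2], so one formula evaluates both terms; the
     second gets the factor [cos (- pi/2) = 0], and [f2] drops out. *)
  transitivity (\int[lebt k]_xi
    (f1 (row_mx y (vec z)) * (cos (dotv (vec xi) (vec z - s) + 0) * gaussv (e *: vec xi)) +
     f2 (row_mx y (vec z)) * (cos (dotv (vec xi) (vec z - s) + - (pi / 2)) * gaussv (e *: vec xi)))).
    apply: eq_Rintegral => xi _; rewrite /F /phase /theta -/s addr0.
    rewrite cosB cos_pihalf sin_pihalf; ring.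
  rewrite RintegralD //; last 2 first.
  - exact: (integrableZl measurableT (f1 (row_mx y (vec z))) (ic 0)).
  - exact: (integrableZl measurableT (f2 (row_mx y (vec z))) (ic (- (pi / 2)))).
  rewrite !RintegralZl // !gaussian_fourier_scaled // cosN cos_pihalf cos0.
  by rewrite mul1r !mul0r !mulr0 addr0.
have e20 : 0 < 2 * e by rewrite mulr_gt0.
pose H (z : 'rV[R]_k) := f1 (row_mx y z) *
    (e ^- k * (Num.sqrt pi ^+ k * gaussv ((2 * e)^-1 *: (z - s)))).
have HE (u : 'rV[R]_k) : H (s + (2 * e) *: u) =
    e ^- k * Num.sqrt pi ^+ k * (f1 (row_mx y (s + (2 * e) *: u)) * gaussv u).
  rewrite /H [s + _]addrC addrK scalerA mulVf ?gt_eqF // scale1r; ring.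
have [B B0 HB] := row_mx_bound sf1.
have mH : measurable_fun setT (fun z : k.-tuple mR => H (vec z)).
  apply: measurable_funM; first exact: measurable_row_mx.
  do 2 apply: measurable_funM => //.
  apply: measurableT_comp; first exact: measurable_expR.
  apply: measurableT_comp => //; apply: measurable_dotv => i;
  rewrite (_ : (fun _ => _) = fun x : k.-tuple mR => (2 * e)^-1 * (vec x 0 i - s 0 i));
  do ?[by apply: measurable_funM => //; apply: measurable_funB => //; exact: measurable_vec];
  by apply/funext => x; rewrite !mxE.
have iH : (lebt k).-integrable setT (EFin \o (fun z => H (vec z))).
  have ie : 0 < (2 * e)^-1 by rewrite invr_gt0.
  have := integrable_affine (- ((2 * e)^-1 *: s)) ie (integrable_gaussv k).
  move=> /(integrableZl measurableT (B * (e ^- k * Num.sqrt pi ^+ k))).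
  move/integrable_dominated; apply => // z.
  rewrite /H normrM -mulrA; apply: ler_pM => //.
  have q0 : 0 <= e ^- k * Num.sqrt pi ^+ k.
    by apply: mulr_ge0; rewrite ?invr_ge0 exprn_ge0 ?sqrtr_ge0 // ltW.
  rewrite mulrA ger0_norm; last by apply: mulr_ge0 => //; exact: gaussv_ge0.
  by rewrite scalerBr addrC.
rewrite -/(H _) [LHS](Rintegral_affine s e20 iH).
under eq_Rintegral do rewrite HE.
rewrite RintegralZl //; last first.
  apply: (integrable_dominated _ (integrableZl measurableT B (integrable_gaussv k))).
    apply: measurable_funM; last exact: measurable_gaussv.
    have := measurableT_comp (measurable_row_mx y sf1)
       (@measurable_affine_tuple R k (fun i => s 0 i) (2 * e)).
    by congr measurable_fun; apply/funext => u /=; rewrite vec_affine_tuple.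
  move=> u; rewrite normrM [X in _ * X]ger0_norm ?gaussv_ge0 //.
  by rewrite ler_wpM2r ?gaussv_ge0.
rewrite mulrA; congr (_ * _).
by rewrite !exprMn; field; rewrite expf_neq0.
Qed.

(** Both sides of [regularized_inversion] are taken to the limit along [e = 1 / (m + 1)]:
    [pint_decay] dominates the left one, the Gaussian the right one. The constant is
    [(2 sqrt pi)^k * sqrt pi ^ k = (2 pi)^k]. *)
Lemma fourier_inversion X y :
  \int[lebt k]_xi pint f1 f2 0 X y (vec xi) =
  (2 * pi) ^+ k * f1 (row_mx y (rsubmx X)).
Proof.
have e_gt0 m : 0 < (@harmonic R) m by rewrite /harmonic /= invr_gt0.
have ecvg := @cvg_harmonic R.
have [M M0 HM] := pint_decay sf1 sf2.
have L1 : \int[lebt k]_xi (gaussv (harmonic m *: vec xi) * pint f1 f2 0 X y (vec xi))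
    @[m --> \oo] --> \int[lebt k]_xi pint f1 f2 0 X y (vec xi).
  apply: (@Rintegral_dominated_cvg _ _ _ (lebt k) _ _ (fun x : k.-tuple mR => M * (wt (vec x))^-1)).
  - move=> m; apply: measurable_funM; first exact: measurable_gaussv_scaled.
    exact: measurable_pint.
  - move=> xi; rewrite -[X in _ --> X]mul1r; apply: cvgM; last exact: cvg_cst.
    rewrite (_ : (fun m => gaussv _) = fun m => expR (- (harmonic m * (harmonic m * dotv (vec xi) (vec xi))))); last first.
      by apply/funext => m; rewrite /gaussv dotvZl dotvZr.
    have a0 : - (harmonic m * (harmonic m * dotv (vec xi) (vec xi))) @[m --> \oo] --> (0 : R).
      rewrite -oppr0; apply: cvgN; rewrite -(mul0r (0 * dotv (vec xi) (vec xi))).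
      apply: cvgM => //; apply: cvgM => //; exact: cvg_cst.
    rewrite -expR0; move: a0; apply: continuous_cvg; exact: continuous_expR.
  - exact: (integrableZl measurableT M (integrable_wtV k)).
  - move=> m xi; rewrite normrM ger0_norm ?gaussv_ge0 //.
    apply: le_trans (HM 0 X y (vec xi)).
    by rewrite ler_piMl // gaussv_le1.
have [B B0 HB] := row_mx_bound sf1.
have L2 : \int[lebt k]_u (f1 (row_mx y (rsubmx X + (2 * harmonic m) *: vec u)) * gaussv (vec u))
    @[m --> \oo] --> \int[lebt k]_u (f1 (row_mx y (rsubmx X)) * gaussv (vec u)).
  apply: (@Rintegral_dominated_cvg _ _ _ (lebt k) _ _ (fun x : k.-tuple mR => B * gaussv (vec x))).
  - move=> m; apply: measurable_funM; last exact: measurable_gaussv.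
    have := measurableT_comp (measurable_row_mx y sf1)
       (@measurable_affine_tuple R k (fun i => rsubmx X 0 i) (2 * harmonic m)).
    by congr measurable_fun; apply/funext => u /=; rewrite vec_affine_tuple.
  - move=> u; apply: cvgM; last exact: cvg_cst.
    have rc : (row_mx y (rsubmx X + (2 * harmonic m) *: vec u) : 'rV[R]_(n + k)) @[m --> \oo]
        --> (row_mx y (rsubmx X) : 'rV[R]_(n + k)).
      rewrite (_ : (fun m => _) = (fun m => row_mx y (rsubmx X) +
          (2 * harmonic m) *: (row_mx 0 (vec u) : 'rV[R]_(n + k)))); last first.
        by apply/funext => m; rewrite scale_row_mx add_row_mx scaler0 addr0.
      rewrite -[X in _ --> X]addr0 -(scale0r (row_mx 0 (vec u) : 'rV[R]_(n + k))) -(mulr0 2).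
      apply: cvgD; first exact: cvg_cst.
      apply: cvgZ; last exact: cvg_cst.
      by apply: cvgM => //; exact: cvg_cst.
    by have [c _ _] := sf1 [::]; exact: (cvg_comp _ _ rc (c _)).
  - exact: (integrableZl measurableT B (integrable_gaussv k)).
  - move=> m u; rewrite normrM [X in _ * X]ger0_norm ?gaussv_ge0 //.
    by rewrite ler_wpM2r ?gaussv_ge0.
have L3 : \int[lebt k]_xi (gaussv (harmonic m *: vec xi) * pint f1 f2 0 X y (vec xi))
    @[m --> \oo] --> (2 * pi) ^+ k * f1 (row_mx y (rsubmx X)).
  rewrite (_ : (fun m => \int[lebt k]_xi _) = fun m => (2 * Num.sqrt pi) ^+ k * \int[lebt k]_u
     (f1 (row_mx y (rsubmx X + (2 * harmonic m) *: vec u)) * gaussv (vec u))); last first.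
    by apply/funext => m; exact: regularized_inversion.
  have -> : (2 * pi) ^+ k * f1 (row_mx y (rsubmx X)) =
      (2 * Num.sqrt pi) ^+ k * \int[lebt k]_u (f1 (row_mx y (rsubmx X)) * gaussv (vec u)).
    rewrite RintegralZl //; last exact: integrable_gaussv.
    rewrite Rintegral_gaussv mulrCA -exprMn -mulrA -expr2 sqr_sqrtr ?pi_ge0 //.
    by rewrite mulrC.
  by apply: cvgM => //; exact: cvg_cst.
exact: (cvg_unique _ L1 L3).
Qed.

End inversion.

(** * The initial condition *)

Section small_time.
Context {R : realType}.

Lemma expR_half_ln (a : R) : 0 < a -> expR (ln a / 2) = Num.sqrt a.
Proof.
move=> a0; have E : expR (ln a / 2) ^+ 2 = a.
  by rewrite -expRM_natl mulrC divfK // lnK.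
by rewrite -{2}E sqrtr_sqr ger0_norm ?expR_ge0.
Qed.

Lemma mehlerA_inv_cvg (r : R) (u : nat -> R) : 0 <= r -> (forall m, 0 < u m) ->
  u m @[m --> \oo] --> 0 -> (mehlerA r (u m))^-1 @[m --> \oo] --> 0.
Proof.
rewrite le_eqVlt => /predU1P[<-|r0] u0 cu.
  by under eq_fun do rewrite mehlerA0 invrK.
under eq_fun do rewrite mehlerAE // invf_div.
rewrite -(mul0r r^-1) -(@sinh0 R); apply: cvgM; last exact: cvg_cst.
have cs : {for 0, continuous (@sinh R)}.
  apply/differentiable_continuous/derivable1_diffP.
  by have := @is_derive_sinh R 0 => ?; exact: ex_derive.
have ru : r * u m @[m --> \oo] --> 0.
  by rewrite -[X in _ --> X](mulr0 r); apply: cvgM => //; exact: cvg_cst.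
by move: ru; apply: continuous_cvg.
Qed.

(** [(T - A) (T + A) = r^2], and [T + A >= A]. *)
Lemma mehlerT_subA_le (r t : R) : 0 <= r -> 0 < t ->
  0 <= mehlerT r t - mehlerA r t <= r ^+ 2 * (mehlerA r t)^-1.
Proof.
move=> r0 t0; have A0 := mehlerA_gt0 r0 t0; have AT := mehlerA_leT r0 t0.
have := mehlerT_sqr r0 t0; rewrite subr_ge0 AT /= ler_pdivlMr //.
move: A0 AT; set A := mehlerA _ _; set T := mehlerT _ _ => A0 AT E.
have -> : r ^+ 2 = (T - A) * (T + A) by rewrite -subr_sqr E; ring.
by rewrite ler_wpM2l ?subr_ge0 // lerDr (le_trans (ltW A0)).
Qed.

Lemma mehlerT_subA_cvg (r : R) (u : nat -> R) : 0 <= r -> (forall m, 0 < u m) ->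
  u m @[m --> \oo] --> 0 -> mehlerT r (u m) - mehlerA r (u m) @[m --> \oo] --> 0.
Proof.
move=> r0 u0 cu.
have c2 : r ^+ 2 * (mehlerA r (u m))^-1 @[m --> \oo] --> 0.
  rewrite -[X in _ --> X](mulr0 (r ^+ 2)); apply: cvgM; first exact: cvg_cst.
  exact: mehlerA_inv_cvg.
apply: (@squeeze_cvgr _ _ _ _ (cst 0) _ _ _ _ _ c2); last exact: cvg_cst.
by apply: nearW => m; exact: mehlerT_subA_le.
Qed.

Context {n k : nat}.
Local Notation mR := (measurableTypeR R).
Local Notation lebt := (@lebesgue_tuple R).

Variables (f1 f2 : 'rV[R]_(n + k) -> R).
Hypotheses (sf1 : rschwartz f1) (sf2 : rschwartz f2) (hn : (0 < n)%N).
Variable X : 'rV[R]_(n + k).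
Let w := lsubmx X.

Lemma integrable_Eker_slice (xi : 'rV[R]_k) (t : R) : 0 < t ->
  (lebt n \x lebt k)%E.-integrable setT
    (EFin \o (fun o => Eker f1 f2 0 (X, t) (vec o.1) (vec o.2) xi)).
Proof.
move=> t0; have [B B0 /nbhs_singleton pB] := @near_box R n k (X, t) t0.
have [C C0 HC] := Eker_bound sf1 sf2 hn 1 B0.
have iw := integrable_prodM (integrableZl measurableT C (integrable_wtV n)) (integrable_wtV k).
move: iw; move/integrable_dominated; apply.
  have [u <-] := vec_surj xi.
  exact: (measurableT_comp (measurable_Eker sf1 sf2 0 (X, t)) (measurable_pair2 u)).
move=> o; apply: le_trans (HC 0 (X, t) _ _ _ pB) _.
rewrite expr1 -[leRHS]mulrA -invfM /wt3 ler_wpM2l // lef_pV2 ?posrE ?mulr_gt0 ?wt_gt0 //.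
by rewrite ler_peMr ?wt_ge1 // mulr_ge0 // ltW ?wt_gt0.
Qed.

(** Contribution of a single frequency: the Mehler kernel at [xi] applied to the partial Fourier
    transform of the data. *)
Definition mslice (xi : 'rV[R]_k) (t : R) : R :=
  \int[lebt n]_y (expR (mexp (X, t) (vec y) xi) * pint f1 f2 0 X (vec y) xi).

Lemma mslice_Eker (xi : 'rV[R]_k) (t : R) :
  (fun y : n.-tuple mR => \int[lebt k]_z Eker f1 f2 0 (X, t) (vec y) (vec z) xi) =
  (fun y => expR (mexp (X, t) (vec y) xi) * pint f1 f2 0 X (vec y) xi).
Proof.
apply/funext => y; rewrite mulrC /Eker RintegralZr //.
exact: integrable_phase_z.
Qed.

Lemma integrable_mslice (xi : 'rV[R]_k) (t : R) : 0 < t ->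
  (lebt n).-integrable setT
    (EFin \o (fun y => expR (mexp (X, t) (vec y) xi) * pint f1 f2 0 X (vec y) xi)).
Proof.
by move=> t0; rewrite -mslice_Eker; exact: (integrable_Rfubini1 (integrable_Eker_slice xi t0)).
Qed.

Lemma mslice_fubini (xi : 'rV[R]_k) (t : R) : 0 < t -> mslice xi t =
  \int[(lebt n \x lebt k)%E]_o Eker f1 f2 0 (X, t) (vec o.1) (vec o.2) xi.
Proof.
move=> t0; rewrite (Rintegral_fubini1 (integrable_Eker_slice xi t0)).
by rewrite /mslice -mslice_Eker.
Qed.

(** At a fixed [t > 0] convergence is absolute, so [xi] may be moved outermost, an order in which a
    domination is still available as [t -> 0]. *)
Lemma kint_mslice (c t : R) : 0 < t ->
  kint f1 f2 (fun _ _ _ => c) 0 (X, t) = c * \int[lebt k]_xi mslice (vec xi) t /\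
  (lebt k).-integrable setT (EFin \o (fun xi => mslice (vec xi) t)).
Proof.
move=> t0.
have i1 := integrable_integ sf1 sf2 hn 0 (symbol_cst 1) (p := (X, t)) t0.
have E1 : (fun xi : k.-tuple mR => \int[sigma_product (lebt n) (lebt k)]_o
   integ f1 f2 (fun _ _ _ => 1) 0 (X, t) (o, xi)) = (fun xi => mslice (vec xi) t).
  apply/funext => xi; rewrite mslice_fubini //.
  by apply: eq_Rintegral => o _; rewrite /integ mul1r.
have i2 := integrable_Rfubini2 i1; rewrite E1 in i2; split => //.
have := Rintegral_fubini2 i1; rewrite E1 => <-.
rewrite -RintegralZl //.
by apply: eq_Rintegral => o _; rewrite /integ mul1r.
Qed.

Definition mwidth (xi : 'rV[R]_k) t : R := 2 * Num.sqrt (mehlerA (enorm xi) t)^-1.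

Definition mdamp (xi : 'rV[R]_k) t (y : 'rV[R]_n) : R :=
  expR (- ((mehlerT (enorm xi) t - mehlerA (enorm xi) t) * (dotv w w + dotv y y) / 4)).

(* With [y = w + a u] and [a = 2 / sqrt A], the Mehler kernel becomes the
   standard Gaussian times a damping factor that tends to 1 as [t -> 0]. *)
Lemma expR_mexp_subst (xi : 'rV[R]_k) t (u : 'rV[R]_n) : 0 < t ->
  mwidth xi t ^+ n * expR (mexp (X, t) (w + mwidth xi t *: u) xi) =
  2 ^+ n * (gaussv u * mdamp xi t (w + mwidth xi t *: u)).
Proof.
move=> t0; rewrite /mexp /mquad /kA /kT /= -/w /mdamp.
have A0 := mehlerA_gt0 (enorm_ge0 xi) t0.
set y := w + _; set A := mehlerA _ _ in A0 *; set T := mehlerT _ _.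
have sA : Num.sqrt A^-1 * Num.sqrt A = 1.
  by rewrite -sqrtrM ?invr_ge0 ?ltW // mulVf ?sqrtr1 // gt_eqF.
have a2 : A * mwidth xi t ^+ 2 = 4.
  rewrite /mwidth exprMn sqr_sqrtr ?invr_ge0 ?(ltW A0) // mulrCA divff ?gt_eqF //.
  by rewrite mulr1 -natrX.
have q : A * (dotv w w + dotv y y - 2 * dotv w y) = 4 * dotv u u.
  rewrite /y !(dotvDl, dotvDr) !(dotvZl, dotvZr) [dotv u w]dotvC -a2; ring.
have -> : n%:R / 2 * ln A - (T * (dotv w w + dotv y y) - 2 * A * dotv w y) / 4 =
    n%:R * (ln A / 2) + (- dotv u u + - ((T - A) * (dotv w w + dotv y y) / 4)).
  have -> : dotv u u = A * (dotv w w + dotv y y - 2 * dotv w y) / 4 by rewrite q; field.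
  by field.
have aA : mwidth xi t * Num.sqrt A = 2 by rewrite /mwidth -/A -mulrA sA mulr1.
by rewrite !expRD expRM_natl expR_half_ln // mulrA -exprMn aA.
Qed.

Lemma mslice_subst (xi : 'rV[R]_k) t : 0 < t ->
  mslice xi t = 2 ^+ n * \int[lebt n]_u (gaussv (vec u) *
    (mdamp xi t (w + mwidth xi t *: vec u) * pint f1 f2 0 X (w + mwidth xi t *: vec u) xi)) /\
  (lebt n).-integrable setT (EFin \o (fun u => gaussv (vec u) *
    (mdamp xi t (w + mwidth xi t *: vec u) * pint f1 f2 0 X (w + mwidth xi t *: vec u) xi))).
Proof.
move=> t0; have A0 := mehlerA_gt0 (enorm_ge0 xi) t0.
have a0 : 0 < mwidth xi t by rewrite mulr_gt0 // sqrtr_gt0 invr_gt0.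
have i1 := integrable_mslice xi t0.
pose F y := expR (mexp (X, t) y xi) * pint f1 f2 0 X y xi.
have iF : (lebt n).-integrable setT (EFin \o (fun y => F (vec y))) by [].
have i2 := integrable_affine w a0 iF.
have E (u : 'rV[R]_n) : gaussv u * (mdamp xi t (w + mwidth xi t *: u) *
    pint f1 f2 0 X (w + mwidth xi t *: u) xi) =
    (mwidth xi t / 2) ^+ n * F (w + mwidth xi t *: u).
  have h := expR_mexp_subst xi u t0.
  have z2 : (2 : R) ^+ n != 0 by rewrite expf_neq0.
  apply: (mulfI z2); rewrite /F expr_div_n.
  transitivity (2 ^+ n * (gaussv u * mdamp xi t (w + mwidth xi t *: u)) *
    pint f1 f2 0 X (w + mwidth xi t *: u) xi); first by ring.
  by rewrite -h; field.
split.
  rewrite [LHS](Rintegral_affine w a0 iF).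
  under [in RHS]eq_Rintegral do rewrite E.
  rewrite RintegralZl // mulrA; congr (_ * _).
  by rewrite -exprMn mulrC divfK.
have := integrableZl measurableT ((mwidth xi t / 2) ^+ n) i2.
by apply: eq_integrable => // u _ /=; rewrite E.
Qed.

Lemma mdamp_le1 (xi : 'rV[R]_k) t y : 0 < t -> 0 <= mdamp xi t y <= 1.
Proof.
move=> t0; rewrite expR_ge0 /= -expR0 ler_expR oppr_le0.
have /andP[h _] := mehlerT_subA_le (enorm_ge0 xi) t0.
by rewrite divr_ge0 // mulr_ge0 // addr_ge0 // dotv_ge0.
Qed.

(** After the substitution, time enters only through a damping factor at most 1 and through the
    argument of [pint], whose bound is uniform in [y]; the remaining Gaussian in [u] has a fixed
    integral. *)
Lemma mslice_bound : exists2 M, 0 <= M & forall (xi : 'rV[R]_k) t, 0 < t ->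
  `|mslice xi t| <= M * (wt xi)^-1.
Proof.
have [M M0 HM] := pint_decay sf1 sf2.
exists (2 ^+ n * (M * Num.sqrt pi ^+ n)) => [|xi t t0].
  by rewrite !mulr_ge0 ?exprn_ge0 ?sqrtr_ge0.
have [-> iG] := mslice_subst xi t0.
rewrite normrM ger0_norm ?exprn_ge0 // -mulrA ler_wpM2l ?exprn_ge0 //.
apply: le_trans (le_normr_Rintegral measurableT iG) _.
rewrite mulrAC -Rintegral_gaussv -RintegralZl //; last exact: integrable_gaussv.
apply: le_Rintegral => //.
- exact: (integrable_norm iG).
- exact: (integrableZl measurableT (M / wt xi) (integrable_gaussv n)).
move=> u _; rewrite normrM ger0_norm ?gaussv_ge0 // mulrC ler_wpM2r ?gaussv_ge0 //.
have /andP[d0 d1] := mdamp_le1 xi (w + mwidth xi t *: vec u) t0.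
by rewrite normrM ger0_norm // -[leRHS]mul1r; apply: ler_pM.
Qed.

(** The width and [T - A] both tend to 0, so the integrand tends to the Gaussian times [pint] at
    [w]; its integral supplies [sqrt pi ^+ n]. *)
Lemma mslice_cvg (xi : 'rV[R]_k) (t : nat -> R) : (forall m, 0 < t m) ->
  t m @[m --> \oo] --> 0 ->
  mslice xi (t m) @[m --> \oo] --> (2 * Num.sqrt pi) ^+ n * pint f1 f2 0 X w xi.
Proof.
move=> t0 ct; have e0 := enorm_ge0 xi.
have ca : mwidth xi (t m) @[m --> \oo] --> 0.
  rewrite /mwidth -[X in _ --> X](mulr0 2); apply: cvgM; first exact: cvg_cst.
  rewrite -[X in _ --> X]sqrtr0.
  have := mehlerA_inv_cvg e0 t0 ct; apply: continuous_cvg; exact: sqrt_continuous.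
have cd := mehlerT_subA_cvg e0 t0 ct.
have [M M0 HM] := pint_decay sf1 sf2.
have cy (u : 'rV[R]_n) : w + mwidth xi (t m) *: u @[m --> \oo] --> w.
  rewrite -[X in _ --> X]addr0 -(scale0r u); apply: cvgD; first exact: cvg_cst.
  by apply: cvgZ => //; exact: cvg_cst.
have L : \int[lebt n]_u (gaussv (vec u) *
    (mdamp xi (t m) (w + mwidth xi (t m) *: vec u) *
     pint f1 f2 0 X (w + mwidth xi (t m) *: vec u) xi)) @[m --> \oo] -->
    \int[lebt n]_u (gaussv (vec u) * (1 * pint f1 f2 0 X w xi)).
  apply: (@Rintegral_dominated_cvg _ _ _ (lebt n) _ _
    (fun u : n.-tuple mR => M / wt xi * gaussv (vec u))).
  - move=> m; have [_ /integrableP[/measurable_EFinP]] := mslice_subst xi (t0 m).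
    by [].
  - move=> u; apply: cvgM; first exact: cvg_cst.
    apply: cvgM; last first.
      have cp := @continuous_pint_y R n k f1 f2 0 X sf1 sf2 w xi.
      exact: (cvg_comp _ _ (cy (vec u)) cp).
    have cz : - ((mehlerT (enorm xi) (t m) - mehlerA (enorm xi) (t m)) *
        (dotv w w + dotv (w + mwidth xi (t m) *: vec u) (w + mwidth xi (t m) *: vec u)) / 4)
        @[m --> \oo] --> (0 : R).
      have cq : dotv (w + mwidth xi (t m) *: vec u) (w + mwidth xi (t m) *: vec u) @[m --> \oo] -->
          dotv w w + 0 * (2 * dotv w (vec u)) + 0 * 0 * dotv (vec u) (vec u).
        rewrite (_ : (fun m => _) = (fun m => dotv w w + mwidth xi (t m) * (2 * dotv w (vec u)) +
            mwidth xi (t m) * mwidth xi (t m) * dotv (vec u) (vec u))); last first.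
          apply/funext => m; rewrite !(dotvDl, dotvDr) !(dotvZl, dotvZr) [dotv (vec u) w]dotvC; ring.
        apply: cvgD; first apply: cvgD; first exact: cvg_cst.
          by apply: cvgM => //; exact: cvg_cst.
        by apply: cvgM; [exact: cvgM|exact: cvg_cst].
      have := cvgN (cvgM (cvgM cd (cvgD (cvg_cst (dotv w w)) cq)) (cvg_cst (4^-1 : R))).
      rewrite mul0r mul0r oppr0; exact.
    rewrite -expR0 /mdamp; move: cz; apply: continuous_cvg; exact: continuous_expR.
  - exact: (integrableZl measurableT (M / wt xi) (integrable_gaussv n)).
  - move=> m u; rewrite normrM ger0_norm ?gaussv_ge0 // mulrC ler_wpM2r ?gaussv_ge0 //.
    have /andP[d0 d1] := mdamp_le1 xi (w + mwidth xi (t m) *: vec u) (t0 m).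
    by rewrite normrM ger0_norm // -[leRHS]mul1r; apply: ler_pM.
rewrite (_ : (fun m => mslice xi (t m)) = fun m => 2 ^+ n * \int[lebt n]_u (gaussv (vec u) *
    (mdamp xi (t m) (w + mwidth xi (t m) *: vec u) *
     pint f1 f2 0 X (w + mwidth xi (t m) *: vec u) xi))); last first.
  by apply/funext => m; have [->] := mslice_subst xi (t0 m).
have -> : (2 * Num.sqrt pi) ^+ n * pint f1 f2 0 X w xi =
    2 ^+ n * \int[lebt n]_u (gaussv (vec u) * (1 * pint f1 f2 0 X w xi)).
  by rewrite RintegralZr ?Rintegral_gaussv ?mul1r ?mulrA -?exprMn //; exact: integrable_gaussv.
by apply: cvgM => //; exact: cvg_cst.
Qed.

Lemma kint_initial (c : R) : c * ((2 * Num.sqrt pi) ^+ n * (2 * pi) ^+ k) = 1 ->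
  kint f1 f2 (fun _ _ _ => c) 0 (X, t) @[t --> 0^'+] --> f1 X.
Proof.
(* The one-sided limit is tested on sequences of positive times, to suit dominated convergence. *)
move=> c1; apply/cvg_at_rightP => t [t0 ct].
have [M M0 HM] := mslice_bound.
rewrite (_ : (fun m => kint _ _ _ _ _) = fun m => c * \int[lebt k]_xi mslice (vec xi) (t m)); last first.
  by apply/funext => m; have [->] := kint_mslice c (t0 m).
have -> : f1 X = c * \int[lebt k]_xi ((2 * Num.sqrt pi) ^+ n * pint f1 f2 0 X w (vec xi)).
  rewrite RintegralZl //; last first.
    have [M' M'0 HM'] := pint_decay sf1 sf2.
    apply: (@integrable_le_wtV _ _ _ M'); first exact: measurable_pint.
    by move=> xi; exact: HM'.
  by rewrite fourier_inversion // hsubmxK !mulrA -[c * _ * _]mulrA c1 mul1r.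
apply: cvgM; first exact: cvg_cst.
apply: (@Rintegral_dominated_cvg _ _ _ (lebt k) (fun m xi => mslice (vec xi) (t m)) _
    (fun x : k.-tuple mR => M * (wt (vec x))^-1)).
- by move=> m; have [_ /integrableP[/measurable_EFinP]] := kint_mslice c (t0 m).
- by move=> xi; exact: mslice_cvg.
- exact: (integrableZl measurableT M (integrable_wtV k)).
- by move=> m xi; exact: HM.
Qed.

End small_time.

(** * The complex kernel *)

Local Open Scope complex_scope.

Section kernel_formula.
Context {R : realType} {n k : nat}.
Local Notation mR := (measurableTypeR R).
Local Notation lebt := (@lebesgue_tuple R).

(** [(2 sqrt pi)^n] comes from the Gaussian in [u], [(2 pi)^k] from Fourier inversion;
    [kernelB_const] matches this with the normalization of the kernel. *)
Definition kconst : R := ((2 * Num.sqrt pi) ^+ n * (2 * pi) ^+ k)^-1.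

Lemma kconstV : kconst * ((2 * Num.sqrt pi) ^+ n * (2 * pi) ^+ k) = 1.
Proof.
have p0 := @pi_gt0 R.
by rewrite mulVf // mulf_neq0 // expf_neq0 // mulf_neq0 // gt_eqF // sqrtr_gt0.
Qed.

Lemma enormZ d (t : R) (x : 'rV[R]_d) : 0 < t -> enorm (t *: x) = t * enorm x.
Proof.
move=> t0; rewrite /enorm dotvZl dotvZr mulrA -expr2 sqrtrM ?sqr_ge0 //.
by rewrite sqrtr_sqr gtr0_norm.
Qed.

(** At [lambda = t xi] the factor [1 / t] in the phase cancels, and [div_sinh (t |xi|) = t A], which
    leaves the power [t^(n/2)] in front. *)
Lemma kernel_integrand_scaled (w : 'rV[R]_n) (s : 'rV[R]_k) y z (t : R) xi : 0 < t ->
  kernel_integrand w s y z t (t *: xi) =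
  (t `^ (n%:R / 2) * (cos (theta (row_mx w s) z xi) * expR (mexp (row_mx w s, t) y xi)))
  +i* (- (t `^ (n%:R / 2) * (sin (theta (row_mx w s) z xi) * expR (mexp (row_mx w s, t) y xi)))).
Proof.
move=> t0; have e0 := enorm_ge0 xi; have A0 := mehlerA_gt0 e0 t0.
rewrite /kernel_integrand enormZ // !enorm_sqr dotvZl [t * enorm xi]mulrC [t * dotv _ _]mulrC mulfK ?gt_eqF //.
have -> : div_sinh (enorm xi * t) = t * mehlerA (enorm xi) t.
  by rewrite /mehlerA mulrCA divff ?mulr1 // gt_eqF.
have -> : div_tanh (enorm xi * t) / (4 * t) = mehlerT (enorm xi) t / 4.
  by rewrite /mehlerT; field; rewrite gt_eqF.
have -> : - (mehlerT (enorm xi) t / 4 *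
    (dotv w w + dotv y y - 2 * dotv w y * sech (enorm xi * t))) =
    - mquad (row_mx w s, t) y xi / 4.
  rewrite /mquad /kA /kT /= row_mxKl -(mehlerT_sech e0 t0); by field.
rewrite powRM ?(ltW t0) ?(ltW A0) // /expi /theta row_mxKr.
have -> : mehlerA (enorm xi) t `^ (n%:R / 2) = expR (n%:R / 2 * ln (mehlerA (enorm xi) t)).
  by rewrite /powR gt_eqF.
rewrite -mulrA -expRD.
have -> : n%:R / 2 * ln (mehlerA (enorm xi) t) + - mquad (row_mx w s, t) y xi / 4 =
    mexp (row_mx w s, t) y xi by rewrite /mexp mulNr.
rewrite cosN sinN.
apply/eqP; rewrite eq_complex /=; apply/andP; split; apply/eqP; ring.
Qed.

Lemma mode_integrable (hn : (0 < n)%N) (X : 'rV[R]_(n + k)) (t : R) y z (h : R -> R) :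
  0 < t -> continuous h -> (forall x, `|h x| <= 1) ->
  (lebt k).-integrable setT
    (EFin \o (fun xi => h (theta X z (vec xi)) * expR (mexp (X, t) y (vec xi)))).
Proof.
move=> t0 ch h1; have [B B0 /nbhs_singleton pB] := @near_box R n k (X, t) t0.
have [C C0 HC] := @expR_mexp_bound R n k hn B 1 B0.
have [u yE] := vec_surj y; have [v zE] := vec_surj z.
apply: (@integrable_le_wtV _ _ _ C).
  apply: measurable_funM.
    apply: (measurableT_comp (continuous_measurable_fun ch)).
    rewrite -zE; exact: (measurableT_comp (measurable_theta (n := n) (k := k) X) (measurable_pair1 (u, v))).
  apply: (measurableT_comp (@measurable_expR R)).
  rewrite -yE; exact: (measurableT_comp (measurable_mexp (X, t)) (measurable_pair1 (u, v))).
move=> xi; rewrite normrM [X in _ * X]ger0_norm ?expR_ge0 //.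
apply: (@le_trans _ _ (1 * expR (mexp (X, t) y (vec xi)))).
  by rewrite ler_wpM2r // expR_ge0.
by rewrite mul1r -[wt _]expr1 HC.
Qed.

Lemma unscale_integrable (t : R) (F G : 'rV[R]_k -> R) : 0 < t ->
  (forall xi, F (t *: xi) = G xi) ->
  (lebt k).-integrable setT (EFin \o (fun xi => G (vec xi))) ->
  (lebt k).-integrable setT (EFin \o (fun l => F (vec l))) /\
  \int[lebt k]_l F (vec l) = t ^+ k * \int[lebt k]_xi G (vec xi).
Proof.
move=> t0 FG iG; have it0 : 0 < t^-1 by rewrite invr_gt0.
have iF : (lebt k).-integrable setT (EFin \o (fun l => F (vec l))).
  have := integrable_affine 0 it0 iG; apply: eq_integrable => // l _ /=.
  by rewrite add0r -FG scalerA divff ?scale1r // gt_eqF.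
split=> //; rewrite (Rintegral_affine 0 t0 iF); congr (_ * _).
by apply: eq_Rintegral => xi _; rewrite add0r FG.
Qed.

Definition cosint (X : 'rV[R]_(n + k)) (t : R) y z : R :=
  \int[lebt k]_xi (cos (theta X z (vec xi)) * expR (mexp (X, t) y (vec xi))).
Definition sinint (X : 'rV[R]_(n + k)) (t : R) y z : R :=
  \int[lebt k]_xi (sin (theta X z (vec xi)) * expR (mexp (X, t) y (vec xi))).

Section positive_time.
Hypothesis hn : (0 < n)%N.
Variable t : R.
Hypothesis t0 : 0 < t.

Lemma kernel_integrand_Re w s y z :
  (lebt k).-integrable setT
    (EFin \o (fun l => complex.Re (kernel_integrand w s y z t (vec l)))) /\
  \int[lebt k]_l complex.Re (kernel_integrand w s y z t (vec l)) =
    t ^+ k * (t `^ (n%:R / 2) * cosint (row_mx w s) t y z).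
Proof.
have im := mode_integrable hn (row_mx w s) y z t0 (@continuous_cos R) (@normr_cos_le R).
have [h1 h2] := @unscale_integrable t
  (fun l => complex.Re (kernel_integrand w s y z t l))
  (fun xi => t `^ (n%:R / 2) * (cos (theta (row_mx w s) z xi) * expR (mexp (row_mx w s, t) y xi)))
  t0 (fun xi => congr1 (@complex.Re R) (kernel_integrand_scaled w s y z xi t0))
  (integrableZl measurableT (t `^ (n%:R / 2)) im).
by split=> //; rewrite h2 RintegralZl.
Qed.

Lemma kernel_integrand_Im w s y z :
  (lebt k).-integrable setT
    (EFin \o (fun l => complex.Im (kernel_integrand w s y z t (vec l)))) /\
  \int[lebt k]_l complex.Im (kernel_integrand w s y z t (vec l)) =
    - (t ^+ k * (t `^ (n%:R / 2) * sinint (row_mx w s) t y z)).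
Proof.
have im := mode_integrable hn (row_mx w s) y z t0 (@continuous_sin R) (@normr_sin_le R).
have [h1 h2] := @unscale_integrable t
  (fun l => complex.Im (kernel_integrand w s y z t l))
  (fun xi => - t `^ (n%:R / 2) * (sin (theta (row_mx w s) z xi) * expR (mexp (row_mx w s, t) y xi)))
  t0 (fun xi => etrans (congr1 (@complex.Im R) (kernel_integrand_scaled w s y z xi t0)) (esym (mulNr _ _)))
  (integrableZl measurableT (- t `^ (n%:R / 2)) im).
by split=> //; rewrite h2 RintegralZl // mulNr mulrN.
Qed.

Lemma kernel_integrand_integrable (w : 'rV[R]_n) (s : 'rV[R]_k) y z :
  cintegrable (lebt k) (fun l => kernel_integrand w s y z t (vec l)).
Proof.
by split; [have [] := kernel_integrand_Re w s y z|have [] := kernel_integrand_Im w s y z].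
Qed.

(** The Jacobian [t^k] and the factor [t^(n/2)] cancel the powers of [t] in the normalization, and
    [2^k / 4^k] leaves [2^-k]. *)
Lemma kernelB_const :
  2 ^+ k / (4 * pi * t) `^ (n%:R / 2 + k%:R) * (t ^+ k * t `^ (n%:R / 2)) = kconst.
Proof.
have p0 := @pi_gt0 R; have p40 : 0 < 4 * pi :> R by rewrite mulr_gt0.
rewrite powRD; last by apply/implyP => _; rewrite gt_eqF // mulr_gt0.
rewrite !powRM ?(ltW p40) ?(ltW t0) ?(ltW p0) // !powR_mulrn ?(ltW t0) ?(ltW p0) //.
have P2 (a : R) : 0 < a -> a `^ (n%:R / 2) = Num.sqrt a ^+ n.
  by move=> a0; rewrite [_ / _]mulrC powRrM powR12_sqrt ?(ltW a0) // powR_mulrn // sqrtr_ge0.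
rewrite !P2 //.
have -> : Num.sqrt 4 = 2 :> R.
  by rewrite (_ : 4 = 2 ^+ 2 :> R) ?sqrtr_sqr ?ger0_norm // -natrX.
have s0 : Num.sqrt t != 0 by rewrite gt_eqF // sqrtr_gt0.
have sp0 : Num.sqrt pi != 0 :> R by rewrite gt_eqF // sqrtr_gt0.
rewrite /kconst !exprMn (_ : 4 ^+ k = 2 ^+ k * 2 ^+ k :> R); last first.
  by rewrite -exprMn -natrM.
field.
by rewrite !expf_neq0 // ?gt_eqF.
Qed.

Lemma kernelBE w s y z :
  kernelB w s y z t = (kconst * cosint (row_mx w s) t y z)
    +i* (- (kconst * sinint (row_mx w s) t y z)).
Proof.
have [_ eR] := kernel_integrand_Re w s y z; have [_ eI] := kernel_integrand_Im w s y z.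
rewrite /kernelB /cintegral eR eI -kernelB_const.
apply/eqP; rewrite eq_complex /=; apply/andP; split; apply/eqP; ring.
Qed.

Variable f : 'rV[R]_(n + k) -> R[i].
Hypothesis sf : schwartz f.
Let f1 x := complex.Re (f x).
Let f2 x := complex.Im (f x).

Lemma kernelB_mul_Re X y z :
  complex.Re (kernelB (lsubmx X) (rsubmx X) y z t * f (row_mx y z)) =
  \int[lebt k]_xi (kconst * Eker f1 f2 0 (X, t) y z (vec xi)).
Proof.
have ic := mode_integrable hn X y z t0 (@continuous_cos R) (@normr_cos_le R).
have is_ := mode_integrable hn X y z t0 (@continuous_sin R) (@normr_sin_le R).
rewrite kernelBE hsubmxK.
transitivity (\int[lebt k]_xi
   (kconst * f1 (row_mx y z) * (cos (theta X z (vec xi)) * expR (mexp (X, t) y (vec xi))) +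
    kconst * f2 (row_mx y z) * (sin (theta X z (vec xi)) * expR (mexp (X, t) y (vec xi))))).
  rewrite RintegralD //; last 2 first.
  - exact: (integrableZl measurableT (kconst * f1 (row_mx y z)) ic).
  - exact: (integrableZl measurableT (kconst * f2 (row_mx y z)) is_).
  rewrite !RintegralZl // -/(cosint X t y z) -/(sinint X t y z) /f1 /f2.
  by case: (f _) => a b /=; ring.
by apply: eq_Rintegral => xi _; rewrite /Eker /phase addr0; ring.
Qed.

(** Up to the constant, the kernel is [C - i S], and [(C - i S) (f1 + i f2)] has imaginary part
    [C f2 - S f1], the real-part formula for the data [(f2, - f1)]. *)
Lemma kernelB_mul_Im X y z :
  complex.Im (kernelB (lsubmx X) (rsubmx X) y z t * f (row_mx y z)) =
  \int[lebt k]_xi (kconst * Eker f2 (\- f1) 0 (X, t) y z (vec xi)).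
Proof.
have ic := mode_integrable hn X y z t0 (@continuous_cos R) (@normr_cos_le R).
have is_ := mode_integrable hn X y z t0 (@continuous_sin R) (@normr_sin_le R).
rewrite kernelBE hsubmxK.
transitivity (\int[lebt k]_xi
   (kconst * f2 (row_mx y z) * (cos (theta X z (vec xi)) * expR (mexp (X, t) y (vec xi))) +
    kconst * (- f1 (row_mx y z)) * (sin (theta X z (vec xi)) * expR (mexp (X, t) y (vec xi))))).
  rewrite RintegralD //; last 2 first.
  - exact: (integrableZl measurableT (kconst * f2 (row_mx y z)) ic).
  - exact: (integrableZl measurableT (kconst * (- f1 (row_mx y z))) is_).
  rewrite !RintegralZl // -/(cosint X t y z) -/(sinint X t y z) /f1 /f2.
  by case: (f _) => a b /=; ring.
by apply: eq_Rintegral => xi _; rewrite /Eker /phase addr0 /=; ring.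
Qed.

(** The solution is defined by iterated integrals; absolute convergence on the triple product
    identifies them with one integral and gives the integrability of [kernelB] times the data. *)
Lemma kint_iterated g1 g2 X : rschwartz g1 -> rschwartz g2 ->
  (lebt n \x lebt k)%E.-integrable setT
    (EFin \o (fun o => \int[lebt k]_xi (kconst * Eker g1 g2 0 (X, t) (vec o.1) (vec o.2) (vec xi)))) /\
  \int[lebt n]_y \int[lebt k]_z \int[lebt k]_xi
     (kconst * Eker g1 g2 0 (X, t) (vec y) (vec z) (vec xi)) =
  kint g1 g2 (fun _ _ _ => kconst) 0 (X, t).
Proof.
move=> s1 s2.
have i1 := integrable_integ s1 s2 hn 0 (symbol_cst kconst) (p := (X, t)) t0.
have i2 := integrable_Rfubini1 i1.
split; first exact: i2.
rewrite /kint (Rintegral_fubini1 i1).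
exact: (esym (@Rintegral_fubini1 R _ _ _ _ (lebt n) (lebt k)
  (fun o => \int[lebt k]_xi (kconst * Eker g1 g2 0 (X, t) (vec o.1) (vec o.2) (vec xi))) i2)).
Qed.

Lemma kernelB_mul_integrable w s :
  cintegrable (lebt n \x lebt k)%E
    (fun p => kernelB w s (vec p.1) (vec p.2) t * f (row_mx (vec p.1) (vec p.2))).
Proof.
pose X := row_mx w s.
have [iR _] := kint_iterated X (schwartz_Re sf) (schwartz_Im sf).
have [iI _] := kint_iterated X (schwartz_Im sf) (rschwartzN (schwartz_Re sf)).
split.
  move: iR; apply: eq_integrable => // p _ /=.
  by rewrite -kernelB_mul_Re row_mxKl row_mxKr.
move: iI; apply: eq_integrable => // p _ /=.
by rewrite -kernelB_mul_Im row_mxKl row_mxKr.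
Qed.

Lemma kernel_solutionE X :
  kernel_solution f X t = kint f1 f2 (fun _ _ _ => kconst) 0 (X, t)
    +i* kint f2 (\- f1) (fun _ _ _ => kconst) 0 (X, t).
Proof.
have [_ <-] := kint_iterated X (schwartz_Re sf) (schwartz_Im sf).
have [_ <-] := kint_iterated X (schwartz_Im sf) (rschwartzN (schwartz_Re sf)).
congr (_ +i* _); apply: eq_Rintegral => y _; apply: eq_Rintegral => z _.
  exact: kernelB_mul_Re.
exact: kernelB_mul_Im.
Qed.

End positive_time.
End kernel_formula.

(** * Complex-valued derivatives and the Cauchy problem *)

Lemma sum_complex {R : realType} I (r : seq I) (a b : I -> R) :
  \sum_(i <- r) (a i +i* b i) = (\sum_(i <- r) a i) +i* (\sum_(i <- r) b i).
Proof. by elim: r => [|i r IH]; rewrite ?big_nil // !big_cons IH. Qed.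

Lemma cderive_pair {R : realType} (V : normedModType R) (g1 g2 : V -> R) (x v : V) (l1 l2 : R) :
  is_derive x v g1 l1 -> is_derive x v g2 l2 ->
  cderivable (fun y => g1 y +i* g2 y) x v /\
  cderive (fun y => g1 y +i* g2 y) x v = l1 +i* l2.
Proof.
move=> [d1 e1] [d2 e2]; split; first by split.
by rewrite /cderive /= -e1 -e2.
Qed.

Section solution.
Context {R : realType} {n k : nat}.
Variables (hn : (0 < n)%N) (f : 'rV[R]_(n + k) -> R[i]).
Hypothesis sf : schwartz f.
Let f1 x := complex.Re (f x).
Let f2 x := complex.Im (f x).
Let c := @kconst R n k.
Let u := kernel_solution f.

Let sf1 : rschwartz f1 := schwartz_Re sf.
Let sf2 : rschwartz f2 := schwartz_Im sf.
Let sf1N : rschwartz (\- f1) := rschwartzN sf1.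

(* The imaginary part of the solution for [f] is the real part of the one for
   [- i f], whose data are [(Im f, - Re f)]. *)
Definition ckint Q phi (x : 'rV[R]_(n + k)) (t : R) : R[i] :=
  kint f1 f2 Q phi (x, t) +i* kint f2 (\- f1) Q phi (x, t).

Lemma ckint_continuous Q phi (v : 'rV[R]_(n + k) -> R -> R[i]) : symbol Q ->
  (forall x t, 0 < t -> v x t = ckint Q phi x t) -> continuous_pos v.
Proof.
move=> sQ vE x t t0.
have near_t : \forall p \near (x, t), 0 < p.2.
  have c2 : q.2 @[q --> (x, t)] --> t by exact: cvg_snd.
  exact: (c2 _ (lt_nbhsr t0)).
split.
- have := @kint_continuous R n k f1 f2 sf1 sf2 hn Q phi (x, t) sQ t0.
  rewrite /= vE // /ckint /=; apply: cvg_trans; apply: near_eq_cvg.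
  by near=> p; rewrite vE /ckint /=; [case: (p) | near: p].
- have := @kint_continuous R n k f2 (\- f1) sf2 sf1N hn Q phi (x, t) sQ t0.
  rewrite /= vE // /ckint /=; apply: cvg_trans; apply: near_eq_cvg.
  by near=> p; rewrite vE /ckint /=; [case: (p) | near: p].
Unshelve. all: by end_near. Qed.

Let uE x t : 0 < t -> u x t = ckint (fun _ _ _ => c) 0 x t.
Proof. by move=> t0; exact: (kernel_solutionE hn t0 sf). Qed.

Lemma solution_partial1 j x t : 0 < t ->
  cderivable (u^~ t) x (dirv R j) /\
  space_partial j u x t = ckint (sym1 c j) (0 + dphase j) x t.
Proof.
move=> t0.
rewrite /space_partial /partial.
have -> : u^~ t = fun x => ckint (fun _ _ _ => c) 0 x t by apply/funext => y; exact: uE.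
exact: (cderive_pair (kint_derive1 sf1 sf2 hn c 0 j x t0) (kint_derive1 sf2 sf1N hn c 0 j x t0)).
Qed.

Lemma solution_partial2 i j x t : 0 < t ->
  cderivable ((space_partial j u)^~ t) x (dirv R i) /\
  space_partial i (space_partial j u) x t =
    ckint (sym2 c i j) (0 + dphase j + dphase i) x t.
Proof.
move=> t0.
rewrite {2}/space_partial /partial.
have -> : (space_partial j u)^~ t = fun x => ckint (sym1 c j) (0 + dphase j) x t.
  by apply/funext => y; have [_ ->] := solution_partial1 j y t0.
exact: (cderive_pair (kint_derive2 sf1 sf2 hn c _ i j x t0) (kint_derive2 sf2 sf1N hn c _ i j x t0)).
Qed.

Lemma solution_time x t : 0 < t ->
  cderivable (u x) t 1 /\ time_partial u x t = ckint (symt c) 0 x t.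
Proof.
move=> t0.
have d1 := kint_derivet sf1 sf2 hn c 0 x t0.
have d2 := kint_derivet sf2 sf1N hn c 0 x t0.
(* The formula for [u] holds at positive times only, so in [t] it is a local identity, whereas at
   fixed [t] it is an equality of functions of [x]. *)
have E : \forall s \near t, ckint (fun _ _ _ => c) 0 x s = u x s.
  by near=> s; rewrite uE //; near: s; exact: lt_nbhsr.
have [r1 r2] : is_derive t 1 (fun s => complex.Re (u x s)) (kint f1 f2 (symt c) 0 (x, t)) /\
    is_derive t 1 (fun s => complex.Im (u x s)) (kint f2 (\- f1) (symt c) 0 (x, t)).
  split.
    by apply: near_eq_is_derive d1; near=> s; rewrite -(near E s).
  by apply: near_eq_is_derive d2; near=> s; rewrite -(near E s).
split; first by split; exact: ex_derive.
by rewrite /time_partial /cderive; case: r1 => _ ->; case: r2 => _ ->.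
Unshelve. all: by end_near. Qed.

Lemma kernel_solution_solves : solves_cauchy_problem u f.
Proof.
split.
- split.
  + exact: (ckint_continuous (symbol_cst c) uE).
  + split; first by move=> x t t0; have [] := solution_time x t0.
    apply: (@ckint_continuous (symt c) 0 _ (symbolt c)) => x t t0.
    by have [] := solution_time x t0.
  + split; first by move=> i x t t0; have [] := solution_partial1 i x t0.
    move=> i; apply: (@ckint_continuous (sym1 c i) (0 + dphase i) _ (symbol1 c i)) => x t t0.
    by have [] := solution_partial1 i x t0.
  + split; first by move=> i j x t t0; have [] := solution_partial2 i j x t0.
    move=> i j; apply: (@ckint_continuous (sym2 c i j) (0 + dphase j + dphase i) _ (symbol2 c i j)) => x t t0.
    by have [] := solution_partial2 i j x t0.
- move=> x t t0.
  have e2 i : space_partial i (space_partial i u) x t =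
      ckint (sym2 c i i) (0 + dphase i + dphase i) x t.
    by have [] := solution_partial2 i i x t0.
  have [_ ->] := solution_time x t0.
  rewrite /laplacian_w /laplacian_s.
  under eq_bigr do rewrite e2.
  under [X in _ + _ * X - _]eq_bigr do rewrite e2.
  rewrite /ckint !sum_complex.
  have h1 := kint_heat sf1 sf2 hn c x t0.
  have h2 := kint_heat sf2 sf1N hn c x t0.
  apply/eqP; rewrite eq_complex /= !mul0r subr0 addr0.
  by rewrite h1 h2 eqxx.
- move=> x.
  have near0 : \forall t \near (0 : R)^'+, 0 < t by exact: nbhs_right_gt.
  split.
    have := @kint_initial R n k f1 f2 sf1 sf2 hn x c (@kconstV R n k).
    apply: cvg_trans; apply: near_eq_cvg.
    by near=> t; rewrite uE //; near: t.
  have := @kint_initial R n k f2 (\- f1) sf2 sf1N hn x c (@kconstV R n k).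
  apply: cvg_trans; apply: near_eq_cvg.
  by near=> t; rewrite uE //; near: t.
Unshelve. all: by end_near. Qed.

End solution.

Theorem theorem3p4 (R : realType) (n k : nat) (hn : (0 < n)%N) (hk : (0 < k)%N) :
  (forall (w w' : 'rV[R]_n) (s s' : 'rV[R]_k) (t : R), 0 < t ->
     cintegrable (lebesgue_tuple R k)
       (fun l => kernel_integrand w s w' s' t (vec l))) /\
  (forall f : 'rV[R]_(n + k) -> R[i], schwartz f ->
     (forall (w : 'rV[R]_n) (s : 'rV[R]_k) (t : R), 0 < t ->
        cintegrable (lebesgue_tuple R n \x lebesgue_tuple R k)%E
          (fun p => kernelB w s (vec p.1) (vec p.2) t *
                    f (row_mx (vec p.1) (vec p.2)))) /\
     solves_cauchy_problem (kernel_solution f) f).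
Proof.
split=> [w w' s s' t t0|f sf]; first exact: kernel_integrand_integrable.
split=> [w s t t0|]; first exact: kernelB_mul_integrable.
exact: kernel_solution_solves.
Qed.
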